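(* Let $n\ge 2$ be an integer, $s>5/2$, $u_0\in H^s(\mathbb{R})$, and assume $y_0=(1-\partial_x^2)u_0\ge0$. Let $u(t,x)$, $t\in[0,T)$, be the positive solution of the Cauchy problem for the generalized modified Camassa-Holm equation with initial datum $u_0$, and put $M(t)=\max_{x\in\mathbb{R}}u(t,x)$. Then for all $t\in[0,T)$, $$\frac{n(2-c_1)}{n+1}M^{2n+2}(t)-\frac{2-c_1}{2}M^{2n}(t)\,E(u)+F(u)\le 0,$$ where $$c_1=\frac12+\sum_{j=1}^{n+1}(-1)^{j+1}\frac{2j-3}{2(2j-1)}\binom{n+1}{j}.$$
   Context: The generalized modified Camassa-Holm (gmCH) equation is $y_t+\big((u^2-u_x^2)^n y\big)_x=0$, $y=u-u_{xx}$, $t\ge 0$, $x\in\mathbb{R}$. For $u_0\in H^s(\mathbb{R})$, $s>5/2$, the solution meant is the unique strong solution $u\in C([0,T);H^s(\mathbb{R}))\cap C^1([0,T);H^{s-1}(\mathbb{R}))$ with $u(0,\cdot)=u_0$, $T>0$ being its maximal existence time (local well-posedness is a known result). The functionals are (evaluated at $u=u(t,\cdot)$) $$E(u)=\int_{\mathbb{R}}(u^2+u_x^2)\,dx,$$ $$F(u)=\int_{\mathbb{R}}\Big(u^{2n+2}+\sum_{k=1}^{n}\frac{(-1)^{k+1}}{2k-1}\binom{n+1}{k}u^{2n-2k+2}u_x^{2k}+(-1)^n\frac{u_x^{2n+2}}{2n+1}\Big)dx.$$ *)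

(* Defs.v *)
From mathcomp Require Import all_boot all_order all_algebra.
From mathcomp Require Import all_classical all_reals all_analysis.

Set Implicit Arguments.
Unset Strict Implicit.
Unset Printing Implicit Defensive.
Import Order.TTheory GRing.Theory Num.Theory.
Import numFieldNormedType.Exports.

Local Open Scope classical_set_scope.
Local Open Scope ring_scope.

(* Real and imaginary parts of
     (2 pi)^(-1/2) \int_(-A)^A f(x) exp(- i x xi) dx. *)
Definition fourier_trunc_re (R : realType) (f : R -> R) (A xi : R) : R :=
  (Num.sqrt (2 * pi))^-1 *
  \int[@lebesgue_measure R]_(x in `[- A, A]) (f x * cos (x * xi)).

Definition fourier_trunc_im (R : realType) (f : R -> R) (A xi : R) : R :=
  - (Num.sqrt (2 * pi))^-1 *
  \int[@lebesgue_measure R]_(x in `[- A, A]) (f x * sin (x * xi)).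

(* The complex-valued function a + i b is a representative of the
   Fourier-Plancherel transform of the real function f of L^2: it is the limit
   in L^2 of the truncated Fourier integrals of f. *)
Definition is_fourier (R : realType) (f a b : R -> R) : Prop :=
  [/\ f \in Lfun (@lebesgue_measure R) 2%:E,
      measurable_fun [set: R] a, measurable_fun [set: R] b &
      Lnorm (@lebesgue_measure R) 2%:E
        (fun xi => (Num.sqrt ((a xi - fourier_trunc_re f A xi) ^+ 2
                            + (b xi - fourier_trunc_im f A xi) ^+ 2))%:E)
      @[A --> +oo] --> 0%E].

(* The norm of H^s(R) for s >= 0, where H^s is contained in L^2:
     ||f||_(H^s) = || (1 + xi^2)^(s/2) |f^(xi)| ||_(L^2).
   The transform is unique up to a null set, so that the infimum is over at most
   one value; it is +oo when f is not in L^2. *)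
Definition sobolev_norm (R : realType) (s : R) (f : R -> R) : \bar R :=
  ereal_inf [set N | exists a b : R -> R, is_fourier f a b /\
    N = Lnorm (@lebesgue_measure R) 2%:E
          (fun xi => ((1 + xi ^+ 2) `^ (s / 2)
                      * Num.sqrt (a xi ^+ 2 + b xi ^+ 2))%:E)].

Definition sobolev (R : realType) (s : R) : set (R -> R) :=
  [set f | (sobolev_norm s f < +oo)%E].

Definition time_interval (R : realType) (T : \bar R) : set R :=
  [set t | 0 <= t /\ (t%:E < T)%E].

(* v belongs to C(I; H^s). *)
Definition sobolev_continuous (R : realType) (s : R) (I : set R)
    (v : R -> R -> R) : Prop :=
  forall t0, I t0 ->
    sobolev s (v t0) /\
    sobolev_norm s (fun x => v t x - v t0 x)
      @[t --> within I (nbhs t0)] --> 0%E.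

(* v' is the derivative of v : I -> H^s, one-sided at an endpoint of I. *)
Definition sobolev_derivative (R : realType) (s : R) (I : set R)
    (v v' : R -> R -> R) : Prop :=
  forall t0, I t0 ->
    sobolev_norm s (fun x => (v t x - v t0 x) / (t - t0) - v' t0 x)
      @[t --> within (I `\ t0) (nbhs t0)] --> 0%E.

Definition test_function (R : realType) (phi : R -> R) : Prop :=
  (forall (k : nat) (x : R), derivable (derive1n k phi) x 1) /\
  (exists A : R, forall x, A < `|x| -> phi x = 0).

Definition momentum (R : realType) (v : R -> R) : R -> R :=
  fun x => v x - derive1n 2 v x.

(* u in C([0,T); H^s) \cap C^1([0,T); H^(s-1)) solves
     y_t + ((u^2 - u_x^2)^n y)_x = 0,  y = u - u_xx,  u(0,.) = u0.
   For every t the continuous representative u t of the class in H^s is used;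
   for s > 5/2 it is of class C^2, so that u_x and u_xx are classical
   derivatives. Since y_t = u_t - (u_t)_xx only lies in H^(s-3), the equation is
   understood, at each time, in the sense of distributions on R. *)
Definition strong_solution (R : realType) (n : nat) (s : R) (u0 : R -> R)
    (T : \bar R) (u : R -> R -> R) : Prop :=
  let I := time_interval T in
  [/\ (0 < T)%E,
      forall t, I t -> continuous (u t),
      sobolev_continuous s I u,
      u 0 = u0 &
      exists ut : R -> R -> R,
        [/\ sobolev_continuous (s - 1) I ut,
            sobolev_derivative (s - 1) I u ut &
            forall t, I t -> forall phi, test_function phi ->
              \int[@lebesgue_measure R]_x (ut t x * (phi x - derive1n 2 phi x))
              - \int[@lebesgue_measure R]_x
                  ((u t x ^+ 2 - derive1 (u t) x ^+ 2) ^+ n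
                   * momentum (u t) x * derive1 phi x) = 0]].

Definition maximal_strong_solution (R : realType) (n : nat) (s : R)
    (u0 : R -> R) (T : \bar R) (u : R -> R -> R) : Prop :=
  strong_solution n s u0 T u /\
  forall (T' : \bar R) (v : R -> R -> R),
    strong_solution n s u0 T' v -> (T' <= T)%E.

(* The maximum of v over R (0 by convention if it is not attained). *)
Definition max_value (R : realType) (v : R -> R) : R :=
  xget 0 [set m | range v m /\ ubound (range v) m].

Definition energyE (R : realType) (v : R -> R) : R :=
  \int[@lebesgue_measure R]_x (v x ^+ 2 + derive1 v x ^+ 2).

Definition energyF (R : realType) (n : nat) (v : R -> R) : R :=
  \int[@lebesgue_measure R]_x
    (v x ^+ (2 * n + 2)
     + \sum_(1 <= k < n.+1)
         (-1) ^+ k.+1 / (2 * k%:R - 1) * ('C(n.+1, k))%:R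
         * v x ^+ (2 * n - 2 * k + 2) * derive1 v x ^+ (2 * k)
     + (-1) ^+ n * (derive1 v x ^+ (2 * n + 2) / (2 * n%:R + 1))).

Definition coef_c1 (R : realType) (n : nat) : R :=
  2^-1 + \sum_(1 <= j < n.+2)
           (-1) ^+ j.+1 * ((2 * j%:R - 3) / (2 * (2 * j%:R - 1)))
           * ('C(n.+1, j))%:R.

(* Main.v *)
Require Import Defs.
From mathcomp Require Import all_boot all_order all_algebra.
From mathcomp Require Import all_classical all_reals all_analysis.
From mathcomp Require Import measurable_realfun.
From mathcomp Require Import ring lra zify.
(* Write M = u(t,xi) for the maximum, al = 2 - c_1, and let D be the density of F.
   Everything rests on the pointwise bound |u_x| <= u.  Given it, the recursion
     (2N+1) D_{N+1}(X,Y) = 2(N+1) X D_N(X,Y) - (X-Y)^{N+1}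
   for D_N as a polynomial in X = u^2, Y = u_x^2 yields
   D <= (al/2) u^(2n) (u^2 + u_x^2), so that by AM-GM
     (al/2) M^(2n) (u^2 + u_x^2) - D >= al (M^(2n) - u^(2n)) |u u_x| = |(H o u)'|,
   H(z) = al (M^(2n) z^2/2 - z^(2n+2)/(2n+2)).  Integrating on either side of xi,
   where u vanishes at both ends, gives 2 H(M), which is the claim.

   The bound |u_x| <= u holds when y >= 0, because e^x (u - u_x) has derivative e^x y
   and vanishes at -oo, and symmetrically for u + u_x.  That y >= 0 persists is a
   maximum principle for y_t + (a y)_x = 0.  As y solves this equation only weakly,
   it is applied to the window integrals of y, whose time derivative is the
   difference of the fluxes a y at the two end points.

   The Sobolev norm is defined through the L^2 Fourier transform; the classical
   regularity of u(t,.) and the uniform continuity in time follow from Fourier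
   inversion, proved by regularization with the Poisson kernel. *)

Set Implicit Arguments.
Unset Strict Implicit.
Unset Printing Implicit Defensive.
Import Order.TTheory GRing.Theory Num.Theory.
Import numFieldNormedType.Exports.
Local Open Scope classical_set_scope.
Local Open Scope ring_scope.

(** * Integrals over the real line *)

Section integrable_real.
Context {R : realType}.
Notation mu := (@lebesgue_measure R).

(** The constant [2 - c_1] is the value of the density polynomial at [X = Y = 1], that is, the
    weight of [F] where [|u_x| = u]. There every inequality of the argument is an equality: the
    dropped power [(X - Y)^(N+1)] vanishes and so does the AM-GM defect. Formally the peaked profile
    [M exp(-|x - xi|)] turns the claim into an equality, which is why the recursion may not lose any
    constant. The bound [Y <= X] gives that power its sign, and it also makes [D] integrable.

    The evolution enters only through the sign of [y]. As [y] lies in H^(s-2), it is continuous in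
    [x], but its time derivative is a distribution, so a minimum of [y] itself cannot be
    differentiated in time. A minimum over windows [[x, x + l]] can: stationarity in the two end
    points prescribes [y] there, and a bound on [a] then controls the flux. Windows range over an
    unbounded set, so a quadratic penalty is added to make the minimum exist; its growth in time
    absorbs the flux that the penalty itself creates. *)

Definition L1 (f : R -> R) := mu.-integrable [set: R] (EFin \o f).

Definition sqint (f : R -> R) :=
  measurable_fun [set: R] f /\ L1 (fun x => f x ^+ 2).

Lemma L1_meas f : L1 f -> measurable_fun [set: R] f.
Proof. by move=> /(measurable_int mu) /measurable_EFinP. Qed.

Lemma measurable_EFin_comp (f : R -> R) : measurable_fun [set: R] f ->
  measurable_fun [set: R] (EFin \o f).
Proof. by move=> mf; apply/measurable_EFinP. Qed.

Lemma L1_dom (f g : R -> R) : measurable_fun [set: R] f -> L1 g ->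
  (forall x, `|f x| <= g x) -> L1 f.
Proof.
move=> mf ig fg; apply: (le_integrable _ _ _ ig) => //.
  exact/measurable_EFinP.
by move=> x _; rewrite lee_fin (le_trans (fg x))// ler_norm.
Qed.

Lemma L1D f g : L1 f -> L1 g -> L1 (fun x => f x + g x).
Proof. by move=> If Ig; exact: (integrableD measurableT If Ig). Qed.

Lemma L1B f g : L1 f -> L1 g -> L1 (fun x => f x - g x).
Proof. by move=> If Ig; exact: (integrableB measurableT If Ig). Qed.

Lemma L1Z k f : L1 f -> L1 (fun x => k * f x).
Proof. by move=> If; exact: (integrableZl measurableT k If). Qed.

Lemma L1_norm f : L1 f -> L1 (fun x => `|f x|).
Proof. exact: integrable_norm. Qed.

Lemma L1_mul_bounded (f h : R -> R) C : L1 f -> measurable_fun [set: R] h ->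
  (forall x, `|h x| <= C) -> L1 (fun x => f x * h x).
Proof.
move=> If mh hC; apply: (@L1_dom _ (fun x => C * `|f x|)).
- by apply: measurable_funM => //; exact: L1_meas.
- exact/L1Z/L1_norm.
- by move=> x; rewrite normrM mulrC ler_wpM2r.
Qed.

Lemma le_int f g : L1 f -> L1 g -> (forall x, f x <= g x) ->
  \int[mu]_x f x <= \int[mu]_x g x.
Proof. by move=> If Ig fg; apply: le_Rintegral. Qed.

Lemma intZ k f : L1 f -> \int[mu]_x (k * f x) = k * \int[mu]_x f x.
Proof. by move=> If; rewrite RintegralZl. Qed.

Lemma intD f g : L1 f -> L1 g ->
  \int[mu]_x (f x + g x) = \int[mu]_x f x + \int[mu]_x g x.
Proof. by move=> If Ig; rewrite RintegralD. Qed.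

Lemma intB f g : L1 f -> L1 g ->
  \int[mu]_x (f x - g x) = \int[mu]_x f x - \int[mu]_x g x.
Proof. by move=> If Ig; rewrite RintegralB. Qed.

Lemma norm_int f : L1 f -> `|\int[mu]_x f x| <= \int[mu]_x `|f x|.
Proof. by move=> If; apply: le_normr_Rintegral. Qed.

Lemma L1_sqr_mul f g : sqint f -> sqint g -> L1 (fun x => f x * g x).
Proof.
move=> [mf If] [mg Ig].
apply: (@L1_dom _ (fun x => f x ^+ 2 + g x ^+ 2)) (L1D If Ig) _ => [|x].
  exact: measurable_funM.
rewrite normrM -(real_normK (num_real (f x))) -(real_normK (num_real (g x))).
have := sqr_ge0 (`|f x| - `|g x|); rewrite sqrrB.
have := mulr_ge0 (normr_ge0 (f x)) (normr_ge0 (g x)); lra.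
Qed.

(** Upper bounds [N] and [K] stand in for the norms. For positive bounds this is Young's inequality
    with weights [K' / (2 * N')] and [N' / (2 * K')]; a zero bound is reached by enlarging both
    slightly. *)
Lemma cauchy_schwarz f g N K : sqint f -> sqint g -> 0 <= N -> 0 <= K ->
  \int[mu]_x f x ^+ 2 <= N ^+ 2 -> \int[mu]_x g x ^+ 2 <= K ^+ 2 ->
  \int[mu]_x `|f x * g x| <= N * K.
Proof.
move=> f2 g2 N0 K0 fN gK.
apply/ler_addgt0Pr => e e0.
have pos (N' K' : R) : N <= N' -> K <= K' -> 0 < N' -> 0 < K' ->
    \int[mu]_x `|f x * g x| <= N' * K'.
  move=> NN KK N'0 K'0.
  have If := L1Z (K' / (2 * N')) f2.2; have Ig := L1Z (N' / (2 * K')) g2.2.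
  apply: (@le_trans _ _ (\int[mu]_x (K' / (2 * N') * f x ^+ 2
      + N' / (2 * K') * g x ^+ 2))).
    apply: le_int => [||x]; first exact/L1_norm/L1_sqr_mul.
      exact: L1D.
    rewrite normrM -(real_normK (num_real (f x))) -(real_normK (num_real (g x))).
    rewrite -subr_ge0.
    have -> : K' / (2 * N') * `|f x| ^+ 2 + N' / (2 * K') * `|g x| ^+ 2
        - `|f x| * `|g x| =
      (K' * `|f x| - N' * `|g x|) ^+ 2 / (2 * N' * K').
      by field; rewrite !gt_eqF.
    by rewrite divr_ge0 ?sqr_ge0// !mulr_ge0// ltW.
  rewrite RintegralD//= !RintegralZl//=; [|exact: g2.2|exact: f2.2].
  have fN' : \int[mu]_x f x ^+ 2 <= N' ^+ 2.
    by rewrite (le_trans fN)// ler_pXn2r// ?nnegrE// ltW.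
  have gK' : \int[mu]_x g x ^+ 2 <= K' ^+ 2.
    by rewrite (le_trans gK)// ler_pXn2r// ?nnegrE// ltW.
  apply: (@le_trans _ _ (K' / (2 * N') * N' ^+ 2 + N' / (2 * K') * K' ^+ 2)).
    by rewrite lerD// ler_wpM2l// divr_ge0 ?mulr_ge0// ltW.
  rewrite le_eqVlt; apply/orP; left; apply/eqP; field.
  by rewrite !gt_eqF.
(* As [d <= 1], the product [(N + d) * (K + d)] is at most [N * K + d * (N + K + 1)], hence at most
   [N * K + e]. *)
pose d := Num.min 1 (e / (N + K + 1)).
have d0 : 0 < d by rewrite lt_min ltr01 divr_gt0//; lra.
apply: (le_trans (pos (N + d) (K + d) _ _ _ _)); try lra.
have d1 : d <= 1 by rewrite ge_min lexx.
have de : d * (N + K + 1) <= e.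
  by rewrite -ler_pdivlMr ?ge_min ?lexx ?orbT//; lra.
have : d * d <= d * 1 by rewrite ler_wpM2l// ltW.
nra.
Qed.

Lemma dominated_cvg_int (f_ : nat -> R -> R) f g : (forall n, measurable_fun [set: R] (f_ n)) ->
  (forall x, f_ n x @[n --> \oo] --> f x) -> L1 g ->
  (forall n x, `|f_ n x| <= g x) ->
  L1 f /\ \int[mu]_x f_ n x @[n --> \oo] --> \int[mu]_x f x.
Proof.
move=> mf_ f_f Ig fg.
have mf : measurable_fun [set: R] f.
  exact: (measurable_fun_cvg mf_ (fun x _ => f_f x)).
have [||||If _ cf] := @dominated_convergence _ (measurableTypeR R) R mu _ measurableT
  (fun n => EFin \o f_ n) (EFin \o f) (EFin \o g) _ _ _ Ig _.
- by move=> n; exact: measurable_EFin_comp (mf_ n).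
- exact: measurable_EFin_comp mf.
- by apply: aeW => x _; apply: cvg_EFin; [exact: nearW|exact: f_f].
- by apply: aeW => x n _; rewrite lee_fin.
split => //; apply: fine_cvg; rewrite fineK//.
exact: integrable_fin_num.
Qed.

Lemma L1_restr D f : measurable D -> L1 f -> L1 (f \_ D).
Proof.
move=> mD If; apply: (@L1_dom _ (fun x => `|f x|)).
- exact: (measurable_restrictT f mD).1 (measurable_funTS (L1_meas If)).
- exact: L1_norm.
- by move=> x; rewrite patchE; case: ifPn; rewrite ?normr0.
Qed.

Lemma cvg_int_sym (f : R -> R) : L1 f ->
  \int[mu]_(x in `[- A, A]) f x @[A --> +oo] --> \int[mu]_x f x.
Proof.
move=> If; apply/(cvg_pinftyP _ (\int[mu]_x f x)) => a ay.
rewrite (_ : (fun n => _) = (fun n => \int[mu]_x (f \_ `[- a n, a n]) x)).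
  2: by apply/funext => n; rewrite Rintegral_mkcond.
apply: (dominated_cvg_int _ _ (L1_norm If) _).2 => [n|x|n x].
- by apply: L1_meas; apply: L1_restr.
- apply: cvg_near_cst; near=> n.
  rewrite patchE mem_set//= in_itv/= -ler_norml.
  by near: n; move/cvgryPge : ay; exact.
- by rewrite patchE; case: ifPn; rewrite ?normr0.
Unshelve. all: end_near. Qed.

Lemma cvge0_near_lt {T : Type} (F : set_system T) {FF : Filter F}
    (N : T -> \bar R) (e : R) : N x @[x --> F] --> 0%E -> 0 < e ->
  \forall x \near F, (N x < e%:E)%E.
Proof.
move=> N0 e0; apply: (N0 [set x | (x < e%:E)%E]).
by apply: open_nbhs_nbhs; split; [exact: open_ereal_lt_ereal|rewrite /= lte_fin].
Qed.

(** The passage from the extended-real [Lnorm] of the definitions to the real integrals of squares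
    in which the estimates are written. *)
Lemma Lnorm2_lt (h : R -> R) (e : R) : measurable_fun [set: R] h -> 0 < e ->
  (Lnorm mu 2%:E (EFin \o h) < e%:E)%E ->
  sqint h /\ \int[mu]_x h x ^+ 2 < e ^+ 2.
Proof.
move=> mh e0 he.
have hfun : h \in Lfun mu 2%:E.
  apply/andP; split; rewrite inE//=.
  by rewrite /finite_norm (lt_trans he)// ltry.
have Ih := Lfun2_integrable_sqr hfun.
split; first by split.
rewrite -lte_fin /Rintegral fineK ?integrable_fin_num//.
have := @poweR_Lnorm _ _ _ mu (EFin \o h) 2 (negbT (pnatr_eq0 R 2)).
rewrite (_ : (fun x => `|(EFin \o h) x| `^ 2)%E = (fun x => (h x ^+ 2)%:E)).
  2: by apply/funext => x; rewrite [(EFin \o h) x]/= abse_EFin poweR_EFin powR_mulrn// real_normK ?num_real.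
move=> <-; move: he; have := Lnorm_ge0 mu 2%:E (EFin \o h).
case: (Lnorm mu 2%:E (EFin \o h)) => [r||]//.
rewrite lee_fin lte_fin => r0 re; rewrite poweR_EFin lte_fin powR_mulrn//.
by rewrite ltrXn2r// ?nnegrE// ltW.
Qed.

End integrable_real.

Section calculus.
Context {R : realType}.
Notation mu := (@lebesgue_measure R).
Implicit Types (f g F G : R -> R).

Notation der f x d := (is_derive (x : R) (1 : R) f d).

Lemma derD f g (x a b : R) : der f x a -> der g x b ->
  der (fun z => f z + g z) x (a + b).
Proof. by move=> fa gb; exact: is_deriveD. Qed.

Lemma derB f g (x a b : R) : der f x a -> der g x b ->
  der (fun z => f z - g z) x (a - b).
Proof. by move=> fa gb; exact: is_deriveB. Qed.

Lemma derN f (x a : R) : der f x a -> der (fun z => - f z) x (- a).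
Proof. by move=> fa; exact: is_deriveN. Qed.

Lemma derM f g (x a b : R) : der f x a -> der g x b ->
  der (fun z => f z * g z) x (a * g x + f x * b).
Proof.
move=> fa gb; apply: (is_derive_eq (is_deriveM fa gb)).
by rewrite /GRing.scale/= addrC mulrC.
Qed.

Lemma derX f n (x a : R) : der f x a ->
  der (fun z => f z ^+ n.+1) x (n.+1%:R * f x ^+ n * a).
Proof.
move=> fa; elim: n => [|n IH].
  by apply: (is_derive_eq fa); rewrite expr0 !mul1r.
have -> : (fun z => f z ^+ n.+2) = (fun z => f z * f z ^+ n.+1).
  by apply/funext => z; rewrite exprS.
apply: (is_derive_eq (derM fa IH)).
rewrite -[n.+2]add1n natrD exprS; ring.
Qed.

Lemma der_cst (k x : R) : der (fun=> k) x 0.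
Proof. exact: is_derive_cst. Qed.

Lemma der_id (x : R) : der (fun z => z) x 1.
Proof. exact: is_derive_id. Qed.

Lemma derZ k f (x a : R) : der f x a -> der (fun z => k * f z) x (k * a).
Proof.
by move=> fa; apply: (is_derive_eq (derM (der_cst k x) fa)); rewrite mul0r add0r.
Qed.

Lemma der_comp f g (x a b : R) : der f (g x) a -> der g x b ->
  der (fun z => f (g z)) x (a * b).
Proof. by move=> fa gb; exact: is_derive1_comp. Qed.

Lemma der_cont f (x a : R) : der f x a -> {for x, continuous f}.
Proof.
by move=> fa; apply/differentiable_continuous/derivable1_diffP; apply: ex_derive.
Qed.

Lemma der_derive1 f (x a : R) : der f x a -> derive1 f x = a.
Proof. by move=> fa; rewrite derive1E derive_val. Qed.

Lemma derivable_der f (x : R) : derivable f x 1 -> der f x (derive1 f x).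
Proof. by move=> df; rewrite derive1E; exact/derivableP. Qed.

Lemma continuous_itv_integrable f (a b : R) :
  (forall x, a <= x <= b -> {for x, continuous f}) ->
  mu.-integrable `[a, b] (EFin \o f).
Proof.
move=> cf; apply: continuous_compact_integrable; first exact: segment_compact.
by apply: continuous_in_subspaceT => x; rewrite inE/= in_itv/=; exact: cf.
Qed.

Lemma FTC F f (a b : R) : a <= b -> (forall x, a <= x <= b -> der F x (f x)) ->
  (forall x, a <= x <= b -> {for x, continuous f}) ->
  \int[mu]_(x in `[a, b]) f x = F b - F a.
Proof.
rewrite le_eqVlt => /predU1P[<- _ _|ab dF cf].
  by rewrite set_itv1 Rintegral_set1 subrr.
rewrite /Rintegral (@continuous_FTC2 _ _ F)//.
- by apply: continuous_in_subspaceT => x; rewrite inE/= in_itv/=; exact: cf.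
- split.
  + move=> x; rewrite in_itv/= => /andP[/ltW ax /ltW xb].
    by apply: ex_derive; apply: dF; rewrite ax xb.
  + apply: cvg_at_right_filter; apply: der_cont (dF a _).
    by rewrite lexx ltW.
  + apply: cvg_at_left_filter; apply: der_cont (dF b _).
    by rewrite lexx ltW.
- move=> x; rewrite in_itv/= => /andP[/ltW ax /ltW xb].
  by apply: der_derive1; apply: dF; rewrite ax xb.
Qed.

Lemma int_itv_split f (a b c : R) : a <= b -> b <= c ->
  mu.-integrable `[a, c] (EFin \o f) ->
  \int[mu]_(x in `[a, c]) f x =
  \int[mu]_(x in `[a, b]) f x + \int[mu]_(x in `[b, c]) f x.
Proof.
move=> ab bc If.
have := @Rintegral_itvB _ f (BLeft a) (BRight c) b If.
rewrite !bnd_simp => /(_ ab bc) E.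
have Ibc : mu.-integrable `]b, c] (EFin \o f).
  by apply: integrableS If => //; apply: subset_itv; rewrite ?bnd_simp.
have := @Rintegral_itv_obnd_cbnd _ b (BRight c) f Ibc => <-.
by rewrite -E addrC subrK.
Qed.

Lemma nondecreasing_der F f (a b : R) : a <= b ->
  (forall x, a <= x <= b -> der F x (f x)) ->
  (forall x, a <= x <= b -> 0 <= f x) -> F a <= F b.
Proof.
rewrite le_eqVlt => /predU1P[->//|ab dF f0].
have [|x|c cab E] := @MVT _ F f a b ab.
- by move=> x; rewrite in_itv/= => /andP[/ltW ax /ltW xb]; apply: dF; rewrite ax xb.
- apply: continuous_in_subspaceT => {}x; rewrite inE/= in_itv/= => xab.
  exact: der_cont (dF x xab).
rewrite -subr_ge0 E mulr_ge0 ?subr_ge0 ?(ltW ab)// f0//.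
by move: cab; rewrite in_itv/= => /andP[/ltW -> /ltW ->].
Qed.

(** Monotone convergence along [[- n, n]]. Through bounded primitives it gives the integrability of
    the exponential, Poisson and power kernels. *)
Lemma L1_of_itv_bound f (C : R) : continuous f -> (forall x, 0 <= f x) ->
  (forall A : R, 0 <= A -> \int[mu]_(x in `[- A, A]) f x <= C) -> L1 f.
Proof.
move=> cf f0 fC.
have mf : measurable_fun [set: R] f by exact: continuous_measurable_fun.
apply/integrableP; split; first exact/measurable_EFinP.
under eq_integral do rewrite /= ger0_norm//.
pose I (n : nat) : set R := `[- n%:R, n%:R]%classic.
have IT : \bigcup_i I i = [set: R].
  rewrite -subTset => x _; exists (Num.bound `|x|) => //=.
  by rewrite /I/= in_itv/= -ler_norml ltW// archi_boundP.
rewrite -IT; apply: (@le_lt_trans _ _ C%:E); last by rewrite ltry.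
have ndI : nondecreasing_seq I.
  move=> m n mn; rewrite subsetEset => x; rewrite /I/= !in_itv/= -!ler_norml.
  by move=> /le_trans; apply; rewrite ler_nat.
have mI n : measurable (I n) by exact: measurable_itv.
have mfI n : measurable_fun (I n) (EFin \o f).
  by apply/measurable_EFinP; exact: measurable_funTS.
have cv := @ge0_nondecreasing_set_cvg_integral _ (measurableTypeR R) R I
  (EFin \o f) mu ndI mI mfI (fun n x _ => f0 x).
rewrite -(cvg_lim (@ereal_hausdorff R) cv); apply: lime_le.
  by apply/cvg_ex; eexists; exact: cv.
apply: nearW => n /=; rewrite -[leLHS]fineK ?lee_fin; first exact: fC.
have If : mu.-integrable (I n) (EFin \o f).
  by apply: continuous_itv_integrable => x _; exact: cf.
by apply: (@integrable_fin_num _ _ _ mu); [exact: measurable_itv|exact: If].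
Qed.

Lemma L1_primitive F f (C : R) : continuous f -> (forall x, 0 <= f x) ->
  (forall x, der F x (f x)) -> (forall x, `|F x| <= C) -> L1 f.
Proof.
move=> cf f0 dF FC; apply: (@L1_of_itv_bound _ (C + C)) => // A A0.
have -> : \int[mu]_(x in `[- A, A]) f x = F A - F (- A).
  have NAA : - A <= A by rewrite (le_trans _ A0)// oppr_le0.
  exact: (FTC NAA (fun x _ => dF x) (fun x _ => cf x)).
apply: (le_trans (ler_norm _)); apply: (le_trans (ler_normB _ _)).
exact: lerD.
Qed.

(* The integrand is the even extension of g restricted to the half line. *)
Lemma FTC_even G g (A : R) : 0 <= A -> (forall x : R, 0 <= x -> der G x (g x)) ->
  (forall x : R, 0 <= x -> {for x, continuous g}) ->
  \int[mu]_(x in `[- A, A]) g `|x| = 2 * (G A - G 0).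
Proof.
move=> A0 dG cg.
have cgn (x : R) : {for x, continuous (fun y => g `|y|)}.
  apply: (@continuous_comp _ _ _ (@Num.norm R R) g); first exact: norm_continuous.
  exact: cg.
rewrite (@int_itv_split _ _ 0)//; last 2 first.
- by lra.
- by apply: continuous_itv_integrable => x _; exact: cgn.
have -> : \int[mu]_(x in `[0, A]) g `|x| = G A - G 0.
  transitivity (\int[mu]_(x in `[0, A]) g x); last first.
    by apply: FTC => // x /andP[x0 _]; [exact: dG|exact: cg].
  by apply: eq_Rintegral => x; rewrite inE/= in_itv/= => /andP[x0 _]; rewrite ger0_norm.
have -> : \int[mu]_(x in `[- A, 0]) g `|x| = G A - G 0.
  have -> : G A - G 0 = (fun x => - G (- x)) 0 - (fun x => - G (- x)) (- A).
    by rewrite /= opprK oppr0 opprK addrC.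
  apply: (@FTC (fun x => - G (- x)) (fun x => g `|x|)) => [|x /andP[_ x0]|x _];
    [by rewrite oppr_le0| |exact: cgn].
  rewrite ler0_norm//.
  have dG' : der G (- x) (g (- x)) by apply: dG; rewrite oppr_ge0.
  apply: (is_derive_eq (derN (der_comp dG' (derN (der_id x))))).
  by rewrite mulrN mulr1 opprK.
by rewrite mulr_natl mulr2n.
Qed.

Lemma L1_even G g (C : R) : (forall x : R, 0 <= x -> der G x (g x)) ->
  (forall x : R, 0 <= x -> {for x, continuous g}) -> (forall x : R, 0 <= x -> 0 <= g x) ->
  (forall x : R, 0 <= x -> `|G x| <= C) -> L1 (fun x => g `|x|).
Proof.
move=> dG cg g0 GC; apply: (@L1_of_itv_bound _ (2 * (C + C))) => [x|x|A A0].
- apply: (@continuous_comp _ _ _ (@Num.norm R R) g); first exact: norm_continuous.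
  exact: cg.
- exact: g0.
- have -> : \int[mu]_(x in `[- A, A]) g `|x| = 2 * (G A - G 0) by exact: FTC_even.
  rewrite ler_pM2l//; apply: (le_trans (ler_norm _)).
  by apply: (le_trans (ler_normB _ _)); rewrite lerD// GC.
Qed.

End calculus.
Notation der f x d := (is_derive (x : _) 1 f d).

(** * Fourier inversion *)

Section kernels.
Context {R : realType}.
Notation mu := (@lebesgue_measure R).

(** Since [|K| <= 1], the double integrand is dominated by [|h x| * |eta xi|], whose iterated
    integral is finite. *)
Lemma fubini_kernel (h eta : R -> R) (K : R -> R -> R) : L1 h -> L1 eta ->
  measurable_fun [set: R * R] (fun z => K z.1 z.2) ->
  (forall x xi, `|K x xi| <= 1) ->
  \int[mu]_xi (eta xi * \int[mu]_x (h x * K x xi)) =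
  \int[mu]_x (h x * \int[mu]_xi (eta xi * K x xi)).
Proof.
move=> Ih Ieta mK K1.
have mh := L1_meas Ih; have meta := L1_meas Ieta.
have mK1 x : measurable_fun [set: R] (K x).
  exact: (measurableT_comp mK (pair1_measurable x)).
have mK2 xi : measurable_fun [set: R] (K ^~ xi).
  exact: (measurableT_comp mK (pair2_measurable xi)).
have IK1 x : L1 (fun xi => eta xi * K x xi) by exact: L1_mul_bounded.
have IK2 xi : L1 (fun x => h x * K x xi) by apply: (@L1_mul_bounded _ h (K ^~ xi) 1).
pose f (z : R * R) : \bar R := (h z.1 * (eta z.2 * K z.1 z.2))%:E.
have mf : measurable_fun [set: R * R] f.
  apply/measurable_EFinP; apply: measurable_funM.
    exact: (measurableT_comp mh measurable_fst).
  apply: measurable_funM => //.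
  exact: (measurableT_comp meta measurable_snd).
have If : (mu \x mu)%E.-integrable [set: R * R] f.
  apply/integrable12ltyP => //.
  apply: (@le_lt_trans _ _ (\int[mu]_x (`|h x| * \int[mu]_xi `|eta xi|)%:E)%E).
    apply: ge0_le_integral => //.
    - by move=> x _; exact: integral_ge0.
    - apply: (@measurable_fun_fubini_tonelli_F _ _ (measurableTypeR R)
        (measurableTypeR R) R mu (abse \o f)) => [|x] //=.
      exact: measurableT_comp.
    - apply/measurable_EFinP; apply: measurable_funM => //.
      exact: measurableT_comp.
    move=> x _.
    apply: (@le_trans _ _ (\int[mu]_xi (`|h x| * `|eta xi|)%:E)%E).
      apply: ge0_le_integral => //.
      - apply: measurableT_comp => //; apply/measurable_EFinP.
        exact: (L1_meas (L1Z (h x) (IK1 x))).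
      - by apply/measurable_EFinP; apply: measurable_funM => //; exact: measurableT_comp.
      - move=> xi _; rewrite /f/= lee_fin !normrM.
        by rewrite ler_wpM2l// ler_piMr.
    under eq_integral do rewrite EFinM.
    rewrite integralZl//; last exact: L1_norm Ieta.
    rewrite EFinM lee_wpmul2l ?lee_fin// /Rintegral fineK//.
    exact: integrable_fin_num (L1_norm Ieta).
  have := integrable_lty measurableT (L1Z (\int[mu]_xi `|eta xi|) (L1_norm Ih)).
  apply: le_lt_trans; rewrite le_eqVlt; apply/orP; left; apply/eqP.
  by apply: eq_integral => x _; rewrite /= mulrC.
have E1 : (\int[mu]_x (h x * \int[mu]_xi (eta xi * K x xi))%:E =
    \int[mu]_x \int[mu]_xi f (x, xi))%E.
  apply: eq_integral => x _; rewrite /f/=.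
  under [RHS]eq_integral do rewrite EFinM.
  rewrite integralZl//; last exact: IK1.
  rewrite EFinM /Rintegral fineK//.
  exact: integrable_fin_num (IK1 x).
have E2 : (\int[mu]_xi (eta xi * \int[mu]_x (h x * K x xi))%:E =
    \int[mu]_xi \int[mu]_x f (x, xi))%E.
  apply: eq_integral => xi _; rewrite /f/=.
  rewrite (_ : (fun x => _) = (fun x => (eta xi)%:E * (h x * K x xi)%:E)%E).
    2: by apply/funext => x; rewrite -EFinM mulrCA.
  rewrite integralZl//; last exact: IK2.
  rewrite EFinM /Rintegral fineK//.
  exact: integrable_fin_num (IK2 xi).
by rewrite {1 3}/Rintegral; congr fine; rewrite E1 E2; apply/esym/Fubini.
Qed.

Lemma continuous_kernel (h : R -> R) (K : R -> R -> R) : L1 h ->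
  (forall xi, measurable_fun [set: R] (K ^~ xi)) ->
  (forall x xi, `|K x xi| <= 1) -> (forall x, continuous (K x)) ->
  continuous (fun xi => \int[mu]_x (h x * K x xi)).
Proof.
move=> Ih mK K1 cK xi0.
have := @continuity_under_integral R _ _ mu (fun xi x => h x * K x xi) setT
  measurableT (xi0 - 1) (xi0 + 1) _ _ (fun x => `|h x|) (L1_norm Ih) _ xi0.
apply.
- by move=> xi _; apply: (@L1_mul_bounded _ h (K ^~ xi) 1).
- apply: aeW => x _ xi _ /=; apply: continuousM; first exact: cst_continuous.
  exact: cK.
- by move=> xi _; apply: aeW => x _; rewrite normrM ler_piMr.
- by rewrite inE/= in_itv/= ltrBlDr ltrDl ltr01.
Qed.

Lemma measurable_cosM (y : R) : measurable_fun [set: R] (fun x => cos (x * y)).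
Proof.
apply: continuous_measurable_fun => x.
apply: continuous_comp; last exact: continuous_cos.
exact: mulrr_continuous.
Qed.

Lemma measurable_sinM (y : R) : measurable_fun [set: R] (fun x => sin (x * y)).
Proof.
apply: continuous_measurable_fun => x.
apply: continuous_comp; last exact: continuous_sin.
exact: mulrr_continuous.
Qed.

Lemma norm_cos_le1 (x : R) : `|cos x| <= 1.
Proof. by rewrite ler_norml cos_geN1 cos_le1. Qed.

Lemma norm_sin_le1 (x : R) : `|sin x| <= 1.
Proof. by rewrite ler_norml sin_geN1 sin_le1. Qed.

Lemma continuous_cosM (x : R) : continuous (fun y => cos (x * y)).
Proof.
move=> y; apply: continuous_comp; last exact: continuous_cos.
exact: mulrl_continuous.
Qed.

Lemma continuous_sinM (x : R) : continuous (fun y => sin (x * y)).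
Proof.
move=> y; apply: continuous_comp; last exact: continuous_sin.
exact: mulrl_continuous.
Qed.

Lemma measurable_cos2 : measurable_fun [set: R * R] (fun z => cos (z.1 * z.2)).
Proof.
apply: (@measurableT_comp _ _ _ _ _ _ (@cos R)).
  by apply: continuous_measurable_fun; exact: continuous_cos.
exact: measurable_funM measurable_fst measurable_snd.
Qed.

Lemma measurable_sin2 : measurable_fun [set: R * R] (fun z => sin (z.1 * z.2)).
Proof.
apply: (@measurableT_comp _ _ _ _ _ _ (@sin R)).
  by apply: continuous_measurable_fun; exact: continuous_sin.
exact: measurable_funM measurable_fst measurable_snd.
Qed.

End kernels.

(** * Parseval pairing for the L^2 Fourier transform *)

Section multiplication_formula.
Context {R : realType}.
Notation mu := (@lebesgue_measure R).
Notation c := ((Num.sqrt (2 * pi))^-1 : R).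

(* Real part of [\int (p + i q)(xi) exp(i x xi) dxi]. *)
Definition fourier_kernel (p q : R -> R) (x : R) : R :=
  \int[mu]_xi (p xi * cos (x * xi)) - \int[mu]_xi (q xi * sin (x * xi)).

(** On a bounded interval [|f| <= f^2 + 1] is integrable, so the truncated Fourier integrals
    converge absolutely. *)
Lemma sqint_L1_itv (f : R -> R) A : sqint f -> L1 (f \_ `[- A, A]).
Proof.
move=> [mf If].
apply: (@L1_dom _ _ (fun x => f x ^+ 2 + \1_(`[- A, A]%classic) x)).
- exact: (measurable_restrictT f (measurable_itv _)).1 (measurable_funTS mf).
- by apply: L1D => //; apply: integrable_indic_itv.
- move=> x; rewrite patchE indicE; case: ifPn => _; last first.
    by rewrite normr0 addr0 sqr_ge0.
  rewrite -(real_normK (num_real (f x))).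
  have := sqr_ge0 (`|f x| - 1); have := normr_ge0 (f x); rewrite sqrrB /=; lra.
Qed.

Lemma fourier_trunc_reE (f : R -> R) A xi : fourier_trunc_re f A xi =
  c * \int[mu]_x ((f \_ `[- A, A]) x * cos (x * xi)).
Proof.
rewrite /fourier_trunc_re Rintegral_mkcond; congr (_ * _); congr Rintegral.
by apply/funext => x; rewrite !patchE; case: ifPn; rewrite ?mul0r.
Qed.

Lemma fourier_trunc_imE (f : R -> R) A xi : fourier_trunc_im f A xi =
  - c * \int[mu]_x ((f \_ `[- A, A]) x * sin (x * xi)).
Proof.
rewrite /fourier_trunc_im Rintegral_mkcond; congr (_ * _); congr Rintegral.
by apply/funext => x; rewrite !patchE; case: ifPn; rewrite ?mul0r.
Qed.

Lemma norm_trig_int (h : R -> R) (K : R -> R) : L1 h ->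
  measurable_fun [set: R] K -> (forall x, `|K x| <= 1) ->
  `|\int[mu]_x (h x * K x)| <= \int[mu]_x `|h x|.
Proof.
move=> Ih mK K1; have IK := L1_mul_bounded Ih mK K1.
apply: (le_trans (norm_int IK)); apply: le_int => [||x]; try exact: L1_norm.
by rewrite normrM ler_piMr.
Qed.

Lemma measurable_fourier_trunc_re (f : R -> R) A : sqint f ->
  measurable_fun [set: R] (fourier_trunc_re f A).
Proof.
move=> sf; rewrite (funext (fourier_trunc_reE f A)).
apply: measurable_funM => //; apply: continuous_measurable_fun.
apply: (@continuous_kernel _ _ (fun x xi => cos (x * xi))).
- exact: sqint_L1_itv.
- exact: measurable_cosM.
- by move=> *; exact: norm_cos_le1.
- exact: continuous_cosM.
Qed.

Lemma measurable_fourier_trunc_im (f : R -> R) A : sqint f ->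
  measurable_fun [set: R] (fourier_trunc_im f A).
Proof.
move=> sf; rewrite (funext (fourier_trunc_imE f A)).
apply: measurable_funM => //; apply: continuous_measurable_fun.
apply: (@continuous_kernel _ _ (fun x xi => sin (x * xi))).
- exact: sqint_L1_itv.
- exact: measurable_sinM.
- by move=> *; exact: norm_sin_le1.
- exact: continuous_sinM.
Qed.

Lemma L1_trig (h k : R -> R) (K : R -> R -> R) : L1 h -> L1 k ->
  (forall xi, measurable_fun [set: R] (K ^~ xi)) ->
  (forall x xi, `|K x xi| <= 1) -> (forall x, continuous (K x)) ->
  L1 (fun xi => k xi * \int[mu]_x (h x * K x xi)).
Proof.
move=> Ih Ik mK K1 cK.
apply: (@L1_mul_bounded _ _ _ (\int[mu]_x `|h x|)) => //.
  by apply: continuous_measurable_fun; exact: continuous_kernel.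
by move=> xi; apply: norm_trig_int.
Qed.

(** Fubini carries the truncated transform over to [p] and [q]; the minus sign of the imaginary part
    becomes the one in [fourier_kernel]. *)
Lemma fourier_trunc_pairing (f p q : R -> R) A : sqint f -> L1 p -> L1 q ->
  [/\ L1 (fun xi => p xi * fourier_trunc_re f A xi),
      L1 (fun xi => q xi * fourier_trunc_im f A xi) &
   \int[mu]_xi (p xi * fourier_trunc_re f A xi) +
   \int[mu]_xi (q xi * fourier_trunc_im f A xi) =
   c * \int[mu]_(x in `[- A, A]) (f x * fourier_kernel p q x)].
Proof.
move=> f2 Ip Iq; have Ih := sqint_L1_itv A f2; set h := f \_ _ in Ih.
have Ic := L1_trig Ih Ip (@measurable_cosM R) (fun x xi => norm_cos_le1 _)
  (@continuous_cosM R).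
have Is := L1_trig Ih Iq (@measurable_sinM R) (fun x xi => norm_sin_le1 _)
  (@continuous_sinM R).
have Ec : (fun xi => p xi * fourier_trunc_re f A xi) = (fun xi => c *
    (p xi * \int[mu]_x (h x * cos (x * xi)))).
  by apply/funext => xi; rewrite fourier_trunc_reE mulrCA.
have Es : (fun xi => q xi * fourier_trunc_im f A xi) = (fun xi => - c *
    (q xi * \int[mu]_x (h x * sin (x * xi)))).
  by apply/funext => xi; rewrite fourier_trunc_imE mulrCA.
rewrite Ec Es; split; try exact: L1Z.
rewrite (intZ _ Ic) (intZ _ Is).
rewrite (fubini_kernel Ih Ip measurable_cos2 (fun x xi => norm_cos_le1 _)).
rewrite (fubini_kernel Ih Iq measurable_sin2 (fun x xi => norm_sin_le1 _)).
rewrite mulNr -mulrBr; congr (_ * _).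
rewrite -intB; last 2 first.
- apply: (L1_trig Ip Ih (K := fun xi x => cos (x * xi))) => [x|//|xi].
  + by under eq_fun do rewrite mulrC; exact: measurable_cosM.
  + by move=> *; exact: norm_cos_le1.
  + by under eq_fun do rewrite mulrC; exact: continuous_cosM.
- apply: (L1_trig Iq Ih (K := fun xi x => sin (x * xi))) => [x|//|y].
  + by under eq_fun do rewrite mulrC; exact: measurable_sinM.
  + by move=> *; exact: norm_sin_le1.
  + by under eq_fun do rewrite mulrC; exact: continuous_sinM.
rewrite [RHS]Rintegral_mkcond; congr Rintegral; apply/funext => x.
rewrite -mulrBr /h !patchE; case: ifPn => _ //; by rewrite mul0r.
Qed.

(** The truncated integrals of [f] times the kernel have two limits: the left-hand side, because the
    truncated transforms converge in L^2 and [p], [q] are square integrable, and the right-hand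
    side, because [f] times the kernel is integrable. *)
Lemma multiplication_formula (f a b p q : R -> R) : is_fourier f a b ->
  sqint a -> sqint b -> L1 p -> L1 q -> sqint p -> sqint q ->
  sqint (fourier_kernel p q) ->
  \int[mu]_xi (p xi * a xi) + \int[mu]_xi (q xi * b xi) =
  c * \int[mu]_x (f x * fourier_kernel p q x).
Proof.
move=> [f2 _ _ cvf] a2 b2 Ip Iq p2 q2 k2.
have sf : sqint f.
  split; last exact: Lfun2_integrable_sqr f2.
  by move: f2 => /andP[]; rewrite inE.
set L := LHS.
pose P := \int[mu]_xi p xi ^+ 2; pose Q := \int[mu]_xi q xi ^+ 2.
have P0 : 0 <= P by apply: Rintegral_ge0 => x _; exact: sqr_ge0.
have Q0 : 0 <= Q by apply: Rintegral_ge0 => x _; exact: sqr_ge0.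
have close (e : R) : 0 < e -> \forall A \near +oo,
   `|L - c * \int[mu]_(x in `[- A, A]) (f x * fourier_kernel p q x)| <=
   e * (Num.sqrt P + Num.sqrt Q).
  move=> e0.
  have : \forall A \near +oo, (Lnorm mu 2%:E (fun xi =>
     (Num.sqrt ((a xi - fourier_trunc_re f A xi) ^+ 2
             + (b xi - fourier_trunc_im f A xi) ^+ 2))%:E) < e%:E)%E.
    exact: cvge0_near_lt.
  apply: filterS => A.
  pose h xi := Num.sqrt ((a xi - fourier_trunc_re f A xi) ^+ 2
             + (b xi - fourier_trunc_im f A xi) ^+ 2).
  rewrite -/(EFin \o h) => hA.
  have mre : measurable_fun [set: R] (fun xi => a xi - fourier_trunc_re f A xi).
    apply: measurable_funB; first exact: a2.1.
    exact: measurable_fourier_trunc_re.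
  have mim : measurable_fun [set: R] (fun xi => b xi - fourier_trunc_im f A xi).
    apply: measurable_funB; first exact: b2.1.
    exact: measurable_fourier_trunc_im.
  have mh : measurable_fun [set: R] h.
    apply: (@measurableT_comp _ _ _ _ _ _ (@Num.sqrt R)).
      by apply: continuous_measurable_fun; exact: sqrt_continuous.
    by apply: measurable_funD; exact: measurable_funX.
  have [[_ Ih] he] := Lnorm2_lt mh e0 hA.
  have hE xi : h xi ^+ 2 = (a xi - fourier_trunc_re f A xi) ^+ 2
             + (b xi - fourier_trunc_im f A xi) ^+ 2.
    by rewrite sqr_sqrtr// addr_ge0 ?sqr_ge0.
  have sre : sqint (fun xi => a xi - fourier_trunc_re f A xi).
    split => //; apply: (L1_dom _ Ih) => [|xi]; first exact: measurable_funX.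
    by rewrite ger0_norm ?sqr_ge0// hE lerDl sqr_ge0.
  have sim : sqint (fun xi => b xi - fourier_trunc_im f A xi).
    split => //; apply: (L1_dom _ Ih) => [|xi]; first exact: measurable_funX.
    by rewrite ger0_norm ?sqr_ge0// hE lerDr sqr_ge0.
  have [Ire Iim <-] := fourier_trunc_pairing A sf Ip Iq.
  rewrite /L opprD addrACA.
  rewrite -!intB//; try exact: L1_sqr_mul.
  have E (k l m : R -> R) : (fun xi => k xi * l xi - k xi * m xi) =
    (fun xi => k xi * (l xi - m xi)) by apply/funext => xi; rewrite mulrBr.
  rewrite !E.
  apply: (le_trans (ler_normD _ _)); rewrite mulrDr !(mulrC e); apply: lerD.
    apply: (le_trans (norm_int (L1_sqr_mul p2 sre))).
    apply: cauchy_schwarz => //; [exact: ltW|by rewrite sqr_sqrtr|].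
    apply: (le_trans _ (ltW he)); apply: le_int => [||xi]; [exact: sre.2|exact: Ih|].
    by rewrite hE lerDl sqr_ge0.
  apply: (le_trans (norm_int (L1_sqr_mul q2 sim))).
  apply: cauchy_schwarz => //; [exact: ltW|by rewrite sqr_sqrtr|].
  apply: (le_trans _ (ltW he)); apply: le_int => [||xi]; [exact: sim.2|exact: Ih|].
  by rewrite hE lerDr sqr_ge0.
have cv1 : c * \int[mu]_(x in `[- A, A]) (f x * fourier_kernel p q x) @[A --> +oo]
    --> c * \int[mu]_x (f x * fourier_kernel p q x).
  apply: cvgM; first exact: cvg_cst.
  by apply: cvg_int_sym; exact: L1_sqr_mul.
have cv2 : c * \int[mu]_(x in `[- A, A]) (f x * fourier_kernel p q x) @[A --> +oo]
    --> L.
  apply/cvgrPdist_le => e e0.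
  have e1 : 0 < e / (Num.sqrt P + Num.sqrt Q + 1).
    by rewrite divr_gt0// ltr_wpDl// addr_ge0 ?sqrtr_ge0.
  apply: filterS (close _ e1) => A /le_trans; apply.
  rewrite mulrAC ler_pdivrMr; last by rewrite ltr_wpDl// addr_ge0 ?sqrtr_ge0.
  by rewrite ler_pM2l// lerDl.
exact: (cvg_unique _ cv2 cv1).
Qed.

End multiplication_formula.

(** * Fourier inversion by Poisson means *)

Section inversion.
Context {R : realType}.
Notation mu := (@lebesgue_measure R).
Notation c := ((Num.sqrt (2 * pi))^-1 : R).
Implicit Types (e x z : R).

Lemma expRNM_cvg0 e : 0 < e -> expR (- (e * A)) @[A --> +oo] --> (0 : R).
Proof.
move=> e0; apply/cvgrPdist_lt => d d0; near=> A.
rewrite sub0r normrN ger0_norm ?expR_ge0//.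
have A0 : 0 < A by near: A; exact: nbhs_pinfty_gt.
rewrite expRN invf_plt ?posrE ?expR_gt0//.
apply: (lt_le_trans _ (expR_ge1Dx _)).
rewrite ltr_wpDl// -ltr_pdivrMl//.
near: A; apply: nbhs_pinfty_gt; exact: num_real.
Unshelve. all: end_near. Qed.

Lemma der_exp_aff e x : der (fun y => expR (- (e * y))) x (- e * expR (- (e * x))).
Proof.
have d1 := derN (derZ e (der_id x)).
apply: (is_derive_eq (der_comp (is_derive_expR _) d1)).
by rewrite mulr1 mulrC.
Qed.

Lemma continuous_der (f g : R -> R) : (forall x, der f x (g x)) -> continuous f.
Proof. by move=> df x; exact: der_cont (df x). Qed.

Lemma L1_exp_abs e : 0 < e -> L1 (fun x => expR (- (e * `|x|))).
Proof.
move=> e0; apply: (@L1_even _ (fun x => - e^-1 * expR (- (e * x)))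
   (fun x => expR (- (e * x))) e^-1).
- move=> x x0; apply: (is_derive_eq (derZ _ (der_exp_aff e x))).
  by rewrite mulrA mulNr mulrN opprK mulVf ?gt_eqF// mul1r.
- by move=> x x0; exact: der_cont (der_exp_aff e x).
- by move=> x x0; exact: expR_ge0.
- move=> x x0; have ei : 0 <= e^-1 by rewrite invr_ge0 ltW.
  rewrite normrM normrN (ger0_norm ei) ger0_norm ?expR_ge0// ler_piMr//.
  by rewrite -expR0 ler_expR oppr_le0 mulr_ge0// ltW.
Qed.

Lemma der_cosM z x : der (fun y => cos (z * y)) x (- (z * sin (z * x))).
Proof.
apply: (is_derive_eq (der_comp (is_derive_cos _) (derZ z (der_id x)))).
by rewrite mulr1 mulNr mulrC.
Qed.

Lemma der_sinM z x : der (fun y => sin (z * y)) x (z * cos (z * x)).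
Proof.
apply: (is_derive_eq (der_comp (is_derive_sin _) (derZ z (der_id x)))).
by rewrite mulr1 mulrC.
Qed.

(** The Fourier transform of [exp(- e |x|)]: the Poisson kernel of the half-plane at height [e],
    scaled to have total mass [2 * pi]. *)
Definition poisson e z : R := 2 * e / (e ^+ 2 + z ^+ 2).

Lemma int_exp_cos e z : 0 < e ->
  \int[mu]_x (expR (- (e * `|x|)) * cos (z * x)) = poisson e z.
Proof.
move=> e0.
have D0 : 0 < e ^+ 2 + z ^+ 2 by rewrite ltr_pwDl ?exprn_gt0 ?sqr_ge0.
pose g x := expR (- (e * x)) * cos (z * x).
(* [G] is the real part of [exp((- e + i z) x) / (- e + i z)], a primitive of [g] that vanishes at
   [+oo]. *)
pose G x := expR (- (e * x)) * ((z * sin (z * x) - e * cos (z * x)) / (e ^+ 2 + z ^+ 2)).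
have gE : (fun x => expR (- (e * `|x|)) * cos (z * x)) = (fun x => g `|x|).
  apply/funext => x; rewrite /g; congr (_ * _).
  by case: (ger0P x) => // _; rewrite mulrN cosN.
have dg x := derM (der_exp_aff e x) (der_cosM z x).
have dG x : der G x (g x).
  have d2 := derB (derZ z (der_sinM z x)) (derZ e (der_cosM z x)).
  have d3 := derM d2 (der_cst (e ^+ 2 + z ^+ 2)^-1 x).
  apply: (is_derive_eq (derM (der_exp_aff e x) d3)); rewrite /g.
  by field; rewrite gt_eqF.
have Ig : L1 (fun x => expR (- (e * `|x|)) * cos (z * x)).
  apply: (L1_mul_bounded (L1_exp_abs e0)) => [|x]; last exact: norm_cos_le1.
  by under eq_fun do rewrite mulrC; exact: measurable_cosM.
have cv1 := cvg_int_sym Ig.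
have G0 : 2 * (0 - G 0) = poisson e z.
  rewrite /G !mulr0 sin0 cos0 oppr0 expR0 /poisson; field.
  by rewrite gt_eqF.
have cvG : G A @[A --> +oo] --> (0 : R).
  apply: norm_cvg0.
  have nearG : \forall A \near +oo, cst 0 A <= `|G A| <=
      expR (- (e * A)) * ((`|z| + e) / (e ^+ 2 + z ^+ 2)).
    near=> A; rewrite normr_ge0/= normrM ger0_norm ?expR_ge0// ler_wpM2l ?expR_ge0//.
    rewrite normrM normfV (gtr0_norm D0) ler_pM2r ?invr_gt0//.
    apply: (le_trans (ler_normB _ _)); rewrite !normrM (ger0_norm (ltW e0)).
    by rewrite lerD// ler_piMr ?norm_sin_le1 ?norm_cos_le1// ltW.
  apply: (squeeze_cvgr nearG); first exact: cvg_cst.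
  rewrite -[X in _ --> X](mul0r ((`|z| + e) / (e ^+ 2 + z ^+ 2))).
  by apply: cvgM; [exact: expRNM_cvg0|exact: cvg_cst].
have cv2 : \int[mu]_(x in `[- A, A]) (expR (- (e * `|x|)) * cos (z * x)) @[A --> +oo]
    --> poisson e z.
  have : 2 * (G A - G 0) @[A --> +oo] --> poisson e z.
    by rewrite -G0; apply: cvgM; [exact: cvg_cst|apply: cvgB; [exact: cvG|exact: cvg_cst]].
  apply: cvg_trans; apply: near_eq_cvg; near=> A.
  have A0 : 0 <= A by near: A; apply: nbhs_pinfty_ge.
  rewrite gE; apply/esym.
  exact: (FTC_even A0 (fun x _ => dG x) (fun x _ => der_cont (dg x))).
exact: (cvg_unique _ cv1 cv2).
Unshelve. all: end_near. Qed.

Lemma poisson_gt0 e z : 0 < e -> 0 < poisson e z.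
Proof.
by move=> e0; rewrite divr_gt0 ?mulr_gt0// ltr_pwDl ?exprn_gt0 ?sqr_ge0.
Qed.

Lemma der_poisson e x0 x : 0 < e ->
  der (fun y => 2 * atan ((y - x0) / e)) x (poisson e (x - x0)).
Proof.
move=> e0.
have d1 := derM (derB (der_id x) (der_cst x0 x)) (der_cst e^-1 x).
apply: (is_derive_eq (derZ 2 (der_comp (is_derive1_atan _) d1))).
rewrite /poisson; field; rewrite !gt_eqF// ltr_pwDl ?exprn_gt0 ?sqr_ge0//.
Qed.

Lemma continuous_poisson e x0 : 0 < e -> continuous (fun x => poisson e (x - x0)).
Proof.
move=> e0 x; apply: cvgM; first exact: cvg_cst.
apply: cvgV; first by rewrite gt_eqF// ltr_pwDl ?exprn_gt0 ?sqr_ge0.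
apply: cvgD; first exact: cvg_cst.
have d1 := derX 1 (derB (der_id x) (der_cst x0 x)).
exact: der_cont d1.
Qed.

Lemma L1_poisson e x0 : 0 < e -> L1 (fun x => poisson e (x - x0)).
Proof.
move=> e0; apply: (@L1_primitive _ (fun y => 2 * atan ((y - x0) / e)) _ pi).
- exact: continuous_poisson.
- by move=> x; exact/ltW/poisson_gt0.
- by move=> x; exact: der_poisson.
- move=> x; rewrite normrM ger0_norm//.
  have := @atan_ltpi2 R ((x - x0) / e); have := @atan_gtNpi2 R ((x - x0) / e).
  rewrite -ler_pdivlMl// mulrC ler_norml => /ltW -> /ltW ->//.
Qed.

Lemma sqint_poisson e x0 : 0 < e -> sqint (fun x => poisson e (x - x0)).
Proof.
move=> e0; have IP := L1_poisson x0 e0; have mP := L1_meas IP.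
split => //; under eq_fun do rewrite expr2.
apply: (@L1_mul_bounded _ _ _ (2 / e) IP mP) => x.
rewrite (gtr0_norm (poisson_gt0 _ e0)) /poisson.
rewrite ler_pdivrMr ?ltr_pwDl ?exprn_gt0 ?sqr_ge0// mulrDr.
have -> : 2 / e * e ^+ 2 = 2 * e by field; rewrite gt_eqF.
by rewrite lerDl mulr_ge0 ?sqr_ge0// divr_ge0// ltW.
Qed.

Lemma int_poisson e x0 : 0 < e -> \int[mu]_x poisson e (x - x0) = 2 * pi.
Proof.
move=> e0; have cv1 := cvg_int_sym (L1_poisson x0 e0).
have cvp : (A - x0) / e @[A --> +oo] --> +oo.
  apply/cvgryPge => M; near=> A; rewrite ler_pdivlMr// lerBrDr.
  by near: A; apply: nbhs_pinfty_ge; exact: num_real.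
have cvn : (A + x0) / e @[A --> +oo] --> +oo.
  apply/cvgryPge => M; near=> A; rewrite ler_pdivlMr// -lerBlDr.
  by near: A; apply: nbhs_pinfty_ge; exact: num_real.
have cv2 : \int[mu]_(x in `[- A, A]) poisson e (x - x0) @[A --> +oo] --> 2 * pi.
  have : 2 * atan ((A - x0) / e) + 2 * atan ((A + x0) / e) @[A --> +oo] --> 2 * pi.
    have -> : 2 * pi = 2 * (pi / 2) + 2 * (pi / 2) :> R by field.
    apply: cvgD; (apply: cvgM; first exact: cvg_cst).
    - exact: (cvg_comp _ _ cvp (@cvgy_atan R)).
    - exact: (cvg_comp _ _ cvn (@cvgy_atan R)).
  apply: cvg_trans; apply: near_eq_cvg; near=> A.
  have A0 : - A <= A by rewrite -subr_ge0 opprK addr_ge0//; near: A; apply: nbhs_pinfty_ge.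
  have -> := FTC A0 (fun x _ => der_poisson x0 x e0) (fun x _ => @continuous_poisson e x0 e0 x).
  by rewrite -opprD mulNr atanN mulrN opprK.
exact: (cvg_unique _ cv1 cv2).
Unshelve. all: end_near. Qed.

(** Away from 0 the kernel is of order [e] in two senses: the constant bound is to be paired with
    the integrable [f^2], the bound by [poisson 1] with a constant. *)
Lemma poisson_tail e (d : R) z : 0 < e -> 0 < d -> d <= `|z| ->
  poisson e z <= e * (2 / d ^+ 2) /\ poisson e z <= e * (1 + d ^- 2) * poisson 1 z.
Proof.
move=> e0 d0 dz.
have dz2 : d ^+ 2 <= z ^+ 2.
  by rewrite -(real_normK (num_real z)) ler_pXn2r ?nnegrE ?normr_ge0// ltW.
have d2 : 0 < d ^+ 2 by rewrite exprn_gt0.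
have z2 : 0 < z ^+ 2 by exact: lt_le_trans dz2.
have ez : 0 < e ^+ 2 + z ^+ 2 by rewrite ltr_pwDl ?exprn_gt0 ?sqr_ge0.
rewrite /poisson; split.
  rewrite [2 * e]mulrC -mulrA ler_pM2l// ler_pM2l//.
  rewrite lef_pV2 ?posrE// (le_trans dz2)// lerDr sqr_ge0//.
have -> : e * (1 + d ^- 2) * (2 * 1 / (1 ^+ 2 + z ^+ 2)) =
   2 * e * ((1 + d ^- 2) / (1 + z ^+ 2)) by rewrite expr1n mulr1; ring.
rewrite ler_pM2l ?mulr_gt0// ler_pdivlMr; last by rewrite ltr_pwDl ?sqr_ge0.
rewrite mulrC ler_pdivrMr//.
have h : 1 <= d ^- 2 * z ^+ 2 by rewrite mulrC ler_pdivlMr// mul1r.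
have : 0 <= (1 + d ^- 2) * e ^+ 2 by rewrite mulr_ge0 ?sqr_ge0// addr_ge0// invr_ge0 ltW.
rewrite mulrDr [(1 + _) * z ^+ 2]mulrDl mul1r; lra.
Qed.

(** Near [x0] continuity applies. Far away [f] is only square integrable, so [|f x - f x0|] is
    bounded by [f x ^+ 2 + (|f x0| + 1)], and each summand meets its own bound from
    [poisson_tail]. *)
Lemma poisson_approx (f : R -> R) x0 : sqint f -> {for x0, continuous f} ->
  \int[mu]_x (f x * poisson e (x - x0)) @[e --> 0^'+] --> 2 * pi * f x0.
Proof.
move=> [mf If] cf; apply/cvgrPdist_le => eta eta0.
(* The kernel has mass [2 * pi], so the part near [x0] contributes at most [eta / 2]; the far part
   is [e * C], made small by the choice of [e]. *)
pose et := eta / (4 * pi).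
have pi0 : 0 < pi :> R := pi_gt0 R.
have et0 : 0 < et by rewrite divr_gt0// mulr_gt0.
move/cvgrPdist_le : cf => /(_ _ et0) [d /= d0 fd].
pose K1 := 2 / d ^+ 2; pose K2 := (`|f x0| + 1) * (1 + d ^- 2).
have K10 : 0 <= K1 by rewrite divr_ge0// exprn_ge0// ltW.
have K20 : 0 <= K2 by rewrite mulr_ge0 ?addr_ge0// invr_ge0 exprn_ge0// ltW.
pose C := K1 * \int[mu]_x (f x ^+ 2) + K2 * (2 * pi).
have C0 : 0 <= C.
  apply: addr_ge0; apply: mulr_ge0 => //; last by rewrite mulr_ge0// ltW.
  by apply: Rintegral_ge0 => x _; rewrite sqr_ge0.
near=> e.
have e0 : 0 < e by near: e; exact: nbhs_right_gt.
have IP := L1_poisson x0 e0.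
have sP := sqint_poisson x0 e0.
have IfP : L1 (fun x => f x * poisson e (x - x0)) by exact: L1_sqr_mul.
rewrite -(int_poisson x0 e0) -mulrC -intZ// -intB//; last exact: L1Z.
apply: (le_trans (norm_int _)); first by apply: L1B => //; exact: L1Z.
apply: (@le_trans _ _ (\int[mu]_x (et * poisson e (x - x0) +
   (e * K1 * f x ^+ 2 + e * K2 * poisson 1 (x - x0))))).
  apply: le_int => [||x].
  - by apply: L1_norm; apply: L1B => //; exact: L1Z.
  - by apply: L1D; [exact: L1Z|apply: L1D; apply: L1Z => //; exact: L1_poisson].
  have P0 := poisson_gt0 (x - x0) e0.
  have P1 := poisson_gt0 (x - x0) (@ltr01 R).
  rewrite -mulrBl normrM (ger0_norm (ltW P0)).
  have [xd|dx] := ltP `|x0 - x| d.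
    apply: (@le_trans _ _ (et * poisson e (x - x0))).
      by rewrite ler_wpM2r//; [exact: ltW|exact: fd].
    rewrite lerDl; have eK1 := mulr_ge0 (ltW e0) K10; have eK2 := mulr_ge0 (ltW e0) K20.
    exact: addr_ge0 (mulr_ge0 eK1 (sqr_ge0 _)) (mulr_ge0 eK2 (ltW P1)).
  rewrite distrC in dx; have [t1 t2] := poisson_tail e0 d0 dx.
  apply: (@le_trans _ _ ((f x ^+ 2 + (`|f x0| + 1)) * poisson e (x - x0))).
    apply: ler_wpM2r; first exact: ltW.
    apply: (le_trans (ler_normB _ _)).
    rewrite -(real_normK (num_real (f x))); have := sqr_ge0 (`|f x| - 1); have := normr_ge0 (f x).
    rewrite sqrrB; lra.
  rewrite mulrDl.
  have h1 : f x ^+ 2 * poisson e (x - x0) <= e * K1 * f x ^+ 2.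
    by rewrite mulrC; apply: ler_wpM2r => //; exact: sqr_ge0.
  have h2 : (`|f x0| + 1) * poisson e (x - x0) <= e * K2 * poisson 1 (x - x0).
    have -> : e * K2 * poisson 1 (x - x0) = (`|f x0| + 1) * (e * (1 + d ^- 2) * poisson 1 (x - x0)).
      by rewrite /K2; ring.
    by apply: ler_wpM2l => //; exact: addr_ge0.
  have h3 := mulr_ge0 (ltW et0) (ltW P0).
  lra.
have I1 := L1_poisson x0 (@ltr01 R).
rewrite intD; [|exact: L1Z|by apply: L1D; exact: L1Z].
rewrite intD; [|exact: L1Z|exact: L1Z].
rewrite (intZ _ IP) (intZ _ If) (intZ _ I1) !int_poisson//.
have half (h p : R) : 0 < p -> h / (4 * p) * (2 * p) = h / 2.
  by move=> p0; field; rewrite gt_eqF.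
rewrite /et half//.
have -> : e * K1 * \int[mu]_x f x ^+ 2 + e * K2 * (2 * pi) = e * C by rewrite /C; ring.
suff : e * C <= eta / 2 by lra.
have : e <= eta / 2 / (C + 1).
  by near: e; apply: nbhs_right_le; rewrite !divr_gt0// ltr_wpDl.
rewrite ler_pdivlMr ?ltr_wpDl// mulrDr mulr1; have := ltW e0; lra.
Unshelve. all: end_near. Qed.

(** The transform is only an L^2 limit, so it is tested against damped characters, for which the
    multiplication formula produces a Poisson kernel centred at [x0]. Removing the damping uses
    dominated convergence on the frequency side and continuity of [f] at [x0] on the other. *)
Lemma fourier_inversion (f a b : R -> R) x0 : is_fourier f a b ->
  sqint a -> sqint b -> L1 a -> L1 b -> {for x0, continuous f} ->
  f x0 = c * fourier_kernel a b x0.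
Proof.
move=> Ff a2 b2 Ia Ib cf.
have sf : sqint f.
  case: Ff => f2 _ _ _; split; last exact: Lfun2_integrable_sqr f2.
  by move: f2 => /andP[]; rewrite inE.
pose w e (xi : R) := expR (- (e * `|xi|)).
(* [p + i q] is the damped character [exp(- e |xi|) exp(- i x0 xi)]. *)
pose p e (xi : R) := w e xi * cos (x0 * xi); pose q e (xi : R) := w e xi * - sin (x0 * xi).
have mc : measurable_fun [set: R] (fun xi => cos (x0 * xi)).
  by under eq_fun do rewrite mulrC; exact: measurable_cosM.
have ms : measurable_fun [set: R] (fun xi => sin (x0 * xi)).
  by under eq_fun do rewrite mulrC; exact: measurable_sinM.
have mNs : measurable_fun [set: R] (fun xi => - sin (x0 * xi)) by exact: measurable_funN.
have Ns1 xi : `|- sin (x0 * xi)| <= 1 by rewrite normrN norm_sin_le1.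
have MF e : 0 < e ->
    \int[mu]_xi (p e xi * a xi) + \int[mu]_xi (q e xi * b xi) =
    c * \int[mu]_x (f x * poisson e (x - x0)).
  move=> e0; have Iw := L1_exp_abs e0.
  have Ip : L1 (p e) by apply: (L1_mul_bounded Iw mc) => xi; exact: norm_cos_le1.
  have Iq : L1 (q e) by exact: (L1_mul_bounded Iw mNs Ns1).
  have w1 xi : `|w e xi| <= 1.
    by rewrite ger0_norm ?expR_ge0// -expR0 ler_expR oppr_le0 mulr_ge0// ltW.
  have sqL (k : R -> R) : L1 k -> (forall xi, `|k xi| <= 1) -> sqint k.
    move=> Ik k1; split; first exact: L1_meas.
    by under eq_fun do rewrite expr2; exact: L1_mul_bounded Ik (L1_meas Ik) k1.
  have sp : sqint (p e).
    apply: sqL => // xi; rewrite normrM -[leRHS]mulr1.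
    by apply: ler_pM => //; exact: norm_cos_le1.
  have sq : sqint (q e).
    by apply: sqL => // xi; rewrite normrM -[leRHS]mulr1; apply: ler_pM.
  have kE : fourier_kernel (p e) (q e) = (fun x => poisson e (x - x0)).
    apply/funext => x; rewrite -int_exp_cos// /fourier_kernel -intB; last 2 first.
    - apply: (L1_mul_bounded Ip) => [|xi]; last exact: norm_cos_le1.
      by under eq_fun do rewrite mulrC; exact: measurable_cosM.
    - apply: (L1_mul_bounded Iq) => [|xi]; last exact: norm_sin_le1.
      by under eq_fun do rewrite mulrC; exact: measurable_sinM.
    congr Rintegral; apply/funext => xi.
    by rewrite /p /q /w mulrBl cosB; ring.
  have -> : (fun x => f x * poisson e (x - x0)) =
      (fun x => f x * fourier_kernel (p e) (q e) x) by rewrite kE.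
  by apply: multiplication_formula => //; rewrite kE; exact: sqint_poisson.
pose en (n : nat) : R := n.+1%:R^-1.
have en0 n : 0 < en n by rewrite invr_gt0.
have enc : en n @[n --> \oo] --> (0 : R) by exact: cvg_harmonic.
have cvR : c * \int[mu]_x (f x * poisson (en n) (x - x0)) @[n --> \oo] -->
    c * (2 * pi * f x0).
  apply: cvgM; first exact: cvg_cst.
  have /cvg_at_rightP := poisson_approx sf cf.
  by apply; split.
have cvw xi : w (en n) xi @[n --> \oo] --> (1 : R).
  rewrite /w -expR0; apply: continuous_cvg; first exact: continuous_expR.
  rewrite -oppr0 -(mul0r `|xi|); apply: cvgN; apply: cvgM => //; exact: cvg_cst.
have dom (k t : R -> R) : L1 k -> measurable_fun [set: R] t -> (forall xi, `|t xi| <= 1) ->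
    \int[mu]_xi (w (en n) xi * t xi * k xi) @[n --> \oo] -->
    \int[mu]_xi (k xi * t xi).
  move=> Ik mt t1.
  apply: (@dominated_cvg_int _ (fun n xi => w (en n) xi * t xi * k xi) _ (fun xi => `|k xi|) _ _ _ _).2.
  - move=> n; apply: measurable_funM; last exact: L1_meas.
    by apply: measurable_funM => //; exact: L1_meas (L1_exp_abs _).
  - move=> xi; rewrite -[X in _ --> X]mul1r (mulrC (k xi)) mulrA.
    by apply: cvgM; [apply: cvgM; [exact: cvw|exact: cvg_cst]|exact: cvg_cst].
  - exact: L1_norm.
  - move=> n xi; rewrite normrM ler_piMl// normrM -[leRHS]mulr1 ler_pM//.
    by rewrite ger0_norm ?expR_ge0// -expR0 ler_expR oppr_le0 mulr_ge0// ltW.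
have cvL : c * \int[mu]_x (f x * poisson (en n) (x - x0)) @[n --> \oo] -->
    fourier_kernel a b x0.
  under eq_fun do rewrite -(MF _ (en0 _)).
  rewrite /fourier_kernel.
  have -> : - (\int[mu]_xi (b xi * sin (x0 * xi))) = \int[mu]_xi (b xi * - sin (x0 * xi)).
    rewrite -[LHS]mulN1r -intZ.
      by congr Rintegral; apply/funext => xi; ring.
    by apply: (L1_mul_bounded Ib ms) => xi; exact: norm_sin_le1.
  by apply: cvgD; apply: dom => // xi; exact: norm_cos_le1.
rewrite -(cvg_unique _ cvR cvL) // mulrA mulrA.
have p2 : 0 < 2 * pi :> R by rewrite mulr_gt0// pi_gt0.
(* The normalisation [c * c = 1 / (2 * pi)] cancels the mass of the Poisson kernel. *)
rewrite (_ : c * c * _ = 1) ?mul1r//.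
rewrite -invfM -expr2 sqr_sqrtr ?ltW// mulVf ?gt_eqF//.
Qed.

End inversion.

(** * Sobolev spaces *)

Section sobolev_embedding.
Context {R : realType}.
Notation mu := (@lebesgue_measure R).
Notation c := ((Num.sqrt (2 * pi))^-1 : R).

Lemma fourier_cst_gt0 : 0 < c.
Proof. by rewrite invr_gt0 sqrtr_gt0 mulr_gt0// pi_gt0. Qed.

Lemma one_plus_sqr_gt0 (x : R) : 0 < 1 + x ^+ 2.
Proof. by rewrite ltr_pwDl ?sqr_ge0. Qed.

Lemma one_plus_sqr_ge1 (x : R) : 1 <= 1 + x ^+ 2.
Proof. by rewrite lerDl sqr_ge0. Qed.

Lemma measurable_powR_oneDsqr (r : R) :
  measurable_fun [set: R] (fun x => (1 + x ^+ 2) `^ r).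
Proof.
apply: (measurableT_comp (measurable_powR r)).
by apply: measurable_funD => //; exact: measurable_funX.
Qed.

(** Comparison with [(1 + |x|)^(- 2 r)], which has an elementary primitive on the half line, through
    [(1 + |x|)^2 <= 2 (1 + x^2)]. *)
Lemma L1_powR_oneDsqr (r : R) : 1 / 2 < r ->
  L1 (fun x : R => (1 + x ^+ 2) `^ (- r)).
Proof.
move=> r12; have r0 : 0 < r by lra.
have r2 : 1 - 2 * r != 0 by rewrite lt_eqF//; lra.
pose g (t : R) := (1 + t) `^ (- (2 * r)).
pose G (t : R) := (1 - 2 * r)^-1 * (1 + t) `^ (1 - 2 * r).
have t1 (t : R) : 0 <= t -> 0 < 1 + t by lra.
have d1 (t : R) : der (fun t => 1 + t) t 1.
  by apply: (is_derive_eq (derD (der_cst 1 t) (der_id t))); rewrite add0r.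
have Ig : L1 (fun x => g `|x|).
  apply: (@L1_even _ G g (2 * r - 1)^-1).
  - move=> t t0; apply: (is_derive_eq (derZ _
      (der_comp (is_derive1_powR (1 - 2 * r) (t1 _ t0)) (d1 t)))).
    rewrite mulr1 mulrA mulVf// mul1r; congr powR; ring.
  - move=> t t0; apply: (@der_cont _ g t).
    exact: (der_comp (is_derive1_powR (- (2 * r)) (t1 _ t0)) (d1 t)).
  - by move=> t t0; exact: powR_ge0.
  - move=> t t0; rewrite normrM (ger0_norm (powR_ge0 _ _)).
    have -> : `|(1 - 2 * r)^-1| = (2 * r - 1)^-1.
      by rewrite normfV ltr0_norm ?opprB//; lra.
    rewrite ler_piMr ?invr_ge0//; first lra.
    rewrite -[leRHS](powRr0 (1 + t)) ler_powR//; lra.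
apply: (L1_dom _ (L1Z (2 `^ r) Ig)); first exact: measurable_powR_oneDsqr.
move=> x; rewrite ger0_norm ?powR_ge0// /g.
have x0 : 0 < 1 + `|x| by rewrite ltr_wpDr.
rewrite !powRN powRrM (powR_mulrn _ (ltW x0)).
have h : ((1 + `|x|) ^+ 2) `^ r <= 2 `^ r * (1 + x ^+ 2) `^ r.
  have p0 := ltW (one_plus_sqr_gt0 x).
  rewrite -powRM//; apply: ge0_ler_powR; rewrite ?nnegrE ?sqr_ge0 ?mulr_ge0//.
    exact: ltW.
  rewrite -(real_normK (num_real x)); have := sqr_ge0 (`|x| - 1).
  by rewrite sqrrB sqrrD; lra.
rewrite ler_pdivlMr ?powR_gt0 ?exprn_gt0// mulrC ler_pdivrMr// powR_gt0//.
exact: one_plus_sqr_gt0.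
Qed.

Lemma sqint_powR_oneDsqr (r : R) : 1 / 4 < r ->
  sqint (fun x : R => (1 + x ^+ 2) `^ (- r)).
Proof.
move=> r0; split; first exact: measurable_powR_oneDsqr.
rewrite (_ : (fun x => _) = (fun x : R => (1 + x ^+ 2) `^ (- (2 * r)))).
  by apply: L1_powR_oneDsqr; lra.
apply/funext => x; rewrite -powR_mulrn ?powR_ge0// -powRrM; congr powR; ring.
Qed.

Lemma norm_fourier_kernel (p q : R -> R) (x : R) : L1 p -> L1 q ->
  `|fourier_kernel p q x| <= \int[mu]_xi `|p xi| + \int[mu]_xi `|q xi|.
Proof.
move=> Ip Iq; apply: (le_trans (ler_normB _ _)); apply: lerD.
- apply: norm_trig_int => // [|xi]; last exact: norm_cos_le1.
  by under eq_fun do rewrite mulrC; exact: measurable_cosM.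
- apply: norm_trig_int => // [|xi]; last exact: norm_sin_le1.
  by under eq_fun do rewrite mulrC; exact: measurable_sinM.
Qed.

Lemma der_int_kernel (k : R -> R) (K K' : R -> R -> R) (x : R) : L1 k ->
  L1 (fun xi => xi * k xi) ->
  (forall y : R, measurable_fun [set: R] (K y)) ->
  (forall y xi, `|K y xi| <= 1) -> (forall y xi, `|K' y xi| <= 1) ->
  (forall y xi : R, der (K ^~ xi) y (xi * K' y xi)) ->
  der (fun y : R => \int[mu]_xi (k xi * K y xi)) x
    (\int[mu]_xi (xi * k xi * K' x xi)).
Proof.
move=> Ik Ixk mK K1 K'1 dK.
pose f y xi := k xi * K y xi.
have df (y xi : R) : der (f ^~ xi) y (xi * k xi * K' y xi).
  by apply: (is_derive_eq (derZ (k xi) (dK y xi))); rewrite mulrCA mulrA.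
have dfd (y xi : R) : derivable (f ^~ xi) y 1 by apply: ex_derive; exact: df.
have Ix : `]x - 1, x + 1[%classic x by rewrite /= in_itv/= ltrBlDr ltrDl ltr01.
have If y : L1 (f y) by apply: (L1_mul_bounded Ik (mK y)).
have IG := L1_norm Ixk.
have Gub (y : R) xi : `]x - 1, x + 1[%classic y -> [set: R] xi ->
    `|partial1of2 f y xi| <= `|xi * k xi|.
  by move=> _ _; rewrite /partial1of2 (der_derive1 (df y xi)) normrM ler_piMr.
have d1 := @derivable_under_integral R _ _ mu f setT measurableT x _ _ Ix
  (fun y _ => If y) (fun y xi _ _ => dfd y xi) _ (fun xi => normr_ge0 _) IG Gub.
have d2 := @differentiation_under_integral R _ _ mu f setT measurableT x _ _ Ix
  (fun y _ => If y) (fun y xi _ _ => dfd y xi) _ (fun xi => normr_ge0 _) IG Gub.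
apply: (is_derive_eq (derivable_der d1)); rewrite d2.
congr Rintegral; apply/funext => xi.
by rewrite /partial1of2 (der_derive1 (df x xi)).
Qed.

Lemma der_fourier_kernel (p q : R -> R) (x : R) : L1 p -> L1 q ->
  L1 (fun xi => xi * p xi) -> L1 (fun xi => xi * q xi) ->
  der (fourier_kernel p q) x
    (fourier_kernel (fun xi => - (xi * q xi)) (fun xi => xi * p xi) x).
Proof.
move=> Ip Iq Ixp Ixq.
have mc (y : R) : measurable_fun [set: R] (fun xi => cos (y * xi)).
  by under eq_fun do rewrite mulrC; exact: measurable_cosM.
have ms (y : R) : measurable_fun [set: R] (fun xi => sin (y * xi)).
  by under eq_fun do rewrite mulrC; exact: measurable_sinM.
have dc (y xi : R) : der (fun y => cos (y * xi)) y (xi * - sin (y * xi)).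
  have := der_cosM xi y; under eq_fun do rewrite mulrC.
  by move=> d; apply: (is_derive_eq d); rewrite mulrN (mulrC xi y).
have ds (y xi : R) : der (fun y => sin (y * xi)) y (xi * cos (y * xi)).
  have := der_sinM xi y; under eq_fun do rewrite mulrC.
  by move=> d; apply: (is_derive_eq d); rewrite (mulrC xi y).
have d1 := @der_int_kernel p _ _ x Ip Ixp mc (fun y xi => norm_cos_le1 _)
   (fun y xi => (_ : `|- sin (y * xi)| <= 1)) dc.
have d2 := @der_int_kernel q _ _ x Iq Ixq ms (fun y xi => norm_sin_le1 _)
   (fun y xi => norm_cos_le1 _) ds.
apply: (is_derive_eq (derB (d1 _) d2)).
  by move=> y xi; rewrite normrN norm_sin_le1.
rewrite /fourier_kernel.
have -> : \int[mu]_xi (xi * p xi * - sin (x * xi)) =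
    - (\int[mu]_xi (xi * p xi * sin (x * xi))).
  rewrite -[RHS]mulN1r -intZ.
    by congr Rintegral; apply/funext => xi; rewrite mulrN mulN1r.
  by apply: (L1_mul_bounded Ixp (ms x)) => xi; exact: norm_sin_le1.
have -> : \int[mu]_xi (- (xi * q xi) * cos (x * xi)) =
    - (\int[mu]_xi (xi * q xi * cos (x * xi))).
  rewrite -[RHS]mulN1r -intZ.
    by congr Rintegral; apply/funext => xi; rewrite mulNr mulN1r.
  by apply: (L1_mul_bounded Ixq (mc x)) => xi; exact: norm_cos_le1.
by rewrite addrC.
Qed.

Lemma continuous_fourier_kernel (p q : R -> R) : L1 p -> L1 q ->
  continuous (fourier_kernel p q).
Proof.
move=> Ip Iq x; apply: cvgB.
- apply: (@continuous_kernel R p (fun xi y => cos (y * xi))) => // [y|*|xi].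
  + by under eq_fun do rewrite mulrC; exact: measurable_cosM.
  + exact: norm_cos_le1.
  + by under eq_fun do rewrite mulrC; exact: continuous_cosM.
- apply: (@continuous_kernel R q (fun xi y => sin (y * xi))) => // [y|*|xi].
  + by under eq_fun do rewrite mulrC; exact: measurable_sinM.
  + exact: norm_sin_le1.
  + by under eq_fun do rewrite mulrC; exact: continuous_sinM.
Qed.

Lemma sobolev_norm_lt (s N : R) (f : R -> R) : 0 < N ->
  (sobolev_norm s f < N%:E)%E -> exists a b, is_fourier f a b /\
  let h xi := (1 + xi ^+ 2) `^ (s / 2) * Num.sqrt (a xi ^+ 2 + b xi ^+ 2) in
  sqint h /\ \int[mu]_xi h xi ^+ 2 < N ^+ 2.
Proof.
move=> N0 /ereal_inf_lt [_ [a [b [Ff ->]]] hN]; exists a, b; split => //.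
apply: Lnorm2_lt => //; apply: measurable_funM.
  exact: measurable_powR_oneDsqr.
case: Ff => _ ma mb _.
apply: (@measurableT_comp _ _ _ _ _ _ (@Num.sqrt R)).
  by apply: continuous_measurable_fun; exact: sqrt_continuous.
by apply: measurable_funD; exact: measurable_funX.
Qed.

Lemma is_fourier_sqint (f a b : R -> R) : is_fourier f a b -> sqint f.
Proof.
move=> [f2 _ _ _]; split; last exact: Lfun2_integrable_sqr f2.
by move: f2 => /andP[]; rewrite inE.
Qed.

Lemma le_sqrt_sqrD (a b : R) : `|a| <= Num.sqrt (a ^+ 2 + b ^+ 2) /\
  `|b| <= Num.sqrt (a ^+ 2 + b ^+ 2).
Proof.
by split; rewrite -sqrtr_sqr ler_wsqrtr// ?lerDl ?lerDr sqr_ge0.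
Qed.

Lemma sqint_dom (f h : R -> R) : measurable_fun [set: R] f -> sqint h ->
  (forall x, `|f x| <= `|h x|) -> sqint f /\ \int[mu]_x f x ^+ 2 <= \int[mu]_x h x ^+ 2.
Proof.
move=> mf [mh Ih] fh.
have fh2 x : f x ^+ 2 <= h x ^+ 2.
  rewrite -(real_normK (num_real (f x))) -(real_normK (num_real (h x))).
  by rewrite ler_pXn2r ?nnegrE ?normr_ge0.
have If : L1 (fun x => f x ^+ 2).
  apply: (L1_dom _ Ih) => [|x]; first exact: measurable_funX.
  by rewrite ger0_norm ?sqr_ge0.
by split; [split|exact: le_int].
Qed.

(** With [m] the modulus of the transform, [(1 + xi^2) m] is the product of the H^s density [h] and
    [g = (1 + xi^2)^(- (s/2 - 1))]. The latter is square integrable because [s > 5/2], so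
    [(1 + xi^2) m] is integrable and the inversion formula can be differentiated twice. The bound is
    linear in [N], so that it also applies to differences of two time slices. *)
Lemma sobolev_embedding (s : R) : 5 / 2 < s -> exists2 C : R, 0 < C &
  forall (f : R -> R) (N : R), continuous f -> 0 < N -> (sobolev_norm s f < N%:E)%E ->
  [/\ sqint f, (forall x : R, der f x (derive1 f x)),
    (forall x : R, der (derive1 f) x (derive1n 2 f x)), continuous (derive1n 2 f) &
    forall x : R, [/\ `|f x| <= C * N, `|derive1 f x| <= C * N &
      `|derive1n 2 f x| <= C * N]].
Proof.
move=> s52.
pose g (xi : R) := (1 + xi ^+ 2) `^ (- (s / 2 - 1)).
have g2 : sqint g by apply: sqint_powR_oneDsqr; lra.
pose G := Num.sqrt (\int[mu]_x g x ^+ 2) + 1.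
have G0 : 0 < G by rewrite ltr_wpDl ?sqrtr_ge0.
have gG : \int[mu]_x g x ^+ 2 <= G ^+ 2.
  have I0 : 0 <= \int[mu]_x g x ^+ 2 by apply: Rintegral_ge0 => x _; rewrite sqr_ge0.
  rewrite -[leLHS](sqr_sqrtr I0) ler_pXn2r ?nnegrE ?sqrtr_ge0 ?(ltW G0)//.
  by rewrite /G lerDl.
(* The factor 2 counts the cosine and the sine integral of [fourier_kernel], each at most
   [G * N]. *)
exists (c * (2 * G)); first by rewrite mulr_gt0 ?mulr_gt0// fourier_cst_gt0.
move=> f N cf N0 /(sobolev_norm_lt N0)[a [b [Ff]]].
set h := (fun xi => _); move=> [h2 hN].
have [_ ma mb _] := Ff.
have sf := is_fourier_sqint Ff.
pose m xi := Num.sqrt (a xi ^+ 2 + b xi ^+ 2).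
have m0 xi : 0 <= m xi by exact: sqrtr_ge0.
have mE xi : (1 + xi ^+ 2) * m xi = g xi * h xi.
  rewrite /g /h mulrA -powRD; last by rewrite (gt_eqF (one_plus_sqr_gt0 xi)) implybT.
  rewrite (_ : - (s / 2 - 1) + s / 2 = 1); last by ring.
  by rewrite powRr1// ltW// one_plus_sqr_gt0.
have Im : L1 (fun xi => (1 + xi ^+ 2) * m xi).
  by rewrite (funext mE); exact: L1_sqr_mul.
have ImN : \int[mu]_xi ((1 + xi ^+ 2) * m xi) <= G * N.
  rewrite (funext mE).
  apply: (le_trans (ler_norm _)); apply: (le_trans (norm_int (L1_sqr_mul g2 h2))).
  by apply: cauchy_schwarz => //; exact: ltW.
have mh xi : m xi <= `|h xi|.
  have h0 : 0 <= h xi by rewrite mulr_ge0 ?powR_ge0.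
  rewrite ger0_norm// ler_peMl//.
  by rewrite -[leLHS](powRr0 (1 + xi ^+ 2)) ler_powR ?one_plus_sqr_ge1//; lra.
have a2 : sqint a.
  by apply: (sqint_dom ma h2 _).1 => xi; exact: le_trans (le_sqrt_sqrD _ _).1 (mh xi).
have b2 : sqint b.
  by apply: (sqint_dom mb h2 _).1 => xi; exact: le_trans (le_sqrt_sqrD _ _).2 (mh xi).
(* All coefficients arising from up to two derivatives, that is, up to two factors [xi], share this
   one integrable majorant. *)
pose good (k : R -> R) := measurable_fun [set: R] k /\
  forall xi, `|k xi| <= (1 + xi ^+ 2) * m xi.
have goodL k : good k -> L1 k /\ \int[mu]_xi `|k xi| <= G * N.
  move=> [mk kb]; have Ik := L1_dom mk Im kb; split => //.
  by apply: le_trans ImN; apply: le_int => //; exact: L1_norm.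
have bnd p q x : good p -> good q -> `|c * fourier_kernel p q x| <= c * (2 * G) * N.
  move=> /goodL[Ip pN] /goodL[Iq qN]; rewrite normrM (ger0_norm (ltW fourier_cst_gt0)) -mulrA.
  rewrite ler_pM2l ?fourier_cst_gt0//; apply: (le_trans (norm_fourier_kernel x Ip Iq)).
  have -> : 2 * G * N = G * N + G * N by ring.
  exact: lerD.
have am xi : `|a xi| <= m xi := (le_sqrt_sqrD _ _).1.
have bm xi : `|b xi| <= m xi := (le_sqrt_sqrD _ _).2.
have x1 (x : R) : `|x| <= 1 + x ^+ 2.
  rewrite -(real_normK (num_real x)); have := sqr_ge0 (`|x| - 1).
  by rewrite sqrrB; have := normr_ge0 x; lra.
have x2 (x : R) : `|x * x| <= 1 + x ^+ 2.
  by rewrite -expr2 ger0_norm ?sqr_ge0// lerDr.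
have gd0 (k : R -> R) : measurable_fun [set: R] k -> (forall xi, `|k xi| <= m xi) -> good k.
  move=> mk km; split => // xi; apply: (le_trans (km xi)).
  by rewrite ler_peMl// one_plus_sqr_ge1.
have gd1 (k : R -> R) : measurable_fun [set: R] k -> (forall xi, `|k xi| <= m xi) ->
    good (fun xi => xi * k xi).
  move=> mk km; split => [|xi]; first exact: measurable_funM.
  by rewrite normrM ler_pM.
have gd2 (k : R -> R) : measurable_fun [set: R] k -> (forall xi, `|k xi| <= m xi) ->
    good (fun xi => xi * (xi * k xi)).
  move=> mk km; split => [|xi].
    by apply: measurable_funM => //; exact: measurable_funM.
  by rewrite mulrA normrM ler_pM.
have gdN (k : R -> R) : good k -> good (fun xi => - k xi).
  move=> [mk km]; split => [|xi]; last by rewrite normrN.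
  exact: measurable_funN.
have fE : f = (fun x => c * fourier_kernel a b x).
  apply/funext => x; apply: fourier_inversion => //.
  - exact: (goodL _ (gd0 _ ma am)).1.
  - exact: (goodL _ (gd0 _ mb bm)).1.
  - exact: cf.
have [Ga Gb] := (gd0 _ ma am, gd0 _ mb bm).
have [Gxa Gxb] := (gd1 _ ma am, gd1 _ mb bm).
have [Gxxa Gxxb] := (gd2 _ ma am, gd2 _ mb bm).
have xN (k : R -> R) : (fun xi : R => xi * - (xi * k xi)) = (fun xi => - (xi * (xi * k xi))).
  by apply/funext => xi; rewrite mulrN.
have df (x : R) : der f x (c * fourier_kernel (fun xi => - (xi * b xi)) (fun xi => xi * a xi) x).
  rewrite fE; apply: derZ; apply: der_fourier_kernel.
  - exact: (goodL _ Ga).1.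
  - exact: (goodL _ Gb).1.
  - exact: (goodL _ Gxa).1.
  - exact: (goodL _ Gxb).1.
have f1E : derive1 f = (fun x =>
    c * fourier_kernel (fun xi => - (xi * b xi)) (fun xi => xi * a xi) x).
  by apply/funext => x; exact: der_derive1 (df x).
have ddf (x : R) : der (derive1 f) x (c * fourier_kernel (fun xi => - (xi * (xi * a xi)))
     (fun xi => - (xi * (xi * b xi))) x).
  rewrite f1E -(xN b); apply: derZ; apply: der_fourier_kernel.
  - exact: (goodL _ (gdN _ Gxb)).1.
  - exact: (goodL _ Gxa).1.
  - by rewrite xN; exact: (goodL _ (gdN _ Gxxb)).1.
  - exact: (goodL _ Gxxa).1.
have f2E : derive1n 2 f = (fun x => c * fourier_kernel (fun xi => - (xi * (xi * a xi)))
     (fun xi => - (xi * (xi * b xi))) x).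
  by apply/funext => x; exact: der_derive1 (ddf x).
split; first exact: sf.
- by move=> x; rewrite f1E; exact: df.
- by move=> x; rewrite f2E; exact: ddf.
- rewrite f2E => x; apply: cvgM; first exact: cvg_cst.
  apply: continuous_fourier_kernel; first exact: (goodL _ (gdN _ Gxxa)).1.
  exact: (goodL _ (gdN _ Gxxb)).1.
- move=> x; split.
  + by rewrite fE; exact: bnd.
  + by rewrite f1E; apply: bnd => //; exact: gdN.
  + by rewrite f2E; apply: bnd; exact: gdN.
Qed.

Lemma sqint_Lfun (f : R -> R) : sqint f -> f \in Lfun mu 2%:E.
Proof.
move=> [mf If]; apply/andP; split; rewrite inE//=.
rewrite /finite_norm; apply: (@lty_poweRy _ _ 2); first by rewrite pnatr_eq0.
rewrite (poweR_Lnorm mu (EFin \o f) (negbT (pnatr_eq0 R 2))).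
have := integrable_lty measurableT If; apply: le_lt_trans.
rewrite le_eqVlt; apply/orP; left; apply/eqP; apply: eq_integral => x _.
by rewrite [(EFin \o f) x]/= abse_EFin poweR_EFin powR_mulrn// real_normK ?num_real.
Qed.

Lemma continuous_support_L1 (f : R -> R) (A : R) : continuous f ->
  (forall x, A < `|x| -> f x = 0) -> L1 f.
Proof.
move=> cf fA.
have -> : f = f \_ `[- A, A].
  apply/funext => x; rewrite patchE; case: ifPn => //.
  by rewrite notin_setE/= in_itv/= -ler_norml => /negP; rewrite -ltNge => /fA.
rewrite /L1 -restrict_EFin.
apply/integrable_restrict => //=; rewrite setTI.
by apply: continuous_itv_integrable => x _; exact: cf.
Qed.

Lemma int_support (f : R -> R) (A B : R) : (forall x, A < `|x| -> f x = 0) -> A <= B ->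
  \int[mu]_(x in `[- B, B]) f x = \int[mu]_x f x.
Proof.
move=> fA AB; rewrite Rintegral_mkcond; congr Rintegral; apply/funext => x.
rewrite patchE; case: ifPn => //.
rewrite notin_setE/= in_itv/= -ler_norml => /negP; rewrite -ltNge => Bx.
by rewrite fA// (le_lt_trans AB).
Qed.

(** * Pairing of Sobolev functions with compactly supported functions *)

Section compact_support.
Variables (psi psi1 psi2 : R -> R) (A : R).
Hypotheses (A0 : 0 <= A) (d1 : forall x : R, der psi x (psi1 x))
  (d2 : forall x : R, der psi1 x (psi2 x)) (c2 : continuous psi2).
Hypotheses (s0 : forall x, A <= `|x| -> psi x = 0)
  (s1 : forall x, A <= `|x| -> psi1 x = 0) (s2 : forall x, A <= `|x| -> psi2 x = 0).

Let c0 : continuous psi := continuous_der d1.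
Let I0 : L1 psi := continuous_support_L1 c0 (fun x Ax => s0 (ltW Ax)).
Let I2 : L1 psi2 := continuous_support_L1 c2 (fun x Ax => s2 (ltW Ax)).

Let p xi := c * \int[mu]_x (psi x * cos (x * xi)).
Let q xi := - c * \int[mu]_x (psi x * sin (x * xi)).

Let AA : - A <= A. Proof. by rewrite (le_trans _ A0)// oppr_le0. Qed.

Let int_der (F f : R -> R) : (forall x : R, der F x (f x)) -> continuous f ->
  F A = 0 -> F (- A) = 0 -> (forall x, A < `|x| -> f x = 0) -> \int[mu]_x f x = 0.
Proof.
move=> dF cf FA FNA f0; rewrite -(int_support f0 (lexx A)).
by rewrite (FTC AA (fun x _ => dF x) (fun x _ => cf x)) FA FNA subrr.
Qed.

Let nA : A <= `|A|. Proof. exact: ler_norm. Qed.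
Let nNA : A <= `|- A|. Proof. by rewrite normrN. Qed.

Let cosd (xi x : R) : der (fun x => cos (x * xi)) x (- (xi * sin (x * xi))).
Proof.
have := der_cosM xi x; under eq_fun do rewrite mulrC.
by rewrite (mulrC xi x).
Qed.

Let sind (xi x : R) : der (fun x => sin (x * xi)) x (xi * cos (x * xi)).
Proof.
have := der_sinM xi x; under eq_fun do rewrite mulrC.
by rewrite (mulrC xi x).
Qed.

Let ccos (xi : R) : continuous (fun x : R => cos (x * xi)) := continuous_der (cosd xi).
Let csin (xi : R) : continuous (fun x : R => sin (x * xi)) := continuous_der (sind xi).

Let cmul (f g : R -> R) : continuous f -> continuous g -> continuous (fun x => f x * g x).
Proof. by move=> cf cg x; apply: cvgM; [exact: cf|exact: cg]. Qed.

Let trigL1 (f t : R -> R) : L1 f -> continuous t -> (forall x, `|t x| <= 1) ->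
  L1 (fun x => f x * t x).
Proof.
move=> If ct t1; apply: (L1_mul_bounded If _ t1).
exact: continuous_measurable_fun.
Qed.

(** Two integrations by parts in one: the integrand considered is the derivative of
    [psi1 * cos + xi * psi * sin], which vanishes at both ends since the support hypotheses include
    [|x| = A]. *)
Let decay_cos xi : (1 + xi ^+ 2) * \int[mu]_x (psi x * cos (x * xi)) =
  \int[mu]_x ((psi x - psi2 x) * cos (x * xi)).
Proof.
have Ic := trigL1 I0 (@ccos xi) (fun x => norm_cos_le1 _).
have Ic2 := trigL1 I2 (@ccos xi) (fun x => norm_cos_le1 _).
have : \int[mu]_x (psi2 x * cos (x * xi) + xi ^+ 2 * (psi x * cos (x * xi))) = 0.
  apply: (@int_der (fun x => psi1 x * cos (x * xi) + xi * (psi x * sin (x * xi)))).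
  - move=> x; apply: (is_derive_eq (derD (derM (d2 x) (cosd xi x))
      (derZ xi (derM (d1 x) (sind xi x))))); ring.
  - move=> x; apply: cvgD; first exact: cmul.
    by apply: cvgM; [exact: cvg_cst|exact: cmul].
  - by rewrite s0// s1// !mul0r mulr0 addr0.
  - by rewrite s0// s1// !mul0r mulr0 addr0.
  - by move=> x /ltW Ax; rewrite s0// s2// !mul0r mulr0 addr0.
rewrite intD//; last exact: L1Z.
rewrite intZ// => h.
have -> : (fun x => (psi x - psi2 x) * cos (x * xi)) =
    (fun x => psi x * cos (x * xi) - psi2 x * cos (x * xi)).
  by apply/funext => x; rewrite mulrBl.
rewrite intB//; move: h; set u := \int[mu]_x _; set v := \int[mu]_x _; lra.
Qed.

Let decay_sin xi : (1 + xi ^+ 2) * \int[mu]_x (psi x * sin (x * xi)) =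
  \int[mu]_x ((psi x - psi2 x) * sin (x * xi)).
Proof.
have Ic := trigL1 I0 (@csin xi) (fun x => norm_sin_le1 _).
have Ic2 := trigL1 I2 (@csin xi) (fun x => norm_sin_le1 _).
have : \int[mu]_x (psi2 x * sin (x * xi) + xi ^+ 2 * (psi x * sin (x * xi))) = 0.
  apply: (@int_der (fun x => psi1 x * sin (x * xi) - xi * (psi x * cos (x * xi)))).
  - move=> x; apply: (is_derive_eq (derB (derM (d2 x) (sind xi x))
      (derZ xi (derM (d1 x) (cosd xi x))))); ring.
  - move=> x; apply: cvgD; first exact: cmul.
    by apply: cvgM; [exact: cvg_cst|exact: cmul].
  - by rewrite s0// s1// !mul0r mulr0 subr0.
  - by rewrite s0// s1// !mul0r mulr0 subr0.
  - by move=> x /ltW Ax; rewrite s0// s2// !mul0r mulr0 addr0.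
rewrite intD//; last exact: L1Z.
rewrite intZ// => h.
have -> : (fun x => (psi x - psi2 x) * sin (x * xi)) =
    (fun x => psi x * sin (x * xi) - psi2 x * sin (x * xi)).
  by apply/funext => x; rewrite mulrBl.
rewrite intB//; move: h; set u := \int[mu]_x _; set v := \int[mu]_x _; lra.
Qed.

Let K := c * \int[mu]_x `|psi x - psi2 x|.

Let decay (u v xi : R) : `|u| = c * `|v| -> `|(1 + xi ^+ 2) * v| <= \int[mu]_x `|psi x - psi2 x| ->
  `|u| <= K * (1 + xi ^+ 2) `^ (- 1).
Proof.
move=> -> h; have x0 := one_plus_sqr_gt0 xi.
rewrite powRN powRr1 ?(ltW x0)// ler_pdivlMr// -mulrA ler_pM2l ?fourier_cst_gt0//.
by move: h; rewrite normrM (gtr0_norm x0) mulrC.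
Qed.

Let p_decay xi : `|p xi| <= K * (1 + xi ^+ 2) `^ (- 1).
Proof.
apply: (decay (v := \int[mu]_x (psi x * cos (x * xi)))).
  by rewrite normrM (gtr0_norm fourier_cst_gt0).
rewrite decay_cos; apply: norm_trig_int => [||x]; [exact: L1B| |exact: norm_cos_le1].
exact: continuous_measurable_fun (@ccos xi).
Qed.

Let q_decay xi : `|q xi| <= K * (1 + xi ^+ 2) `^ (- 1).
Proof.
apply: (decay (v := \int[mu]_x (psi x * sin (x * xi)))).
  by rewrite normrM normrN (gtr0_norm fourier_cst_gt0).
rewrite decay_sin; apply: norm_trig_int => [||x]; [exact: L1B| |exact: norm_sin_le1].
exact: continuous_measurable_fun (@csin xi).
Qed.

Let mp : measurable_fun [set: R] p.
Proof.
apply: measurable_funM => //; apply: continuous_measurable_fun.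
apply: (@continuous_kernel R psi (fun x xi => cos (x * xi))) => //.
- exact: measurable_cosM.
- by move=> *; exact: norm_cos_le1.
- exact: continuous_cosM.
Qed.

Let mq : measurable_fun [set: R] q.
Proof.
apply: measurable_funM => //; apply: continuous_measurable_fun.
apply: (@continuous_kernel R psi (fun x xi => sin (x * xi))) => //.
- exact: measurable_sinM.
- by move=> *; exact: norm_sin_le1.
- exact: continuous_sinM.
Qed.

Let L12 (k : R -> R) : measurable_fun [set: R] k ->
  (forall xi, `|k xi| <= K * (1 + xi ^+ 2) `^ (- 1)) -> L1 k /\ sqint k.
Proof.
move=> mk kK.
have h1 : 1 / 2 < 1 :> R by lra.
have h2 : 1 / 4 < 1 :> R by lra.
split; first exact: L1_dom mk (L1Z K (L1_powR_oneDsqr h1)) kK.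
have [mg Ig] := sqint_powR_oneDsqr h2.
split => //; apply: (L1_dom _ (L1Z (K ^+ 2) Ig)) => [|x]; first exact: measurable_funX.
rewrite ger0_norm ?sqr_ge0// -(real_normK (num_real (k x))) -exprMn.
by rewrite ler_pXn2r ?nnegrE ?normr_ge0// (le_trans _ (kK x)).
Qed.

Let psi_sq : sqint psi.
Proof.
split; first exact: continuous_measurable_fun.
apply: (@continuous_support_L1 _ A) => [x|x /ltW Ax].
  by under eq_fun do rewrite expr2; exact: cmul.
by rewrite s0// expr0n.
Qed.

(** For [B >= A] the truncation to [[- B, B]] changes nothing, so the L^2 error is eventually equal
    to 0. *)
Let psi_fourier : is_fourier psi p q.
Proof.
split; [exact: sqint_Lfun psi_sq|exact: mp|exact: mq|].
apply: cvg_near_cst; near=> B.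
have AB : A <= B by near: B; apply: nbhs_pinfty_ge; exact: num_real.
have supp (t : R -> R) : \int[mu]_(x in `[- B, B]) (psi x * t x) = \int[mu]_x (psi x * t x).
  by apply: (@int_support _ A) => // x /ltW Ax; rewrite s0// mul0r.
rewrite -[RHS](Lnorm0 mu (p := 2%:E)) ?eqe ?pnatr_eq0//; apply: eq_Lnorm => xi.
rewrite /fourier_trunc_re /fourier_trunc_im !supp /p /q !subrr expr0n addr0.
by rewrite sqrtr0.
Unshelve. all: end_near. Qed.

(* The transform of [psi] is computed classically and decays like [1 / (1 + xi^2)],
   so that the multiplication formula turns the pairing into an L^2 product. *)
Lemma sobolev_pairing (sigma : R) : 0 <= sigma -> exists2 C : R, 0 < C &
  forall (g : R -> R) (N : R), 0 < N -> (sobolev_norm sigma g < N%:E)%E ->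
  sqint g /\ `|\int[mu]_x (g x * psi x)| <= C * N.
Proof.
move=> sg0.
have [Ip p2] := L12 mp p_decay; have [Iq q2] := L12 mq q_decay.
pose P := Num.sqrt (\int[mu]_x p x ^+ 2) + 1.
pose Q := Num.sqrt (\int[mu]_x q x ^+ 2) + 1.
have sq1 (k : R -> R) : \int[mu]_x k x ^+ 2 <= (Num.sqrt (\int[mu]_x k x ^+ 2) + 1) ^+ 2.
  have k0 : 0 <= \int[mu]_x k x ^+ 2 by apply: Rintegral_ge0 => x _; rewrite sqr_ge0.
  rewrite -[leLHS](sqr_sqrtr k0) ler_pXn2r ?nnegrE ?sqrtr_ge0 ?addr_ge0 ?sqrtr_ge0//.
  by rewrite lerDl.
have P0 : 0 < P by rewrite ltr_wpDl ?sqrtr_ge0.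
have Q0 : 0 < Q by rewrite ltr_wpDl ?sqrtr_ge0.
have PQ0 : 0 < P + Q := addr_gt0 P0 Q0.
exists (P + Q); first exact: PQ0.
move=> g N N0 /(sobolev_norm_lt N0)[a [b [Fg]]].
set h := (fun xi => _); move=> [h2 hN].
have [_ ma mb _] := Fg.
have sgq := is_fourier_sqint Fg; split; first exact: sgq.
have mh (xi : R) : Num.sqrt (a xi ^+ 2 + b xi ^+ 2) <= `|h xi|.
  have h0 : 0 <= h xi by rewrite mulr_ge0 ?powR_ge0 ?sqrtr_ge0.
  rewrite ger0_norm// ler_peMl ?sqrtr_ge0//.
  by rewrite -[leLHS](powRr0 (1 + xi ^+ 2)) ler_powR ?one_plus_sqr_ge1// divr_ge0.
have [a2 aN] := sqint_dom ma h2 (fun xi => le_trans (le_sqrt_sqrD _ _).1 (mh xi)).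
have [b2 bN] := sqint_dom mb h2 (fun xi => le_trans (le_sqrt_sqrD _ _).2 (mh xi)).
(* Inversion for [psi] itself: the kernel of its own transform reproduces [psi] up to the factor
   [c^-1], which cancels the [c] of the multiplication formula. *)
have kE : fourier_kernel p q = (fun x => c^-1 * psi x).
  apply/funext => x; have cx : {for x, continuous psi} by exact: c0.
  rewrite (fourier_inversion psi_fourier p2 q2 Ip Iq cx).
  by rewrite mulrA mulVf ?mul1r// gt_eqF// fourier_cst_gt0.
have k2 : sqint (fourier_kernel p q).
  rewrite kE; split; first by apply: measurable_funM => //; exact: psi_sq.1.
  under eq_fun do rewrite exprMn; exact: L1Z psi_sq.2.
have := multiplication_formula Fg a2 b2 Ip Iq p2 q2 k2.
rewrite kE (_ : (fun x => g x * (c^-1 * psi x)) = (fun x => c^-1 * (g x * psi x))).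
  2: by apply/funext => x; rewrite mulrCA.
rewrite intZ; last exact: L1_sqr_mul.
rewrite mulrA mulfV ?mul1r; last by rewrite gt_eqF// fourier_cst_gt0.
move=> <-; apply: (le_trans (ler_normD _ _)); rewrite mulrDl; apply: lerD.
- apply: (le_trans (norm_int (L1_sqr_mul p2 a2))).
  exact: (cauchy_schwarz p2 a2 (ltW P0) (ltW N0) (sq1 p) (le_trans aN (ltW hN))).
- apply: (le_trans (norm_int (L1_sqr_mul q2 b2))).
  exact: (cauchy_schwarz q2 b2 (ltW Q0) (ltW N0) (sq1 q) (le_trans bN (ltW hN))).
Qed.

End compact_support.

End sobolev_embedding.

(** * Weak transport equations *)

Section smooth_step.
Context {R : realType}.
Notation mu := (@lebesgue_measure R).

(** Differentiability of order [k] with an explicit witness for each derivative, so that stability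
    under sums, products and affine substitutions is a plain induction without formulas for iterated
    derivatives. *)
Fixpoint diffn (k : nat) (f : R -> R) : Prop :=
  if k is k'.+1 then exists2 g : R -> R, (forall x : R, der f x (g x)) & diffn k' g
  else True.

Lemma diffn_cst k (a : R) : diffn k (fun=> a).
Proof.
elim: k a => [//|k IH] a; exists (fun=> 0); last exact: IH.
by move=> x; exact: der_cst.
Qed.

Lemma diffnW k f : diffn k.+1 f -> diffn k f.
Proof.
elim: k f => [//|k IH] f [g dg [h dh hk]]; exists g => //.
by apply: IH; exists h.
Qed.

Lemma diffnD k f g : diffn k f -> diffn k g -> diffn k (fun x => f x + g x).
Proof.
elim: k f g => [//|k IH] f g [f' df f'k] [g' dg g'k].
by exists (fun x => f' x + g' x); [move=> x; exact: derD|exact: IH].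
Qed.

Lemma diffnM k f g : diffn k f -> diffn k g -> diffn k (fun x => f x * g x).
Proof.
elim: k f g => [//|k IH] f g [f' df f'k] [g' dg g'k].
exists (fun x => f' x * g x + f x * g' x); first by move=> x; exact: derM.
by apply: diffnD; apply: IH => //; apply: diffnW; [exists g'|exists f'].
Qed.

Lemma diffnZ k a f : diffn k f -> diffn k (fun x => a * f x).
Proof. by move=> fk; apply: diffnM fk; exact: diffn_cst. Qed.

Lemma diffn_affine k a b f : diffn k f -> diffn k (fun x => f (a * x + b)).
Proof.
elim: k f => [//|k IH] f [g dg gk].
exists (fun x => a * g (a * x + b)); last exact/diffnZ/IH.
move=> x; have d := derD (derZ a (der_id x)) (der_cst b x).
by apply: (is_derive_eq (der_comp (dg _) d)); rewrite mulr1 addr0 mulrC.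
Qed.

Lemma diffn_derivable f : (forall k, diffn k f) ->
  forall k (x : R), derivable (derive1n k f) x 1.
Proof.
move=> fk k; elim: k f fk => [|k IH] f fk x.
  by have [g dg _] := fk 1%N; apply: ex_derive; exact: dg.
rewrite /derive1n iterSr; apply: IH => j.
have [g dg gj] := fk j.+1.
by have -> : derive1 f = g by apply/funext => y; exact: der_derive1 (dg y).
Qed.

(** Meant for [flat] at 0, the only point where no formula is valid on both sides. *)
Lemma der0_quadratic (f : R -> R) C : f 0 = 0 -> (forall h, `|f h| <= C * h ^+ 2) ->
  der f (0 : R) 0.
Proof.
move=> f0 fC.
have cv : h^-1 *: ((f \o shift 0) (h *: 1) - f 0) @[h --> 0^'] --> (0 : R).
  apply/cvgr0Pnorm_le => e e0; near=> h.
  have h0 : h != 0 by near: h; exact: nbhs_dnbhs_neq.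
  rewrite /= f0 subr0 addr0 /GRing.scale/= mulr1 normrM normfV.
  rewrite mulrC ler_pdivrMr ?normr_gt0//; apply: (le_trans (fC h)).
  rewrite -(real_normK (num_real h)) expr2 mulrA ler_wpM2r//.
  have hC : `|h| <= e / (`|C| + 1).
    near: h; apply: dnbhs0_le; rewrite divr_gt0// ltr_wpDl//.
  move: hC; rewrite ler_pdivlMr ?ltr_wpDl// => hC; apply: le_trans hC.
  by rewrite mulrC ler_wpM2l// (le_trans (ler_norm C))// lerDl.
apply: DeriveDef; first by apply/cvg_ex; exists 0.
by apply/cvg_lim.
Unshelve. all: end_near. Qed.

(* [flat n x = x^(-n) exp(-1/x)] for [x > 0]; the factors [x^(-n)] make the family
   closed under differentiation. *)
Definition flat (n : nat) (x : R) : R :=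
  if 0 < x then x^-1 ^+ n * expR (- x^-1) else 0.

(** Write [y = n z] and raise [z <= 1 + z <= exp z] to the power [n]. *)
Lemma exp_ge_pow n (y : R) : 0 <= y -> y ^+ n <= n%:R ^+ n * expR y.
Proof.
case: n => [|n] y0; first by rewrite !expr0 mul1r -expR0 ler_expR.
have n0 : 0 < n.+1%:R :> R by [].
pose z := y / n.+1%:R.
have z0 : 0 <= z by rewrite divr_ge0// ltW.
have -> : y = n.+1%:R * z by rewrite /z mulrC divfK// gt_eqF.
rewrite exprMn expRM_natl; apply: ler_wpM2l; first exact/exprn_ge0/ltW.
apply: lerXn2r; rewrite ?nnegrE ?expR_ge0//.
by apply: le_trans (expR_ge1Dx _); rewrite lerDr.
Qed.

(** [exp_ge_pow] at [y = 1 / h] with exponent [n + 2] instead of [n]: the two extra powers are the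
    factor [h^2]. *)
Lemma flat_quadratic n h : `|flat n h| <= n.+2%:R ^+ n.+2 * h ^+ 2.
Proof.
rewrite /flat; case: ifPn => h0; last first.
  by rewrite normr0 mulr_ge0 ?sqr_ge0// exprn_ge0.
have hi : 0 <= h^-1 by rewrite invr_ge0 ltW.
rewrite ger0_norm; last by rewrite mulr_ge0 ?expR_ge0// exprn_ge0.
have := exp_ge_pow n.+2 hi; rewrite expRN.
rewrite -ler_pdivrMr ?expR_gt0// => H.
have := ler_wpM2r (sqr_ge0 h) H; apply: le_trans.
rewrite le_eqVlt; apply/orP; left; apply/eqP.
have -> : h^-1 ^+ n = h^-1 ^+ n.+2 * h ^+ 2.
  by rewrite !exprS expr0 mulr1; field; rewrite gt_eqF.
by rewrite mulrAC.
Qed.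

Lemma der_flat n (x : R) : der (flat n) x (flat n.+2 x - n%:R * flat n.+1 x).
Proof.
have [x0|x0|->] := ltgtP x 0.
- have -> : flat n.+2 x - n%:R * flat n.+1 x = 0.
    by rewrite /flat ltNge (ltW x0)/= mulr0 subr0.
  apply: near_eq_is_derive (der_cst 0 x).
  apply: filterS (lt_nbhsl x0) => y y0.
  by rewrite /flat ltNge ltW.
- rewrite {2 3}/flat x0.
  have dV : der (fun y => y^-1) x (- (x^-1 ^+ 2)).
    have d := is_deriveV (lt0r_neq0 x0) (der_id x).
    by apply: (is_derive_eq d); rewrite /GRing.scale/= mulr1 exprVn.
  have dE : der (fun y => expR (- y^-1)) x (expR (- x^-1) * x^-1 ^+ 2).
    by apply: (is_derive_eq (der_comp (is_derive_expR _) (derN dV))); rewrite opprK.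
  have dP : der (fun y => y^-1 ^+ n) x (- (n%:R * x^-1 ^+ n.+1)).
    case: n => [|m]; first by rewrite mul0r oppr0; exact: der_cst.
    by apply: (is_derive_eq (derX m dV)); rewrite !exprS; ring.
  have d := derM dP dE.
  have E : \forall y \near x, y^-1 ^+ n * expR (- y^-1) = flat n y.
    by apply: filterS (lt_nbhsr x0) => y y0; rewrite /flat y0.
  by apply: (is_derive_eq (near_eq_is_derive E d)); rewrite !exprS; ring.
- have -> : flat n.+2 0 - n%:R * flat n.+1 0 = 0 by rewrite /flat ltxx mulr0 subr0.
  apply: (@der0_quadratic _ (n.+2%:R ^+ n.+2)); first by rewrite /flat ltxx.
  exact: flat_quadratic.
Unshelve. all: end_near. Qed.

Lemma diffn_flat k n : diffn k (flat n).
Proof.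
elim: k n => [//|k IH] n; exists (fun x => flat n.+2 x - n%:R * flat n.+1 x).
  by move=> x; exact: der_flat.
have -> : (fun x => flat n.+2 x - n%:R * flat n.+1 x) =
   (fun x => flat n.+2 x + - n%:R * flat n.+1 x) by apply/funext => x; rewrite mulNr.
by apply: diffnD => //; exact: diffnZ.
Qed.

(** [S] is the normalised primitive of the bump [flat 0 x * flat 0 (1 - x)]; the normalising factor
    exists because the bump is positive inside the unit interval. *)
Lemma smooth_step : exists S beta : R -> R, [/\ forall k, diffn k S,
  forall x : R, der S x (beta x), continuous beta, forall x, 0 <= beta x &
  [/\ forall x, x <= 0 -> S x = 0 & forall x, 1 <= x -> S x = 1]].
Proof.
pose b (x : R) := flat 0 x * flat 0 (-1 * x + 1).
have flat_ge0 (x : R) : 0 <= flat 0 x by rewrite /flat; case: ifP => // _; rewrite mul1r expR_ge0.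
have bk k : diffn k b.
  by apply: diffnM; [exact: diffn_flat|apply: diffn_affine; exact: diffn_flat].
have cb : continuous b by have [g dg _] := bk 1%N; exact: continuous_der dg.
have b0 x : 0 <= b x by rewrite mulr_ge0.
have bl x : x <= 0 -> b x = 0 by move=> x0; rewrite /b /flat ltNge x0 mul0r.
have br x : 1 <= x -> b x = 0.
  move=> x1; rewrite /b [X in _ * X]/flat ifF ?mulr0//.
  by apply/negbTE; rewrite -leNgt; lra.
have bp x : 0 < x < 1 -> 0 < b x.
  move=> /andP[x0 x1]; rewrite /b /flat x0 ifT; last by lra.
  by rewrite !mul1r mulr_gt0// expR_gt0.
have Ib : L1 b.
  apply: (@continuous_support_L1 _ _ 1) => // x.
  by rewrite lter_normr => /orP[/ltW/br//|x1]; apply: bl; lra.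
pose F (x : R) := \int[mu]_(t in `]-oo, x]) b t.
have dF (x : R) : der F x (b x).
  have xu : x < x + 1 by rewrite ltrDl.
  have Iu : mu.-integrable `]-oo, x + 1] (EFin \o b).
    exact: integrableS Ib.
  have [d1 d2] := @continuous_FTC1 R b -oo%O x (x + 1) xu Iu (ltNyr _) (cb x).
  by rewrite -d2; exact: derivable_der.
have Fmon (x y : R) : x <= y -> F x <= F y.
  by move=> xy; apply: (nondecreasing_der xy (fun z _ => dF z)) => z _; exact: b0.
have Fcst (x y : R) : x <= y -> (forall z, x <= z <= y -> b z = 0) -> F y = F x.
  move=> xy bz; apply/eqP; rewrite eq_le (Fmon _ _ xy) andbT -lerN2.
  apply: (nondecreasing_der xy (fun z _ => derN (dF z))) => z zxy.
  by rewrite bz// oppr0.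
have Z0 : 0 < F 1 - F 0.
  have cF : {within `[0, 1], continuous F}.
    by apply: continuous_in_subspaceT => x _; exact: der_cont (dF x).
  have [z + ->] := @MVT _ F b 0 1 ltr01 (fun x _ => dF x) cF.
  by rewrite in_itv/= => z01; rewrite mulr_gt0 ?subr0 ?bp.
exists (fun x => (F 1 - F 0)^-1 * (F x + - F 0)), (fun x => (F 1 - F 0)^-1 * b x); split.
- move=> [//|k]; apply: diffnZ; apply: diffnD; last exact: diffn_cst.
  by exists b => //; exact: bk.
- by move=> x; apply: derZ; apply: (is_derive_eq (derB (dF x) (der_cst (F 0) x))); rewrite subr0.
- by move=> x; apply: cvgM; [exact: cvg_cst|exact: cb].
- by move=> x; rewrite mulr_ge0// invr_ge0 ltW.
- split=> [x x0|x x1].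
    by rewrite -(Fcst x 0) ?subrr ?mulr0// => z /andP[_ /bl].
  by rewrite (Fcst 1 x) ?mulVf ?gt_eqF// => z /andP[/br].
Qed.

End smooth_step.

Section windows.
Context {R : realType}.
Notation mu := (@lebesgue_measure R).

Lemma der_little_o (f : R -> R) (t d : R) :
  (forall e, 0 < e -> \forall s \near t, `|f s - f t - (s - t) * d| <= e * `|s - t|) ->
  der f t d.
Proof.
move=> H.
have cv : h^-1 *: ((f \o shift t) (h *: 1) - f t) @[h --> 0^'] --> d.
  apply/cvgrPdist_le => e e0.
  have H' := H _ e0; rewrite (near_shift 0 t) subr0 in H'.
  have {H'} : \forall h \near 0^', `|f (h + t) - f t - (h + t - t) * d| <= e * `|h + t - t|.
    exact: nbhs_dnbhs.
  apply: filter_app; near=> h.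
  have h0 : h != 0 by near: h; exact: nbhs_dnbhs_neq.
  rewrite addrK => he.
  rewrite /= /GRing.scale/= mulr1.
  have -> : d - h^-1 * (f (h + t) - f t) = - (h^-1 * (f (h + t) - f t - h * d)).
    by field.
  by rewrite normrN normrM normfV mulrC ler_pdivrMr ?normr_gt0.
apply: DeriveDef; first by apply/cvg_ex; exists d.
by apply/cvg_lim.
Unshelve. all: end_near. Qed.

Lemma der_gt0_left (f : R -> R) (t d : R) : der f t d -> 0 < d ->
  exists2 e, 0 < e & forall s, t - e < s < t -> f s < f t.
Proof.
move=> fd d0.
have /cvg_ex[l cl] : derivable f t 1 by apply: ex_derive.
have ld : l = d.
  have <- : 'D_1 f t = d by rewrite derive_val.
  by apply/esym/cvg_lim.
move: cl; rewrite ld => /cvgrPdist_lt /(_ _ d0).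
move=> /nbhs_ballP[e /= e0 H]; exists e => // s /andP[es st].
have := H (s - t); rewrite /ball/= sub0r normrN.
have st0 : s - t < 0 by rewrite subr_lt0.
rewrite ltr0_norm// opprB => /(_ _ (ltr0_neq0 st0)).
rewrite ltrBlDr -ltrBlDl => /(_ es).
rewrite /GRing.scale/= mulr1 subrK => /ltr_normlW.
rewrite ltrBlDr ltrDl => h.
have := nmulr_rgt0 (f s - f t) (_ : (s - t)^-1 < 0).
by rewrite invr_lt0 => /(_ st0); rewrite h subr_lt0.
Qed.

Lemma norm_int_itv (f : R -> R) (B u v : R) : u <= v -> continuous f ->
  (forall x, u <= x <= v -> `|f x| <= B) ->
  `|\int[mu]_(x in `[u, v]) f x| <= B * (v - u).
Proof.
move=> uv cf fB.
have If : mu.-integrable `[u, v] (EFin \o f).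
  by apply: continuous_itv_integrable => x _; exact: cf.
have IB : mu.-integrable `[u, v] (EFin \o cst B).
  by apply: continuous_itv_integrable => x _; exact: cst_continuous.
apply: (le_trans (le_normr_Rintegral _ If)) => //.
have -> : B * (v - u) = \int[mu]_(x in `[u, v]) (cst B x).
  have d (x : R) : der (fun x => B * x) x B.
    by apply: (is_derive_eq (derZ B (der_id x))); rewrite mulr1.
  rewrite (FTC (f := cst B) uv (fun x _ => d x)) ?mulrBr// => x _.
  exact: cst_continuous.
by apply: le_Rintegral => //; exact: integrable_norm.
Qed.

Lemma der_int_right (f : R -> R) (u x : R) : continuous f -> u < x ->
  der (fun z => \int[mu]_(t in `[u, z]) f t) x (f x).
Proof.
move=> cf ux.
have xu : x < x + 1 by rewrite ltrDl.
have Iu : mu.-integrable `[u, x + 1] (EFin \o f).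
  by apply: continuous_itv_integrable => z _; exact: cf.
have [d1 d2] := @continuous_FTC1_closed R f u x (x + 1) xu Iu ux (cf x).
by rewrite -d2; exact: derivable_der.
Qed.

Lemma int_itvB (f : R -> R) (u x z : R) : continuous f -> u <= x -> x <= z ->
  \int[mu]_(t in `[x, z]) f t =
  \int[mu]_(t in `[u, z]) f t - \int[mu]_(t in `[u, x]) f t.
Proof.
move=> cf ux xz; rewrite (@int_itv_split _ f u x z)//; first by rewrite addrC addKr.
by apply: continuous_itv_integrable => y _; exact: cf.
Qed.

Lemma der_window_len (f : R -> R) (x m : R) : continuous f -> 0 < m ->
  der (fun l => \int[mu]_(t in `[x, x + l]) f t) m (f (x + m)).
Proof.
move=> cf m0; have d := derD (der_cst x m) (der_id m).
have xm : x < x + m by rewrite ltrDl.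
apply: (is_derive_eq (der_comp (f := fun z => \int[mu]_(t in `[x, z]) f t)
  (der_int_right cf xm) d)).
by rewrite add0r mulr1.
Qed.

Lemma der_window_shift (f : R -> R) (l x : R) : continuous f -> 0 <= l ->
  der (fun z => \int[mu]_(t in `[z, z + l]) f t) x (f (x + l) - f x).
Proof.
move=> cf l0; pose u := x - 1.
have ux : u < x by rewrite /u ltrBlDr ltrDl.
have uxl : u < x + l by rewrite (lt_le_trans ux)// lerDl.
have d := derD (der_id x) (der_cst l x).
have d1 := derB (der_comp (f := fun z => \int[mu]_(t in `[u, z]) f t) (g := +%R^~ l)
  (der_int_right cf uxl) d) (der_int_right cf ux).
have E : \forall z \near x, \int[mu]_(t in `[u, z + l]) f t - \int[mu]_(t in `[u, z]) f t
    = \int[mu]_(t in `[z, z + l]) f t.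
  apply: filterS (lt_nbhsr ux) => z uz.
  by rewrite -int_itvB// ?lerDl// ltW.
by apply: (is_derive_eq (near_eq_is_derive E d1)); rewrite addr0 mulr1.
Qed.

End windows.

(** * Time derivative of window integrals from the weak equation *)

Section weak_derivative.
Context {R : realType}.
Notation mu := (@lebesgue_measure R).
Variables (S beta : R -> R).
Hypotheses (Sk : forall k, diffn k S) (dS : forall x : R, der S x (beta x)).
Hypotheses (cbeta : continuous beta) (beta0 : forall x, 0 <= beta x).
Hypotheses (Sl : forall x, x <= 0 -> S x = 0) (Sr : forall x, 1 <= x -> S x = 1).

Let Smono (x z : R) : x <= z -> S x <= S z.
Proof.
by move=> xz; apply: (nondecreasing_der xz (fun w _ => dS w)) => w _; exact: beta0.
Qed.

Let S0 x : 0 <= S x.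
Proof.
have [x0|x0] := leP x 0; first by rewrite Sl.
by rewrite -(Sl (lexx 0)) Smono// ltW.
Qed.

Let S1 x : S x <= 1.
Proof.
have [x0|x0] := leP 1 x; first by rewrite Sr.
by rewrite -(Sr (lexx 1)) Smono// ltW.
Qed.

Let betal x : x < 0 -> beta x = 0.
Proof.
move=> x0; rewrite -(der_derive1 (dS x)).
apply: der_derive1; apply: near_eq_is_derive (der_cst 0 x).
by apply: filterS (lt_nbhsl x0) => y y0; rewrite Sl// ltW.
Qed.

Let betar x : 1 < x -> beta x = 0.
Proof.
move=> x0; rewrite -(der_derive1 (dS x)).
apply: der_derive1; apply: near_eq_is_derive (der_cst 1 x).
by apply: filterS (lt_nbhsr x0) => y y0; rewrite Sr// ltW.
Qed.

(** The step rescaled to rise on [[z, z + w]]; the argument [(x - z) / w] is expanded into the form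
    [a * x + b] required by [diffn_affine]. *)
Definition ramp (w z x : R) : R := S (w^-1 * x + - (w^-1 * z)).
Definition ramp' (w z x : R) : R := w^-1 * beta (w^-1 * x + - (w^-1 * z)).

Lemma ramp_diffn k (w z : R) : diffn k (ramp w z).
Proof. exact: diffn_affine. Qed.

Lemma der_ramp (w z x : R) : der (ramp w z) x (ramp' w z x).
Proof.
have d := derD (derZ w^-1 (der_id x)) (der_cst (- (w^-1 * z)) x).
by apply: (is_derive_eq (der_comp (dS _) d)); rewrite mulr1 addr0 mulrC.
Qed.

Lemma continuous_ramp' (w z : R) : continuous (ramp' w z).
Proof. move=> x; apply: cvgM; first exact: cvg_cst.
apply: (@continuous_comp _ _ _ (fun x => w^-1 * x + - (w^-1 * z)) beta); last exact: cbeta.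
exact: der_cont (derD (derZ w^-1 (der_id x)) (der_cst _ x)). Qed.

Lemma ramp_le w z x : 0 < w -> x <= z -> ramp w z x = 0.
Proof. by move=> w0 xz; rewrite /ramp Sl// -mulrBr pmulr_rle0 ?invr_gt0// subr_le0. Qed.

Lemma ramp_ge w z x : 0 < w -> z + w <= x -> ramp w z x = 1.
Proof.
move=> w0 xz; rewrite /ramp Sr// -mulrBr mulrC ler_pdivlMr// mul1r; lra.
Qed.

Lemma ramp'_ge0 w z x : 0 < w -> 0 <= ramp' w z x.
Proof. by move=> w0; rewrite mulr_ge0 ?invr_ge0 ?(ltW w0). Qed.

Lemma ramp'_out w z x : 0 < w -> ~~ (z <= x <= z + w) -> ramp' w z x = 0.
Proof.
move=> w0; rewrite negb_and -!ltNge => /orP[xz|xz]; rewrite /ramp'.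
  by rewrite betal ?mulr0// -mulrBr pmulr_rlt0 ?invr_gt0// subr_lt0.
by rewrite betar ?mulr0// -mulrBr mulrC ltr_pdivlMr// mul1r; lra.
Qed.

Lemma L1_ramp' w z : 0 < w -> L1 (ramp' w z).
Proof.
move=> w0; apply: (@continuous_support_L1 _ _ (`|z| + w)); first exact: continuous_ramp'.
move=> x; rewrite lter_normr => zx; apply: ramp'_out => //; apply/negP => /andP[zx1 zx2].
have := ler_norm z; have := ler_norm (- z); rewrite normrN => h1 h2.
by case/orP: zx => zx; lra.
Qed.

Lemma int_ramp' w z : 0 < w -> \int[mu]_x ramp' w z x = 1.
Proof.
move=> w0; have supp x : `|z| + w < `|x| -> ramp' w z x = 0.
  rewrite lter_normr => zx; apply: ramp'_out => //; apply/negP => /andP[zx1 zx2].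
  have := ler_norm z; have := ler_norm (- z); rewrite normrN => h1 h2.
  by case/orP: zx => zx; lra.
have A0 : 0 <= `|z| + w by rewrite addr_ge0// ltW.
have AA : - (`|z| + w) <= `|z| + w by rewrite (le_trans _ A0)// oppr_le0.
rewrite -(int_support supp (lexx _)).
rewrite (FTC AA (fun x _ => der_ramp w z x) (fun x _ => @continuous_ramp' w z x)).
have := ler_norm z; have := ler_norm (- z); rewrite normrN => h1 h2.
by rewrite ramp_ge// ?ramp_le ?subr0//; lra.
Qed.

(** [ramp' w z] is a probability density carried by [[z, z + w]], so it averages [k] over that
    interval. This turns a pairing with a test function into point values of the flux. *)
Lemma int_ramp'_close (k : R -> R) (w z l e : R) : 0 < w -> continuous k ->
  (forall x, z <= x <= z + w -> `|k x - l| <= e) ->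
  L1 (fun x => k x * ramp' w z x) /\
  `|\int[mu]_x (k x * ramp' w z x) - l| <= e.
Proof.
move=> w0 ck kl.
have cr := @continuous_ramp' w z.
have Ir := L1_ramp' z w0.
have Ik : L1 (fun x => k x * ramp' w z x).
  apply: (@continuous_support_L1 _ _ (`|z| + w)).
    by move=> x; apply: cvgM; [exact: ck|exact: cr].
  move=> x; rewrite lter_normr => zx; rewrite ramp'_out ?mulr0//; apply/negP => /andP[zx1 zx2].
  have := ler_norm z; have := ler_norm (- z); rewrite normrN => h1 h2.
  by case/orP: zx => zx; lra.
split => //.
have -> : l = \int[mu]_x (l * ramp' w z x) by rewrite intZ// int_ramp'// mulr1.
rewrite -intB//; last exact: L1Z.
apply: (le_trans (norm_int _)); first by apply: L1B => //; exact: L1Z.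
apply: (@le_trans _ _ (\int[mu]_x (e * ramp' w z x))); last first.
  by rewrite intZ// int_ramp'// mulr1.
apply: le_int => [||x].
- by apply: L1_norm; apply: L1B => //; exact: L1Z.
- exact: L1Z.
- rewrite -mulrBl normrM (ger0_norm (ramp'_ge0 _ _ w0)).
  have [xin|xout] := boolP (z <= x <= z + w); last by rewrite ramp'_out ?mulr0.
  by apply: ler_wpM2r; [exact: ramp'_ge0|exact: kl].
Qed.

Definition plateau (w x1 x2 x : R) := ramp w x1 x + -1 * ramp w x2 x.

Lemma der_plateau w x1 x2 (x : R) :
  der (plateau w x1 x2) x (ramp' w x1 x + -1 * ramp' w x2 x).
Proof. exact: (derD (der_ramp _ _ _) (derZ _ (der_ramp _ _ _))). Qed.

Lemma plateau_diffn k w x1 x2 : diffn k (plateau w x1 x2).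
Proof. by apply: diffnD; [exact: ramp_diffn|apply: diffnZ; exact: ramp_diffn]. Qed.

Lemma plateau_out w x1 x2 x : 0 < w -> x1 < x2 -> ~~ (x1 <= x <= x2 + w) ->
  plateau w x1 x2 x = 0.
Proof.
move=> w0 x12; rewrite negb_and -!ltNge /plateau => /orP[xx|xx].
  by rewrite !ramp_le ?mulr0 ?addr0// ltW// (lt_trans xx).
by rewrite !ramp_ge ?mulr1 ?subrr//; lra.
Qed.

Lemma test_plateau w x1 x2 : 0 < w -> x1 < x2 -> test_function (plateau w x1 x2).
Proof.
move=> w0 x12; split.
  by apply: diffn_derivable => k; exact: plateau_diffn.
exists (`|x1| + `|x2| + w) => x; rewrite lter_normr => zx.
apply: plateau_out => //; apply/negP => /andP[h1 h2].
have := ler_norm x2; have := ler_norm (- x1); rewrite normrN => h3 h4.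
have := normr_ge0 x1; have := normr_ge0 x2.
by case/orP: zx => zx; lra.
Qed.

(** The error lives on the two ramps. These may overlap when [w > x2 - x1], so all relative
    positions of the four break points are examined. *)
Let plateau_bool (w x1 x2 x p1 p2 : R) : 0 < w -> x1 < x2 ->
  0 <= p1 <= 1 -> 0 <= p2 <= 1 ->
  (x <= x1 -> p1 = 0) -> (x1 + w <= x -> p1 = 1) ->
  (x <= x2 -> p2 = 0) -> (x2 + w <= x -> p2 = 1) ->
  `|(if (x1 <= x <= x2)%R then 1 else 0) - (p1 - p2)| <=
  (x1 <= x <= x1 + w)%R%:R + (x2 <= x <= x2 + w)%R%:R.
Proof.
move=> w0 x12 /andP[p10 p11] /andP[p20 p21] e1 e2 e3 e4.
case: (leP x1 x) => a1; case: (leP x x2) => a2; case: (leP x (x1 + w)) => a3;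
case: (leP x2 x) => a4; case: (leP x (x2 + w)) => a5 /=;
(try have h1 := e1 (ltW a1)); (try have h2 := e2 (ltW a3)); (try have h3 := e3 a2);
(try have h4 := e3 (ltW a4)); (try have h5 := e4 (ltW a5));
by rewrite ler_norml; apply/andP; split; lra.
Qed.

Lemma plateau_approx (f : R -> R) (B w x1 x2 : R) : 0 < w -> x1 < x2 ->
  continuous f -> (forall x, `|f x| <= B) ->
  `|\int[mu]_(x in `[x1, x2]) f x - \int[mu]_x (f x * plateau w x1 x2 x)| <= 2 * B * w.
Proof.
move=> w0 x12 cf fB.
have B0 : 0 <= B by exact: le_trans (normr_ge0 _) (fB 0).
have cp : continuous (plateau w x1 x2) := continuous_der (der_plateau w x1 x2).
have [_ [A pA]] := test_plateau w0 x12.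
have Ip : L1 (fun x => f x * plateau w x1 x2 x).
  apply: (@continuous_support_L1 _ _ A) => [x|x Ax]; last by rewrite pA ?mulr0.
  by apply: cvgM; [exact: cf|exact: cp].
have If : L1 (f \_ `[x1, x2]).
  rewrite /L1 -restrict_EFin; apply/integrable_restrict => //=; rewrite setTI.
  by apply: continuous_itv_integrable => x _; exact: cf.
have I1 a b : L1 (\1_(`[a, b]%classic) : R -> R) by exact: integrable_indic_itv.
have i1 (z : R) : \int[mu]_x (\1_(`[z, z + w]%classic) x : R) = w.
  have zw : z <= z + w by rewrite lerDl ltW.
  transitivity (\int[mu]_(x in `[z, z + w]) (cst 1 x : R)).
    rewrite [RHS]Rintegral_mkcond; congr Rintegral; apply/funext => x.
    by rewrite indicE patchE; case: ifP.
  rewrite (FTC (F := id) zw (fun x _ => der_id x)); last by move=> x _; exact: cst_continuous.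
  by rewrite addrC addKr.
rewrite Rintegral_mkcond -intB//; apply: (le_trans (norm_int (L1B If Ip))).
apply: (@le_trans _ _ (\int[mu]_x (B * \1_(`[x1, x1 + w]%classic) x +
    B * \1_(`[x2, x2 + w]%classic) x))); last first.
  rewrite (intD (L1Z B (I1 _ _)) (L1Z B (I1 _ _))) !intZ ?i1//; lra.
apply: le_int => [||x]; first exact/L1_norm/L1B.
  by apply: L1D; exact: L1Z.
rewrite patchE !indicE.
have ind (b : bool) : 0 <= B * b%:R by rewrite mulr_ge0.
have key : `|(if x \in `[x1, x2]%classic then 1 else 0) - plateau w x1 x2 x| <=
   (x \in `[x1, x1 + w]%classic)%:R + (x \in `[x2, x2 + w]%classic)%:R.
  rewrite !mem_setE !in_itv/= /plateau mulN1r.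
  apply: plateau_bool => //.
  - by rewrite S0 S1.
  - by rewrite S0 S1.
  - exact: ramp_le.
  - exact: ramp_ge.
  - exact: ramp_le.
  - exact: ramp_ge.
rewrite -mulrDr; apply: (@le_trans _ _ (`|f x| *
    `|(if x \in `[x1, x2]%classic then 1 else 0) - plateau w x1 x2 x|)).
  by rewrite -normrM mulrBr; case: ifP => _; rewrite ?mulr1 ?mulr0.
by apply: ler_pM.
Qed.

(* The indicator of [[x1, x2]] is approximated by [plateau w x1 x2]; the error on
   difference quotients is uniform in [w] by the mean value theorem. *)
Lemma weak_derivative (y k : R -> R -> R) (t B x1 x2 : R) : x1 < x2 ->
  (\forall s \near t, [/\ continuous (y s), continuous (k s) & forall x, `|y s x| <= B]) ->
  (forall e, 0 < e -> \forall s \near t, forall x, `|k s x - k t x| <= e) ->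
  (\forall s \near t, forall phi, test_function phi ->
     der (fun s : R => \int[mu]_x (y s x * phi x)) (s : R) (\int[mu]_x (k s x * derive1 phi x))) ->
  der (fun s : R => \int[mu]_(x in `[x1, x2]) y s x) t (k t x1 - k t x2).
Proof.
move=> x12 reg uni weak; apply: der_little_o => e e0.
have e4 : 0 < e / 4 by rewrite divr_gt0.
have [_ ckt _] := nbhs_singleton reg.
have near_point (x : R) : exists2 d, 0 < d & forall z, x <= z <= x + d -> `|k t z - k t x| <= e / 4.
  have /cvgrPdist_le /(_ _ e4) /nbhs_ballP[d /= d0 H] := ckt x.
  exists (d / 2); first by rewrite divr_gt0.
  move=> z /andP[xz zx]; rewrite distrC; apply: H; rewrite /ball/= distrC ger0_norm; lra.
have [d1 d10 H1] := near_point x1; have [d2 d20 H2] := near_point x2.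
have [r /= r0 Hr] : exists2 r : R, 0 < r & forall s, `|t - s| < r ->
  [/\ [/\ continuous (y s), continuous (k s) & forall x, `|y s x| <= B],
     forall x, `|k s x - k t x| <= e / 4 & forall phi, test_function phi ->
     der (fun s : R => \int[mu]_x (y s x * phi x)) (s : R) (\int[mu]_x (k s x * derive1 phi x))].
  have : \forall s \near t, [/\ [/\ continuous (y s), continuous (k s) & forall x, `|y s x| <= B],
     forall x, `|k s x - k t x| <= e / 4 & forall phi, test_function phi ->
     der (fun s : R => \int[mu]_x (y s x * phi x)) (s : R) (\int[mu]_x (k s x * derive1 phi x))].
    by near=> s; split; near: s; [exact: reg|exact: uni|exact: weak].
  by move=> /nbhs_ballP[r /= r0 H]; exists r.
exists r => //= s sr; have {}sr : `|t - s| < r := sr.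
set J := fun s => \int[mu]_(x in `[x1, x2]) y s x; rewrite -/(J s) -/(J t).
(* Valid for all times within [r] and all small [w], with [r] fixed before [w]. Each end point costs
   [e / 4] for the variation in time and [e / 4] for that in space, which makes [e] in total. *)
have rate w tau : 0 < w -> w <= d1 -> w <= d2 -> `|t - tau| < r ->
   `|\int[mu]_x (k tau x * derive1 (plateau w x1 x2) x) - (k t x1 - k t x2)| <= e.
  move=> w0 wd1 wd2 /Hr[[_ ck _] kt _].
  have near (z : R) : (forall u, z <= u <= z + w -> `|k t u - k t z| <= e / 4) ->
      forall x, z <= x <= z + w -> `|k tau x - k t z| <= e / 2.
    move=> H x xz; have -> : k tau x - k t z = (k tau x - k t x) + (k t x - k t z) by ring.
    apply: (le_trans (ler_normD _ _)); have := kt x; have := H x xz; lra.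
  have n1 : forall u, x1 <= u <= x1 + w -> `|k t u - k t x1| <= e / 4.
    by move=> u /andP[u1 u2]; apply: H1; rewrite u1 /=; lra.
  have n2 : forall u, x2 <= u <= x2 + w -> `|k t u - k t x2| <= e / 4.
    by move=> u /andP[u1 u2]; apply: H2; rewrite u1 /=; lra.
  have [I1 C1] := int_ramp'_close w0 ck (near x1 n1).
  have [I2 C2] := int_ramp'_close w0 ck (near x2 n2).
  have -> : (fun x => k tau x * derive1 (plateau w x1 x2) x) =
     (fun x => k tau x * ramp' w x1 x - k tau x * ramp' w x2 x).
    by apply/funext => x; rewrite (der_derive1 (der_plateau _ _ _ _)); ring.
  rewrite (intB I1 I2).
  set u1 := \int[mu]_x _ in C1 *; set u2 := \int[mu]_x _ in C2 *.
  have -> : u1 - u2 - (k t x1 - k t x2) = (u1 - k t x1) - (u2 - k t x2) by ring.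
  by apply: (le_trans (ler_normB _ _)); lra.
pose m w tau := \int[mu]_x (y tau x * plateau w x1 x2 x).
pose m' w tau := \int[mu]_x (k tau x * derive1 (plateau w x1 x2) x).
have dm w tau : 0 < w -> `|t - tau| < r -> der (m w) tau (m' w tau).
  by move=> w0 /Hr[_ _]; apply; exact: test_plateau.
have mrate w : 0 < w -> w <= d1 -> w <= d2 ->
    `|m w s - m w t - (s - t) * (k t x1 - k t x2)| <= e * `|t - s|.
  move=> w0 wd1 wd2.
  have fin c : `|t - c| < r -> m w s - m w t = m' w c * (s - t) ->
      `|m w s - m w t - (s - t) * (k t x1 - k t x2)| <= e * `|t - s|.
    move=> cr ->; rewrite (mulrC (m' w c)) -mulrBr normrM mulrC (distrC s t).
    by apply: ler_wpM2r => //; exact: rate.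
  have [ts|st|ts] := ltgtP t s; last first.
  - by apply: (fin t); rewrite ?subrr ?normr0// -ts !subrr mulr0.
  - have close c : s <= c <= t -> `|t - c| < r.
      move=> /andP[c1 c2]; rewrite ger0_norm ?subr_ge0//; move: sr.
      by rewrite gtr0_norm ?subr_gt0//; lra.
    have [|c|c cst E] := @MVT _ (m w) (m' w) s t st.
    + by move=> c; rewrite in_itv/= => /andP[/ltW c1 /ltW c2]; apply: dm => //; apply: close; rewrite c1.
    + apply: continuous_in_subspaceT => {}c; rewrite inE/= in_itv/= => /close cr.
      exact: der_cont (dm w c w0 cr).
    apply: (fin c).
      by apply: close; move: cst; rewrite in_itv/= => /andP[/ltW -> /ltW ->].
    by rewrite -[LHS]opprB E; ring.
  - have close c : t <= c <= s -> `|t - c| < r.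
      move=> /andP[c1 c2]; rewrite ler0_norm ?subr_le0//; move: sr.
      by rewrite ltr0_norm ?subr_lt0//; lra.
    have [|c|c cst E] := @MVT _ (m w) (m' w) t s ts.
    + by move=> c; rewrite in_itv/= => /andP[/ltW c1 /ltW c2]; apply: dm => //; apply: close; rewrite c1.
    + apply: continuous_in_subspaceT => {}c; rewrite inE/= in_itv/= => /close cr.
      exact: der_cont (dm w c w0 cr).
    apply: (fin c); last exact: E.
    by apply: close; move: cst; rewrite in_itv/= => /andP[/ltW -> /ltW ->].
have [[cyt _ yB] _ _] : [/\ [/\ continuous (y t), continuous (k t) & forall x, `|y t x| <= B],
     forall x, `|k t x - k t x| <= e / 4 & forall phi, test_function phi ->
     der (fun s : R => \int[mu]_x (y s x * phi x)) t (\int[mu]_x (k t x * derive1 phi x))].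
  by apply: Hr; rewrite subrr normr0.
have [[cys _ ysB] _ _] := Hr s sr.
have B0 : 0 <= B by exact: le_trans (normr_ge0 _) (yB 0).
apply/ler_addgt0Pr => eta eta0.
(* With [s] fixed, [w] can still be shrunk: replacing the two windows by plateaus costs at most
   [4 * B * w <= eta], and [eta] is arbitrary. *)
pose w := Num.min (Num.min d1 d2) (eta / (4 * B + 1)).
have B41 : 0 < 4 * B + 1 by lra.
have w0 : 0 < w by rewrite !lt_min d10 d20 divr_gt0.
have wd1 : w <= d1 by rewrite !ge_min lexx.
have wd2 : w <= d2 by rewrite !ge_min lexx orbT.
have we : w * (4 * B + 1) <= eta by rewrite -ler_pdivlMr// !ge_min lexx !orbT.
have a1 := plateau_approx w0 x12 cys ysB; have a2 := plateau_approx w0 x12 cyt yB.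
have a3 := mrate w w0 wd1 wd2.
rewrite -/(J s) -/(m w s) in a1; rewrite -/(J t) -/(m w t) in a2.
have -> : J s - J t - (s - t) * (k t x1 - k t x2) =
   (J s - m w s) - (J t - m w t) + (m w s - m w t - (s - t) * (k t x1 - k t x2)) by ring.
apply: (le_trans (ler_normD _ _)).
have := ler_normB (J s - m w s) (J t - m w t).
rewrite (distrC s t); move: a1 a2 a3 we w0; set A1 := `|_|; set A2 := `|_|; set A3 := `|_|; set A4 := `|_|.
nra.
Unshelve. all: end_near. Qed.

End weak_derivative.

(** * Maximum principle for the transport equation *)

Section maximum_principle.
Context {R : realType}.
Notation mu := (@lebesgue_measure R).
Variables (y a : R -> R -> R) (t1 B : R).
Hypothesis B0 : 0 < B.
Hypothesis cy : forall t, 0 <= t <= t1 -> continuous (y t).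
Hypothesis yB : forall t x, 0 <= t <= t1 -> `|y t x| <= B.
Hypothesis aB : forall t x, 0 <= t <= t1 -> `|a t x| <= B.
Hypothesis uni : forall t e, 0 <= t <= t1 -> 0 < e -> exists2 d, 0 < d &
  forall s x, 0 <= s <= t1 -> `|s - t| < d -> `|y s x - y t x| <= e.
Hypothesis transport : forall t x1 x2, 0 < t <= t1 -> x1 < x2 ->
  der (fun s : R => \int[mu]_(x in `[x1, x2]) y s x) t
      (a t x1 * y t x1 - a t x2 * y t x2).
Hypothesis y0 : forall x, 0 <= y 0 x.

Let W (t x l : R) : R := \int[mu]_(z in `[x, x + l]) y t z.

Let W_bound t x l : 0 <= t <= t1 -> 0 <= l -> `|W t x l| <= B * l.
Proof.
move=> t01 l0; have xl : x <= x + l by rewrite lerDl.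
apply: (le_trans (norm_int_itv xl (cy t01) (B := B) _)) => [z _|]; first exact: yB.
by rewrite addrC addKr.
Qed.

(** Integrals from a fixed base point [- D] make a window a difference of two values, which
    separates the dependence on time from that on each end point. *)
Let Z (D t x : R) : R := \int[mu]_(z in `[- D, x]) y t z.

Let WE D t x l : 0 <= t <= t1 -> - D <= x -> 0 <= l -> W t x l = Z D t (x + l) - Z D t x.
Proof. by move=> t01 Dx l0; rewrite /W (int_itvB (cy t01) Dx)// lerDl. Qed.

Let Z_lip D t u v : 0 <= t <= t1 -> - D <= u -> - D <= v ->
  `|Z D t u - Z D t v| <= B * `|u - v|.
Proof.
move=> t01; wlog uv : u v / u <= v => [H|] Du Dv.
  by have [/H|/ltW/H] := leP u v; [exact|rewrite distrC (distrC u); exact].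
rewrite distrC -(int_itvB (cy t01) Du uv) (distrC u) (ger0_norm (_ : 0 <= v - u)) ?subr_ge0//.
apply: norm_int_itv => // [|x _]; [exact: cy|exact: yB].
Qed.

Let Z_time D t s u e : 0 <= t <= t1 -> 0 <= s <= t1 -> - D <= u ->
  (forall x, `|y s x - y t x| <= e) -> `|Z D s u - Z D t u| <= e * (u + D).
Proof.
move=> t01 s01 Du ye.
have Iy r : 0 <= r <= t1 -> mu.-integrable `[- D, u] (EFin \o y r).
  by move=> r01; apply: continuous_itv_integrable => x _; exact: cy.
rewrite /Z -RintegralB//; [|exact: Iy|exact: Iy].
have -> : u + D = u - - D by rewrite opprK.
apply: norm_int_itv => // x.
by apply: cvgB; [exact: cy|exact: cy].
Qed.

(* Coercive in the window, and growing in time faster than the flux at a minimum. *)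
Let pen (e lam t x l : R) : R := e * expR (lam * t) * (1 + x ^+ 2 + (x + l) ^+ 2).

Let G (e lam t x l : R) : R := W t x l + pen e lam t x l.

(** Joint continuity on the compact set where the minimum is sought. Windows with [|x| <= A] and
    [l <= 2 * A] end at distance at most [4 * A] from the base point [- A]. *)
Let continuous_G e lam A : 0 < A ->
  {within (`[0, t1] `*` (`[- A, A] `*` `[0, 2 * A]))%classic,
    continuous (fun z : R * (R * R) => G e lam z.1 z.2.1 z.2.2)}.
Proof.
move=> A0; apply/subspace_continuousP => -[t [x l]] /= [].
rewrite !in_itv/= => t01 [/andP[xA Ax] /andP[l0 lA]].
have c1 : z.1 @[z --> within (`[0, t1] `*` (`[- A, A] `*` `[0, 2 * A]))%classic
    (nbhs (t, (x, l)))] --> t.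
  by apply: cvg_within_filter; exact: cvg_fst.
have c2 : z.2.1 @[z --> within (`[0, t1] `*` (`[- A, A] `*` `[0, 2 * A]))%classic
    (nbhs (t, (x, l)))] --> x.
  apply: cvg_within_filter.
  apply: (@cvg_comp _ _ _ snd fst); [exact: cvg_snd|exact: cvg_fst].
have c3 : z.2.2 @[z --> within (`[0, t1] `*` (`[- A, A] `*` `[0, 2 * A]))%classic
    (nbhs (t, (x, l)))] --> l.
  apply: cvg_within_filter.
  apply: (@cvg_comp _ _ _ snd snd); [exact: cvg_snd|exact: cvg_snd].
apply: cvgD; last first.
  apply: cvgM.
    apply: cvgM; first exact: cvg_cst.
    apply: (@cvg_comp _ _ _ (fun z : R * (R * R) => lam * z.1) expR); last exact: continuous_expR.
    by apply: cvgM; [exact: cvg_cst|exact: c1].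
  apply: cvgD; first apply: cvgD; first exact: cvg_cst.
    by rewrite expr2; under eq_fun do rewrite expr2; exact: cvgM.
  rewrite expr2; under eq_fun do rewrite expr2.
  by apply: cvgM; apply: cvgD.
apply/cvgrPdist_le => eta eta0.
(* The two time errors come to [eta / 4] and [eta / 8], the two end point errors to [eta / 3] and
   [eta / 6]; their sum is below [eta]. *)
have eta1 : 0 < eta / (16 * A) by rewrite divr_gt0// mulr_gt0.
have [d d0 Hd] := uni t01 eta1.
have eta2 : 0 < eta / (6 * B) by rewrite divr_gt0// mulr_gt0.
move/cvgrPdist_lt : c1 => /(_ _ d0) c1.
move/cvgrPdist_le : c2 => /(_ _ eta2) c2.
move/cvgrPdist_le : c3 => /(_ _ eta2) c3.
near=> z.
have [/=] : (`[0, t1] `*` (`[- A, A] `*` `[0, 2 * A]))%classic z.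
  by near: z; exact: withinT.
rewrite !in_itv/= => s01 [/andP[zA Az] /andP[m0 mA]].
have h1 : `|t - z.1| < d by near: z.
have h2 : `|x - z.2.1| <= eta / (6 * B) by near: z.
have h3 : `|l - z.2.2| <= eta / (6 * B) by near: z.
rewrite (WE (D := A))// (WE (D := A))//.
set s := z.1 in s01 h1 *; set x' := z.2.1 in zA Az h2 *; set l' := z.2.2 in m0 mA h3 *.
have sy w : `|y s w - y t w| <= eta / (16 * A) by apply: Hd => //; rewrite distrC.
have k1 := Z_time t01 s01 (_ : - A <= x + l) sy.
have k2 := Z_time t01 s01 xA sy.
have k3 := Z_lip s01 (_ : - A <= x + l) (_ : - A <= x' + l').
have k4 := Z_lip s01 xA zA.
have xl : - A <= x + l by rewrite (le_trans xA)// lerDl.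
have x'l' : - A <= x' + l' by rewrite (le_trans zA)// lerDl.
move: {k1 k3}(k1 xl) (k3 xl x'l') k2 k4.
have -> : Z A t (x + l) - Z A t x - (Z A s (x' + l') - Z A s x') =
  - (Z A s (x + l) - Z A t (x + l)) + (Z A s x - Z A t x)
  + (Z A s (x + l) - Z A s (x' + l')) - (Z A s x - Z A s x') by ring.
move=> k1 k3 k2 k4.
apply: (le_trans (ler_normB _ _)).
apply: (le_trans (lerD (ler_normD _ _) (lexx _))).
apply: (le_trans (lerD (lerD (ler_normD _ _) (lexx _)) (lexx _))); rewrite normrN.
have j1 : eta / (16 * A) * (x + l + A) <= eta / 4.
  have -> : eta / 4 = eta / (16 * A) * (A + 2 * A + A) by field; rewrite gt_eqF.
  by rewrite ler_pM2l// lerD2r lerD.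
have j2 : eta / (16 * A) * (x + A) <= eta / 8.
  have -> : eta / 8 = eta / (16 * A) * (A + A) by field; rewrite gt_eqF.
  by rewrite ler_pM2l// lerD2r.
have j3 : B * `|x + l - (x' + l')| <= eta / 3.
  have -> : eta / 3 = B * (eta / (6 * B) + eta / (6 * B)) by field; rewrite gt_eqF.
  rewrite ler_pM2l//; have -> : x + l - (x' + l') = (x - x') + (l - l') by ring.
  by apply: (le_trans (ler_normD _ _)); exact: lerD.
have j4 : B * `|x - x'| <= eta / 6.
  have -> : eta / 6 = B * (eta / (6 * B)) by field; rewrite gt_eqF.
  by rewrite ler_pM2l.
lra.
Unshelve. all: end_near. Qed.

Let der_pen_x (e lam t x l : R) : der (fun z : R => pen e lam t z l : R) x
  (e * expR (lam * t) * (2 * x + 2 * (x + l))).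
Proof.
have d1 := derX 1 (der_id x); have d2 := derX 1 (derD (der_id x) (der_cst l x)).
have d := derZ (e * expR (lam * t)) (derD (derD (der_cst 1 x) d1) d2).
by apply: (is_derive_eq d); rewrite !expr1; ring.
Qed.

Let der_pen_l (e lam t x l : R) : der (fun m : R => pen e lam t x m) l
  (e * expR (lam * t) * (2 * (x + l))).
Proof.
have d2 := derX 1 (derD (der_cst x l) (der_id l)).
have d := derZ (e * expR (lam * t)) (derD (der_cst (1 + x ^+ 2) l) d2).
by apply: (is_derive_eq d); rewrite !expr1; ring.
Qed.

Let der_pen_t (e lam t x l : R) : der (fun s : R => pen e lam s x l) t
  (lam * pen e lam t x l).
Proof.
have d1 := der_comp (is_derive_expR (lam * t)) (derZ lam (der_id t)).
have d := derM (derZ e d1) (der_cst (1 + x ^+ 2 + (x + l) ^+ 2) t).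
by apply: (is_derive_eq d); rewrite /pen; ring.
Qed.

(* At a negative interior minimum of [G], stationarity in the two end points of the
   window gives [y] there in terms of the penalty, and then the time derivative of [G]
   is positive, so that [G] was smaller just before. *)
Lemma window_ge0 t x l : 0 <= t <= t1 -> 0 <= l -> 0 <= W t x l.
Proof.
move=> ts l0; rewrite leNgt; apply/negP => W0.
(* At the minimum the flux term is at least [- 2 * B * p * Q] while the penalty grows at rate
   [lam * p * Q]; this [lam] leaves a margin [p * Q > 0]. *)
pose lam := 2 * B + 1.
pose Q x l : R := 1 + x ^+ 2 + (x + l) ^+ 2.
have Q1 u v : 1 <= Q u v by rewrite /Q -addrA lerDl addr_ge0 ?sqr_ge0.
have QB u v : `|u| + `|u + v| <= Q u v.
  rewrite /Q -(real_normK (num_real u)) -(real_normK (num_real (u + v))).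
  have := sqr_ge0 (`|u| - 1); have := sqr_ge0 (`|u + v| - 1).
  have := sqr_ge0 `|u|; have := sqr_ge0 `|u + v|; rewrite !sqrrB; lra.
(* Chosen so that the penalty is half of [- W t x l] at the given point, where [G] is then
   [W t x l / 2], still negative. *)
pose e : R := (- W t x l) / (2 * (expR (lam * t) * Q x l)).
have EQ0 : 0 < expR (lam * t) * Q x l.
  by rewrite mulr_gt0 ?expR_gt0// (lt_le_trans ltr01).
have e0 : 0 < e by apply: divr_gt0; [rewrite oppr_gt0; exact: W0|rewrite mulr_gt0].
have Gneg : G e lam t x l < 0.
  have -> : G e lam t x l = W t x l / 2.
    rewrite /G /pen -/(Q x l) /e; field.
    by rewrite !gt_eqF ?expR_gt0// (lt_le_trans ltr01).
  by rewrite pmulr_llt0.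
have pen_ge s u v : 0 <= s -> e * Q u v <= pen e lam s u v.
  move=> s0; rewrite /pen -/(Q u v) -mulrA ler_pM2l//.
  rewrite ler_peMl//; first exact: le_trans ler01 (Q1 _ _).
  by rewrite -expR0 ler_expR mulr_ge0// addr_ge0// mulr_ge0// ltW.
have G_ge s u v : 0 <= s <= t1 -> 0 <= v -> e * Q u v - B * v <= G e lam s u v.
  move=> s01 v0; have /andP[s0 _] := s01.
  have := W_bound u s01 v0; have := pen_ge s u v s0; rewrite ler_norml /G.
  by move=> h1 /andP[h2 h3]; lra.
(* [A >= 2 * B / e] lets the quadratic penalty beat the linear bound [B * v] as soon as one end of
   the window is at distance [A] from 0; [|x| + l] puts the given window inside the compact set. *)
pose A := `|x| + l + 2 * B / e + 1.
have Be : 0 < 2 * B / e by rewrite divr_gt0// mulr_gt0.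
have A1 : 1 <= A by rewrite /A; have := normr_ge0 x; lra.
have A0 : 0 < A by lra.
have AA : - A <= A by rewrite ge0_cp ?ltW.
have far u v s : 0 <= s <= t1 -> 0 <= v -> (A <= `|u|) || (A <= `|u + v|) ->
    0 < G e lam s u v.
  move=> s01 v0 far; apply: lt_le_trans (G_ge s u v s01 v0).
  have vle : v <= `|u| + `|u + v|.
    by have := ler_norm (u + v); have := ler_norm (- u); rewrite normrN; lra.
  have eA : 2 * B <= e * A.
    have BA : 2 * B / e <= A by rewrite /A; have := normr_ge0 x; lra.
    by rewrite -(ler_pdivrMl _ _ e0) (mulrC e^-1).
  have big r : A <= r -> 0 <= r -> B * r <= e * r ^+ 2 / 2.
    move=> Ar r0; have h : 2 * B <= e * r by rewrite (le_trans eA)// ler_pM2l.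
    by have := ler_wpM2r r0 h; rewrite expr2; lra.
  have small r p : 0 <= r -> r <= p -> A <= p -> B * r <= e * p ^+ 2 / 2.
    move=> r0 rp Ap; have p0 : 0 <= p by lra.
    by apply: le_trans (big p Ap p0); rewrite ler_pM2l.
  rewrite subr_gt0 /Q.
  have Bv : B * v <= B * (`|u| + `|u + v|) by rewrite ler_pM2l.
  apply: (le_lt_trans Bv); rewrite mulrDr.
  rewrite -(real_normK (num_real u)) -(real_normK (num_real (u + v))).
  have nu := normr_ge0 u; have nuv := normr_ge0 (u + v).
  move: far nu nuv; set p := `|u|; set q := `|u + v| => far nu nuv.
  have ep : 0 <= e * p ^+ 2 by rewrite mulr_ge0 ?sqr_ge0// ltW.
  have eq : 0 <= e * q ^+ 2 by rewrite mulr_ge0 ?sqr_ge0// ltW.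
  have [pq|qp] := leP p q.
    have Aq : A <= q by case/orP: far => // /le_trans; apply.
    by have := big q Aq nuv; have := small p q nu pq Aq; lra.
  have Ap : A <= p by case/orP: far => // /le_trans; apply; exact: ltW.
  by have := big p Ap nu; have := small q p nuv (ltW qp) Ap; lra.
pose K := (`[0, t1] `*` (`[- A, A] `*` `[0, 2 * A]))%classic : set (R * (R * R)).
have Kt : K (t, (x, l)).
  have := ler_norm x; have := ler_norm (- x); rewrite normrN => h1 h2.
  by split; [|split]; rewrite /= in_itv/= //; apply/andP; split => //; rewrite /A; lra.
have cK : compact K.
  apply: compact_setX; first exact: segment_compact.
  by apply: compact_setX; exact: segment_compact.
have [[s [u v]] + minG] := compact_EVT_min (ex_intro _ _ Kt) cK (@continuous_G e lam A A0).
rewrite inE => -[/=]; rewrite !in_itv/= => s01 [/andP[uA Au] /andP[v0 vA]].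
have Gs : G e lam s u v < 0.
  by apply: le_lt_trans Gneg; have := minG (t, (x, l)); rewrite inE; apply.
have minG' s' u' v' : 0 <= s' <= t1 -> - A <= u' <= A -> 0 <= v' <= 2 * A ->
    G e lam s u v <= G e lam s' u' v'.
  move=> h1 h2 h3; have := minG (s', (u', v')); rewrite inE; apply.
  by split; [|split]; rewrite /= in_itv.
have near u' v' : 0 <= v' -> G e lam s u' v' < 0 -> `|u'| < A /\ `|u' + v'| < A.
  move=> v'0 Gu; apply/andP; apply: contraTT (Gu); rewrite negb_and -!leNgt => h.
  by rewrite ltW// far.
have [uA' uvA'] := near u v v0 Gs.
have /andP[s0 st1] := s01.
(* The remaining faces are excluded: at length 0 only the penalty is left, and at time 0 the datum
   is nonnegative. The face [s = t1] is permitted, since the contradiction comes from earlier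
   times. *)
have vpos : 0 < v.
  rewrite lt_neqAle v0 andbT eq_sym; apply/eqP => vE.
  move: Gs; apply/negP; rewrite -leNgt.
  have := G_ge s u v s01 v0; rewrite vE mulr0 subr0; apply: le_trans.
  by rewrite mulr_ge0 ?(ltW e0)// (le_trans ler01).
have spos : 0 < s.
  rewrite lt_neqAle s0 andbT eq_sym; apply/eqP => sE.
  move: Gs; apply/negP; rewrite -leNgt /G addr_ge0//.
    by rewrite sE; apply: Rintegral_ge0 => z _; exact: y0.
  by apply: le_trans (pen_ge _ _ _ s0); rewrite mulr_ge0 ?(ltW e0)// (le_trans ler01).
have v2A : v < 2 * A.
  rewrite mulr_natl mulr2n (_ : v = (u + v) - u); last by ring.
  by rewrite (le_lt_trans (ler_norm _))// (le_lt_trans (ler_normB _ _))// ltrD.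
move: uA'; rewrite ltr_norml => /andP[uA1 uA2].
pose p := e * expR (lam * s).
have p0 : 0 < p by rewrite mulr_gt0 ?expR_gt0.
have dx (z : R) : der (fun z : R => G e lam s z v) z (y s (z + v) - y s z + p * (2 * z + 2 * (z + v))).
  exact: derD (der_window_shift _ (cy s01) v0) (der_pen_x e lam s z v).
have E1 : y s (u + v) - y s u + p * (2 * u + 2 * (u + v)) = 0.
  have h := @derive1_at_min R (fun z : R => G e lam s z v) (- A) A u AA
    (fun z _ => @ex_derive _ _ _ _ _ _ _ (dx z)).
  have d0 : der (fun z : R => G e lam s z v) u 0.
    apply: h; first by rewrite in_itv/= uA1.
    move=> z; rewrite in_itv/= => /andP[z1 z2]; apply: minG' => //.
      by rewrite (ltW z1) ltW.
    by rewrite v0.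
  by rewrite -(der_derive1 (dx u)) (der_derive1 d0).
have dl (m : R) : 0 < m -> der (fun m : R => G e lam s u m) m (y s (u + m) + p * (2 * (u + m))).
  by move=> m0; exact: derD (der_window_len _ (cy s01) m0) (der_pen_l e lam s u m).
have E2 : y s (u + v) + p * (2 * (u + v)) = 0.
  have A20 : 0 <= 2 * A by rewrite mulr_ge0 ?(ltW A0).
  have d0 : der (fun m : R => G e lam s u m) v 0.
    have dG m : m \in `]0, (2 * A)[ -> derivable (fun m : R => G e lam s u m) m 1.
      by rewrite in_itv/= => /andP[m0 _]; exact: (@ex_derive _ _ _ _ _ _ _ (dl m m0)).
    apply: (@derive1_at_min R (fun m : R => G e lam s u m) 0 (2 * A) v A20 dG).
    - by rewrite in_itv/= vpos.
    - move=> m; rewrite in_itv/= => /andP[m1 m2]; apply: minG' => //.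
        by rewrite uA Au.
      by rewrite (ltW m1) ltW.
  by rewrite -(der_derive1 (dl v vpos)) (der_derive1 d0).
have dt : der (fun s : R => G e lam s u v) s
    (a s u * y s u - a s (u + v) * y s (u + v) + lam * pen e lam s u v).
  apply: derD (der_pen_t e lam s u v).
  by apply: transport; rewrite ?spos// ltrDl.
have yu : y s u = 2 * p * u by move: E1 E2; lra.
have yuv : y s (u + v) = - (2 * p * (u + v)).
  by apply/eqP; rewrite -addr_eq0 -[X in _ == X]E2 (mulrC 2) mulrA.
have dpos : 0 < a s u * y s u - a s (u + v) * y s (u + v) + lam * pen e lam s u v.
  rewrite yu yuv.
  have -> : a s u * (2 * p * u) - a s (u + v) * - (2 * p * (u + v)) + lam * pen e lam s u v =
     p * (2 * (a s u * u + a s (u + v) * (u + v)) + lam * Q u v).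
    by rewrite /pen -/(Q u v) /p; ring.
  apply: mulr_gt0 => //.
  have b1 : - (B * `|u|) <= a s u * u.
    have : `|a s u * u| <= B * `|u| by rewrite normrM ler_wpM2r// aB.
    by rewrite ler_norml => /andP[].
  have b2 : - (B * `|u + v|) <= a s (u + v) * (u + v).
    have : `|a s (u + v) * (u + v)| <= B * `|u + v| by rewrite normrM ler_wpM2r// aB.
    by rewrite ler_norml => /andP[].
  have b3 : B * (`|u| + `|u + v|) <= B * Q u v by rewrite ler_pM2l.
  have := Q1 u v; rewrite /lam mulrDl mul1r; lra.
have [d d0 dec] := der_gt0_left dt dpos.
(* An earlier time within the reach of [dec]; the term [s / 2] keeps it nonnegative. *)
pose r := Num.max (s - d / 2) (s / 2).
have rs : r < s by rewrite gt_max gtrBl divr_gt0//= ltr_pdivrMr// ltr_pMr// ltr1n.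
have := dec r; rewrite rs andbT lt_max (_ : s - d < s - d / 2) ?orTb//; last first.
  by rewrite ltrD2l ltrN2 ltr_pdivrMr// ltr_pMr// ltr1n.
move=> /(_ isT); apply/negP; rewrite -leNgt.
apply: minG'; last by rewrite v0.
- by rewrite le_max [0 <= s / 2]divr_ge0 ?(ltW spos)// orbT (le_trans (ltW rs)).
- by rewrite uA Au.
Qed.

(** By continuity a negative value would persist on a short window and make its integral
    negative. *)
Lemma transport_ge0 t x : 0 <= t <= t1 -> 0 <= y t x.
Proof.
move=> t01; rewrite leNgt; apply/negP => yx.
have yx2 : 0 < - y t x / 2 by lra.
have cyx : {for x, continuous (y t)} by exact: (cy t01).
have /cvgrPdist_lt/(_ _ yx2)/nbhs_ballP[d /= d0 H] := cyx.
have neg z : x <= z <= x + d / 2 -> y t z < 0.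
  move=> /andP[z1 z2]; have : `|x - z| < d by rewrite ler0_norm ?subr_le0//; lra.
  by move=> /H; rewrite /= ltr_norml => /andP[h1 h2]; lra.
have xd : x < x + d / 2 by lra.
have x1 : x - 1 <= x by lra.
pose F (z : R) : R := \int[mu]_(w in `[x - 1, z]) y t w.
have dF z : x <= z -> der F z (y t z).
  by move=> xz; apply: der_int_right; [exact: cy|lra].
have d2 : 0 <= d / 2 by lra.
have WF : W t x (d / 2) = F (x + d / 2) - F x by exact: int_itvB (cy t01) x1 (ltW xd).
have := window_ge0 x t01 d2; rewrite WF.
have dF' z : z \in `]x, x + d / 2[ -> der F z (y t z).
  by rewrite in_itv/= => /andP[/ltW zx _]; exact: dF.
have cF : {within `[x, x + d / 2], continuous F}.
  apply: continuous_in_subspaceT => z; rewrite inE/= in_itv/= => /andP[xz _].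
  exact: der_cont (dF z xz).
have [z] := MVT xd dF' cF.
rewrite in_itv/= => /andP[z1 z2] E.
have /neg yz : x <= z <= x + d / 2 by lra.
rewrite E; apply/negP; rewrite -ltNge.
rewrite nmulr_rlt0//; lra.
Qed.

End maximum_principle.

(** * The sharp inequality for a fixed time *)

Section density.
Context {R : realFieldType}.

(* Density of F in terms of [X = u^2] and [Y = u_x^2], with [N = n + 1]. *)
Definition energy_density (N : nat) (X Y : R) : R :=
  \sum_(k < N.+1) (-1) ^+ k.+1 / (2 * k%:R - 1) * ('C(N, k))%:R * X ^+ (N - k) * Y ^+ k.

Lemma double_sub1_neq0 k : 2 * k%:R - 1 != 0 :> R.
Proof.
rewrite subr_eq0 -natrM -[1]/(1%:R) eqr_nat mul2n.
by apply/eqP => /(congr1 odd); rewrite odd_double.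
Qed.

(** Coefficientwise, [(2N+1) C(N+1,k) = 2 (N+1) C(N,k) + (2k-1) C(N+1,k)]. Divided by [2k-1], the
    first term gives the density of order [N]; in the second the denominator cancels and the
    alternating sum is the binomial expansion of [- (X - Y)^(N+1)]. *)
Lemma energy_density_rec (N : nat) (X Y : R) :
  (2 * N%:R + 1) * energy_density N.+1 X Y = 2 * N.+1%:R * X * energy_density N X Y - (X - Y) ^+ N.+1.
Proof.
rewrite exprDn /energy_density mulr_sumr [in X in _ - X]big_ord_recr /=.
rewrite big_ord_recr /= mulr_sumr opprD addrA; congr (_ + _).
  rewrite -sumrB; apply: eq_bigr => k _.
  have kN : (k <= N)%N by rewrite -ltnS.
  rewrite subSn// [X ^+ _.+1]exprS (exprNn Y) -[in RHS](mulr_natl _ 'C(_, _)).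
  have B : (N.+1 - k)%:R * ('C(N.+1, k))%:R = N.+1%:R * ('C(N, k))%:R :> R.
    by rewrite -!natrM mul_bin_down.
  have B' : ('C(N.+1, k))%:R * (N%:R + 1 - k%:R) = (N%:R + 1) * ('C(N, k))%:R :> R.
    by rewrite mulrC natr1 -B natrB// ltnW.
  have -> : N.+1%:R = N%:R + 1 :> R by rewrite natr1.
  apply: (mulfI (double_sub1_neq0 k)).
  transitivity ((-1) ^+ k.+1 * (X * X ^+ (N - k)) * Y ^+ k * ((2 * N%:R + 1) * ('C(N.+1, k))%:R)).
    by field; exact: double_sub1_neq0.
  have -> : (2 * N%:R + 1) * 'C(N.+1, k)%:R =
    2 * ('C(N.+1, k)%:R * (N%:R + 1 - k%:R)) + (2 * k%:R - 1) * 'C(N.+1, k)%:R :> R by ring.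
  by rewrite B' exprS; field; exact: double_sub1_neq0.
have NE : N.+1%:R = N%:R + 1 :> R by rewrite natr1.
rewrite subnn expr0 binn (exprNn Y) mulr1n exprS NE.
by field; rewrite -NE.
Qed.

Lemma energy_density1 (X Y : R) : energy_density 1 X Y = X + Y.
Proof. by rewrite /energy_density !big_ord_recr big_ord0 /= !bin0 !binn; field.
Qed.

(** Induction along the recursion, dropping a power of [X - Y >= 0]. At [X = Y = 1] that power is 0,
    so the constants satisfy the recursion exactly and are carried through unchanged. *)
Lemma energy_density_le (n : nat) (X Y : R) : 0 <= Y -> Y <= X ->
  energy_density n.+1 X Y <= energy_density n.+1 1 1 / 2 * (X ^+ n * (X + Y)).
Proof.
move=> Y0 YX; have X0 : 0 <= X by exact: le_trans YX.
elim: n => [|n IH]; first by rewrite !energy_density1 expr0 mul1r; lra.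
have N0 : (0 : R) < 2 * n.+1%:R + 1 by rewrite addr_gt0// mulr_gt0// ltr0n.
rewrite -(ler_pM2l N0) energy_density_rec !mulrA energy_density_rec subrr expr0n/= subr0 mulr1.
apply: (@le_trans _ _ (2 * n.+2%:R * X * energy_density n.+1 X Y)).
  by rewrite lerBlDr lerDl exprn_ge0// subr_ge0.
have X2 : 0 <= 2 * n.+2%:R * X by rewrite !mulr_ge0.
apply: (le_trans (ler_wpM2l X2 IH)).
by rewrite le_eqVlt exprS; apply/orP; left; apply/eqP; field.
Qed.

Lemma energy_density11_ge0 (n : nat) : 0 <= energy_density n.+1 1 1 :> R.
Proof.
elim: n => [|n IH]; first by rewrite energy_density1 addr_ge0.
have N0 : (0 : R) < 2 * n.+1%:R + 1 by rewrite addr_gt0// mulr_gt0// ltr0n.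
by rewrite -(pmulr_rge0 _ N0) energy_density_rec subrr expr0n/= subr0 mulr1 !mulr_ge0.
Qed.

(** Crude homogeneity bound, needed only for the integrability of the density of [F]. *)
Lemma norm_energy_density (n : nat) : exists2 C : R, 0 <= C & forall X Y : R, 0 <= Y -> Y <= X ->
  `|energy_density n.+1 X Y| <= C * X ^+ n.+1.
Proof.
exists (\sum_(k < n.+2) `|(-1) ^+ k.+1 / (2 * k%:R - 1) * ('C(n.+1, k))%:R|).
  by apply: sumr_ge0 => k _.
move=> X Y Y0 YX; have X0 : 0 <= X by exact: le_trans YX.
rewrite mulr_suml; apply: (le_trans (ler_norm_sum _ _ _)); apply: ler_sum => k _.
rewrite -mulrA normrM ler_wpM2l// ger0_norm ?mulr_ge0 ?exprn_ge0//.
have kn : (k <= n.+1)%N by rewrite -ltnS.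
by rewrite -[in leRHS](subnK kn) exprD ler_wpM2l ?exprn_ge0// lerXn2r.
Qed.

End density.

(** Partial fractions: [(2j-3) / (2 (2j-1)) = 1/2 - 1/(2j-1)]. The first part sums to [1/2], so
    [c_1 = 1 - s1], while the density at [(1, 1)] is [1 + s1], the 1 being its term [k = 0]. *)
Lemma coef_c1E (R : realType) (n : nat) : 2 - coef_c1 R n = energy_density n.+1 1 1.
Proof.
rewrite /coef_c1 /energy_density big_add1 /= big_mkord [in RHS]big_ord_recl /= bin0.
(* The expansion of [(1 - 1)^(n + 1) = 0] with its first term split off. *)
have S : \sum_(i < n.+1) (-1) ^+ i * ('C(n.+1, i.+1))%:R = 1 :> R.
  have := exprBn (1 : R) 1 n.+1; rewrite subrr expr0n /= big_ord_recl /= bin0 => /eqP.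
  rewrite eq_sym expr0 !expr1n !mul1r mulr1n addr_eq0 => /eqP S0.
  rewrite [RHS]S0 -sumrN; apply: eq_bigr => i _; rewrite !expr1n /bump /= add1n exprS mulr_natr.
  by rewrite !mulr1 mulN1r mulNrn opprK.
have -> : \sum_(i < n.+1) (-1) ^+ i.+2 * ((2 * i.+1%:R - 3) / (2 * (2 * i.+1%:R - 1)))
            * ('C(n.+1, i.+1))%:R =
   2^-1 * (\sum_(i < n.+1) (-1) ^+ i * ('C(n.+1, i.+1))%:R)
   - \sum_(i < n.+1) (-1) ^+ i / (2 * i.+1%:R - 1) * ('C(n.+1, i.+1))%:R :> R.
  rewrite mulr_sumr -sumrB; apply: eq_bigr => i _.
  have := ler0n R i; rewrite -natr1 !exprS => i0; field.
  by rewrite gt_eqF//; lra.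
rewrite S; set s1 := \sum_(i < n.+1) _.
rewrite (eq_bigr (fun i : 'I_n.+1 => (-1) ^+ i / (2 * i.+1%:R - 1) * ('C(n.+1, i.+1))%:R)); last first.
  by move=> i _; rewrite /bump /= add1n !expr1n !mulr1 !exprS !mulN1r opprK.
by rewrite -/s1 !expr1n; field.
Qed.

Lemma energyF_density (R : realType) (n : nat) (v : R -> R) :
  energyF n v = \int[@lebesgue_measure R]_x energy_density n.+1 (v x ^+ 2) (derive1 v x ^+ 2).
Proof.
rewrite /energyF; congr Rintegral; apply/funext => x.
rewrite /energy_density big_ord_recr /= big_ord_recl /= big_add1 /= big_mkord bin0 binn subnn subn0.
congr (_ + _ + _).
- by rewrite -exprM expr0 expr1 mulr1 mulr0 sub0r invrN invr1 mulrN1 opprK !mul1r; congr (_ ^+ _); lia.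
(* The exponent [2 * n - 2 * k + 2] uses truncated subtraction, which is exact because [k <= n]. *)
- apply: eq_bigr => i _; rewrite /bump /= add1n -!exprM; congr (_ * _ ^+ _ * _).
  by rewrite subSS; have := ltn_ord i; lia.
- have -> : (2 * n + 2 = 2 * n.+1)%N by lia.
  have NE : n.+1%:R = n%:R + 1 :> R by rewrite natr1.
  rewrite expr0 !mulr1 -exprM [(-1) ^+ n.+2]exprS [(-1) ^+ n.+1]exprS NE; field.
  have N0 := ler0n R n; lra.
Qed.

(** * Derivative bound, decay and maximum of a profile *)

Section profile.
Context {R : realType}.
Notation mu := (@lebesgue_measure R).

(* [exp(x) (v - v')] is nondecreasing and tends to 0 at [-oo]. *)
Lemma sub_derive_ge0 (v v1 v2 : R -> R) (B : R) :
  (forall x : R, der v x (v1 x)) -> (forall x : R, der v1 x (v2 x)) ->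
  (forall x, `|v x| <= B) -> (forall x, `|v1 x| <= B) -> (forall x, v2 x <= v x) ->
  forall x, v1 x <= v x.
Proof.
move=> dv dv1 vB v1B vv x.
pose h (z : R) : R := expR z * (v z - v1 z).
have dh (z : R) : der h z (expR z * (v z - v2 z)).
  apply: (is_derive_eq (derM (is_derive_expR z) (derB (dv z) (dv1 z)))); ring.
have mono a b : a <= b -> h a <= h b.
  move=> ab; apply: (nondecreasing_der ab (fun z _ => dh z)) => z _.
  by rewrite mulr_ge0 ?expR_ge0// subr_ge0.
have B0 : 0 <= B by exact: le_trans (normr_ge0 _) (vB 0).
(* A quantitative form of the vanishing at [-oo]: [|v - v1| <= 2 * B] and [exp z >= 1 + z] give
   [h (- z) >= - 2 * B / (1 + z)]. *)
have lb z : 0 <= z -> - (2 * B) <= h (- z) * (1 + z).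
  move=> z0.
  have e1 : 0 < expR z by exact: expR_gt0.
  have e2 : 1 + z <= expR z := expR_ge1Dx z.
  have -> : h (- z) = (v (- z) - v1 (- z)) / expR z by rewrite /h expRN mulrC.
  rewrite mulrAC -ler_pdivrMr ?invr_gt0// invrK.
  have := vB (- z); have := v1B (- z); rewrite !ler_norml => /andP[? ?] /andP[? ?].
  have : - (2 * B) * expR z <= - (2 * B) * (1 + z) by rewrite ler_wnM2l// oppr_le0 mulr_ge0.
  have : - (2 * B) * (1 + z) <= (v (- z) - v1 (- z)) * (1 + z) by rewrite ler_wpM2r; lra.
  by move=> /[swap]; apply: le_trans.
rewrite -subr_ge0 -(pmulr_rge0 _ (expR_gt0 x)) -/(h x) leNgt; apply/negP => hx.
(* For this [z], [- h x * (1 + z)] exceeds [2 * B], which contradicts [lb] since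
   [h (- z) <= h x]. *)
pose z := `|x| + 2 * B / (- h x).
have z0 : 0 <= z by rewrite addr_ge0// divr_ge0 ?mulr_ge0// oppr_ge0 ltW.
have zx : h (- z) <= h x.
  apply: mono; rewrite lerNl; apply: le_trans (ler_norm _) _; rewrite normrN lerDl.
  by rewrite divr_ge0 ?mulr_ge0// oppr_ge0 ltW.
have zB : 2 * B <= z * - h x.
  rewrite -ler_pdivrMr ?oppr_gt0// lerDr//.
have := lb z z0; have : h (- z) * (1 + z) <= h x * (1 + z) by rewrite ler_wpM2r// addr_ge0.
by lra.
Qed.

Lemma norm_derive_le (v v1 v2 : R -> R) (B : R) :
  (forall x : R, der v x (v1 x)) -> (forall x : R, der v1 x (v2 x)) ->
  (forall x, `|v x| <= B) -> (forall x, `|v1 x| <= B) -> (forall x, v2 x <= v x) ->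
  forall x, `|v1 x| <= v x.
Proof.
move=> dv dv1 vB v1B vv x; rewrite ler_norml (sub_derive_ge0 dv dv1 vB v1B vv) andbT.
have dr f (df : R -> R) : (forall x : R, der f x (df x)) ->
    forall x : R, der (fun z => f (- z)) x (- df (- x)).
  move=> H z; apply: (is_derive_eq (der_comp (H (- z)) (derN (der_id z)))); ring.
have dv' : forall x : R, der (fun z => v (- z)) x (- v1 (- x)) := dr v v1 dv.
have dv1' (z : R) : der (fun z => - v1 (- z)) z (v2 (- z)).
  by apply: (is_derive_eq (derN (dr v1 v2 dv1 z))); rewrite opprK.
have := @sub_derive_ge0 (fun z => v (- z)) (fun z => - v1 (- z)) (fun z => v2 (- z)) B
  dv' dv1' (fun z => vB _) _ (fun z => vv _) (- x).
by rewrite !opprK lerNl; apply=> z; rewrite normrN.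
Qed.

Section decay.
Variables v v1 : R -> R.
Hypotheses (dv : forall x : R, der v x (v1 x)) (v1v : forall x, `|v1 x| <= v x)
  (v2L : L1 (fun x => v x ^+ 2)).

Let v0 x : 0 <= v x.
Proof. exact: le_trans (normr_ge0 _) (v1v x). Qed.

Let cv2 : continuous (fun x => v x ^+ 2).
Proof. by move=> x; exact: der_cont (derX 1 (dv x)). Qed.

(** [exp(x) v] is nondecreasing because [v1 >= - v], so [v] loses at most a factor [exp 1] over a
    unit length. *)
Lemma harnack x z : x <= z -> z <= x + 1 -> v x <= expR 1 * v z.
Proof.
move=> xz zx.
have dh (w : R) : der (fun z : R => expR z * v z) w (expR w * (v w + v1 w)).
  by apply: (is_derive_eq (derM (is_derive_expR w) (dv w))); ring.
have : expR x * v x <= expR z * v z.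
  apply: (nondecreasing_der xz (fun w _ => dh w)) => w _.
  rewrite mulr_ge0 ?expR_ge0//; have := v1v w; rewrite ler_norml => /andP[]; lra.
rewrite -ler_pdivlMl ?expR_gt0// -expRN mulrA -expRD => /le_trans; apply.
by rewrite ler_wpM2r// ler_expR; lra.
Qed.

(** By [harnack], a large value at [x] forces a large integral of [v^2] over [[x, x + 1]], while
    such integrals tend to 0 because [v^2] is integrable. *)
Lemma vanishing_at_infty e : 0 < e -> exists2 A, 0 < A & forall x, A <= `|x| -> v x <= e.
Proof.
move=> e0.
pose Z (u z : R) : R := \int[mu]_(w in `[u, z]) (v w ^+ 2).
have dZ (u z : R) : u < z -> der (Z u) z (v z ^+ 2) by exact: (der_int_right cv2).
have Zmono u a b : u < a -> a <= b -> Z u a <= Z u b.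
  move=> ua ab; apply: (@nondecreasing_der _ (Z u) (fun w => v w ^+ 2) a b ab) => w /andP[aw wb].
    by apply: dZ; exact: lt_le_trans aw.
  exact: sqr_ge0.
(* The unit interval to the right of [a] or of [- a] lies in the shell between [a - 1] and [a + 1],
   whose integral is a difference of two symmetric ones; the base point [- a - 2] lies to the left
   of all of them. *)
have window a z : 2 <= a -> z = a \/ z = - a ->
    Z (- a - 2) (z + 1) - Z (- a - 2) z <=
    (Z (- a - 2) (a + 1) - Z (- a - 2) (- (a + 1)))
    - (Z (- a - 2) (a - 1) - Z (- a - 2) (- (a - 1))).
  move=> a2 za; set u := - a - 2.
  have m p q : - (a + 1) <= p -> p <= q -> Z u p <= Z u q.
    by move=> up; apply: Zmono; apply: lt_le_trans up; rewrite /u; lra.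
  have m1 : Z u (a - 1) <= Z u a by apply: m; lra.
  have m2 : Z u (- (a + 1)) <= Z u (- a) by apply: m; lra.
  have m3 : Z u (- (a - 1)) <= Z u a by apply: m; lra.
  have m4 : Z u a <= Z u (a + 1) by apply: m; lra.
  have m5 : Z u (- (a + 1)) <= Z u (- (a - 1)) by apply: m; lra.
  have na : - a + 1 = - (a - 1) by ring.
  by case: za => ->; rewrite ?na; lra.
have Zlow u x : u < x -> (expR 1)^-1 ^+ 2 * v x ^+ 2 <= Z u (x + 1) - Z u x.
  move=> ux; set c := _ * _.
  have x1 : x <= x + 1 by lra.
  have : Z u x - c * x <= Z u (x + 1) - c * (x + 1).
    have dF (w : R) : x <= w <= x + 1 -> der (fun z : R => Z u z - c * z) w (v w ^+ 2 - c * 1).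
      move=> /andP[xw _]; apply: derB (dZ u w (lt_le_trans ux xw)) (derZ c (der_id w)).
    apply: (nondecreasing_der x1 dF) => w /andP[xw wx].
    rewrite mulr1 subr_ge0 /c -exprMn lerXn2r ?nnegrE ?mulr_ge0 ?invr_ge0 ?expR_ge0//.
    by rewrite ler_pdivrMl ?expR_gt0// harnack.
  lra.
have e1 : 0 < ((expR 1)^-1 * e) ^+ 2 / 2.
  by rewrite divr_gt0// exprn_gt0// mulr_gt0// invr_gt0 expR_gt0.
have /cvgrPdist_lt/(_ _ e1)[A0 [_ HA]] := cvg_int_sym v2L.
pose A := Num.max A0 0 + 2.
have A2 : 2 <= A by rewrite /A lerDr le_max lexx orbT.
have AA0 : A0 + 2 <= A by rewrite /A lerD2r le_max lexx.
exists A; first lra.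
move=> x Ax.
have a2 : 2 <= `|x| by exact: le_trans Ax.
have h1 := HA (`|x| + 1) (ltac:(lra)); have h2 := HA (`|x| - 1) (ltac:(lra)).
have hd : \int[mu]_(w in `[- (`|x| + 1), `|x| + 1]) (v w ^+ 2)
   - \int[mu]_(w in `[- (`|x| - 1), `|x| - 1]) (v w ^+ 2) <= ((expR 1)^-1 * e) ^+ 2.
  by move: h1 h2; rewrite !ltr_norml => /andP[? ?] /andP[? ?]; lra.
have J r : 0 <= r -> r <= `|x| + 1 -> \int[mu]_(w in `[- r, r]) (v w ^+ 2) =
    Z (- `|x| - 2) r - Z (- `|x| - 2) (- r).
  by move=> r0 rx; apply: int_itvB => //; lra.
rewrite !J in hd; try lra.
have xE : x = `|x| \/ x = - `|x|.
  by have [x0|x0] := leP 0 x; [left; rewrite ger0_norm|right; rewrite ltr0_norm// opprK].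
have ux : - `|x| - 2 < x.
  by rewrite ltrBlDr (@le_lt_trans _ _ x)// ?ltrDl// lerNl -normrN ler_norm.
have le1 := le_trans (window _ _ a2 xE) hd; have := Zlow _ _ ux.
move=> /le_trans/(_ le1); rewrite exprMn ler_pM2l; last by rewrite exprn_gt0// invr_gt0 expR_gt0.
by rewrite ler_pXn2r ?nnegrE// ltW.
Qed.

(** Unless [v] vanishes identically, outside a compact interval it stays below half of one of its
    positive values, so the maximum over that interval is global. *)
Lemma max_attained : exists xi, forall x, v x <= v xi.
Proof.
have [[x0 x0p]|none] := pselect (exists x, 0 < v x); last first.
  by exists 0 => x; rewrite (le_trans _ (v0 0))// leNgt; apply/negP => h; apply: none; exists x.
have [A A0 HA] := vanishing_at_infty (divr_gt0 x0p (ltr0Sn R 1)).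
pose D := Num.max A `|x0|.
have D0 : - D <= D by rewrite ge0_cp// le_max ltW.
have cv : {within `[- D, D], continuous v}.
  by apply: continuous_subspaceT => x; exact: der_cont (dv x).
have [c cD Hc] := EVT_max D0 cv.
have x0D : x0 \in `[- D, D].
  by rewrite in_itv/= -ler_norml le_max lexx orbT.
exists c => x; have [xD|xD] := leP `|x| D.
  by apply: Hc; rewrite in_itv/= -ler_norml.
have Ax : A <= `|x| by rewrite ltW// (le_lt_trans _ xD)// le_max lexx.
by have := HA x Ax; have := Hc x0 x0D; lra.
Qed.

End decay.

Lemma max_valueE (v : R -> R) (xi : R) : (forall x, v x <= v xi) -> max_value v = v xi.
Proof.
move=> H; rewrite /max_value; apply: xget_unique.
  by split; [exists xi|move=> _ [x _ <-]].
move=> m [[x _ <-] ub]; apply/eqP; rewrite eq_le H /=; apply: ub; by exists xi.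
Qed.

End profile.

(** * The inequality for a single profile *)

Section sharp_inequality.
Context {R : realType}.
Notation mu := (@lebesgue_measure R).
Variables (n : nat) (v : R -> R) (B : R).
Hypotheses (dv : forall x : R, der v x (derive1 v x)) (cv1 : continuous (derive1 v))
  (vB : forall x, `|v x| <= B) (v1v : forall x, `|derive1 v x| <= v x)
  (v2L : L1 (fun x => v x ^+ 2)).

Let v0 x : 0 <= v x.
Proof. exact: le_trans (normr_ge0 _) (v1v x). Qed.

Let v1sq x : derive1 v x ^+ 2 <= v x ^+ 2.
Proof. by rewrite -(real_normK (num_real (derive1 v x))) lerXn2r ?nnegrE. Qed.

Let cv : continuous v.
Proof. by move=> x; exact: der_cont (dv x). Qed.

Let mv1 : measurable_fun [set: R] (derive1 v).
Proof. exact: continuous_measurable_fun. Qed.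

Let cX (f : R -> R) k : continuous f -> continuous (fun x => f x ^+ k).
Proof.
move=> cf x; apply: (@cvg_comp _ _ _ f (fun y => y ^+ k)); first exact: cf.
exact: exprn_continuous.
Qed.

Let L1E : L1 (fun x => v x ^+ 2 + derive1 v x ^+ 2).
Proof.
apply: L1D v2L _; apply: (L1_dom _ v2L) => [|x]; first exact: measurable_funX.
by rewrite ger0_norm ?sqr_ge0// v1sq.
Qed.

Let D x := energy_density n.+1 (v x ^+ 2) (derive1 v x ^+ 2).

Let cD : continuous D.
Proof.
rewrite /D /energy_density; apply: (continuous_big add_continuous) => k _ x.
apply: cvgM.
  by apply: cvgM; [exact: cvg_cst|apply: (cX (f := fun x => v x ^+ 2)); exact: cX].
by apply: (cX (f := fun x => derive1 v x ^+ 2)); exact: cX.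
Qed.

Let L1D' : L1 D.
Proof.
have [C C0 HC] := @norm_energy_density R n.
have L := L1Z (C * B ^+ (2 * n)) v2L.
apply: (L1_dom _ L) => [|x]; first exact: continuous_measurable_fun.
apply: (le_trans (HC _ _ (sqr_ge0 _) (v1sq x))).
rewrite -mulrA ler_wpM2l// [_ ^+ n.+1]exprS mulrC ler_wpM2r ?sqr_ge0// -exprM.
by rewrite lerXn2r ?nnegrE// ?(le_trans _ (vB x))// -[leLHS]ger0_norm.
Qed.

Lemma sharp_inequality :
  n%:R * (2 - coef_c1 R n) / (n.+1)%:R * max_value v ^+ (2 * n + 2)
    - (2 - coef_c1 R n) / 2 * max_value v ^+ (2 * n) * energyE v + energyF n v <= 0.
Proof.
have [xi Hxi] := max_attained dv v1v v2L.
rewrite (max_valueE Hxi) coef_c1E energyF_density /energyE -/D.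
set M := v xi; set al := energy_density n.+1 1 1; set E := \int[mu]_x _; set F := \int[mu]_x _.
have M0 : 0 <= M by exact: v0.
have al0 : 0 <= al by exact: energy_density11_ge0.
pose k x := al / 2 * M ^+ (2 * n) * (v x ^+ 2 + derive1 v x ^+ 2) - D x.
have Lk : L1 k by apply: L1B L1D'; exact: L1Z.
have Ek : \int[mu]_x k x = al / 2 * M ^+ (2 * n) * E - F.
  by rewrite (intB (L1Z _ L1E) L1D') (intZ _ L1E).
have ck : continuous k.
  move=> x; apply: cvgB; last exact: cD.
  apply: cvgM; first exact: cvg_cst.
  by apply: cvgD; [exact: (cX (f := v))|exact: (cX (f := derive1 v))].
have kge x : al * (M ^+ (2 * n) - v x ^+ (2 * n)) * `|v x * derive1 v x| <= k x.
  have := energy_density_le n (sqr_ge0 _) (v1sq x); rewrite -/(D x) -/al -exprM => dle.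
  have vM : v x ^+ (2 * n) <= M ^+ (2 * n) by rewrite lerXn2r ?nnegrE// Hxi.
  have amgm : `|v x * derive1 v x| <= (v x ^+ 2 + derive1 v x ^+ 2) / 2.
    rewrite normrM -(real_normK (num_real (v x))) -(real_normK (num_real (derive1 v x))).
    have := sqr_ge0 (`|v x| - `|derive1 v x|); rewrite sqrrB; lra.
  have h : 0 <= al * (M ^+ (2 * n) - v x ^+ (2 * n)) by rewrite mulr_ge0// subr_ge0.
  apply: (le_trans (ler_wpM2l h amgm)); rewrite /k lerBrDl -lerBrDr.
  by apply: (le_trans dle); rewrite le_eqVlt; apply/orP; left; apply/eqP; field.
pose H (z : R) : R := al * (M ^+ (2 * n) * (v z ^+ 2 / 2) - v z ^+ (2 * n).+2 / (2 * n).+2%:R).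
have dH (x : R) : der H x (al * (M ^+ (2 * n) - v x ^+ (2 * n)) * (v x * derive1 v x)).
  have d1 := derX 1 (dv x); have d2 := derX (2 * n).+1 (dv x).
  have := derZ al (derB (derZ (M ^+ (2 * n) / 2) d1) (derZ (2 * n).+2%:R^-1 d2)).
  have -> : (fun z => al * (M ^+ (2 * n) / 2 * v z ^+ 2 - (2 * n).+2%:R^-1 * v z ^+ (2 * n).+2)) = H.
    by apply/funext => z; rewrite /H; ring.
  move=> d; apply: (is_derive_eq d); rewrite expr1 [v x ^+ (2 * n).+1]exprS.
  by field; have := ler0n R n => n0; apply: lt0r_neq0; lra.
have HM : 2 * H xi = n%:R * al / n.+1%:R * M ^+ (2 * n + 2).
  rewrite /H -/M addn2 [M ^+ (2 * n).+2]exprS [M ^+ (2 * n).+1]exprS expr2.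
  have -> : (2 * n).+2%:R = 2 * (n%:R + 1) :> R by rewrite natr1 -natrM mulnS.
  have -> : n.+1%:R = n%:R + 1 :> R by rewrite natr1.
  by field; have := ler0n R n => n0; apply: lt0r_neq0; lra.
have Hle x : H x <= al / 2 * M ^+ (2 * n) * v x ^+ 2.
  rewrite /H mulrBr [leRHS](_ : _ = al * (M ^+ (2 * n) * (v x ^+ 2 / 2))); last by ring.
  by rewrite lerBlDr lerDl mulr_ge0// divr_ge0// exprn_ge0.
(* By [HM] and [Ek] the claim is exactly this comparison, which is proved up to an arbitrary [e]. *)
suff : 2 * H xi <= \int[mu]_x k x by rewrite HM Ek -subr_le0 opprB addrA addrAC.
apply/ler_addgt0Pr => e e0.
(* [H <= c * v^2], so [v^2 <= e / (4 * c)] makes [H] at most [e / 4] at each end of the interval;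
   the other [e / 2] pays for truncating the integral of [k]. The summand 1 keeps [c] positive. *)
pose c := al / 2 * M ^+ (2 * n) + 1.
have c0 : 0 < c by rewrite ltr_wpDl// mulr_ge0 ?exprn_ge0// divr_ge0.
have ec : 0 < Num.sqrt (e / 4 / c) by rewrite sqrtr_gt0 !divr_gt0.
have [A0 A00 HA0] := vanishing_at_infty dv v1v v2L ec.
have tail x : A0 <= `|x| -> H x <= e / 4.
  move=> /HA0 vx; apply: (le_trans (Hle x)).
  apply: (@le_trans _ _ (c * v x ^+ 2)).
    by rewrite ler_wpM2r ?sqr_ge0// lerDl.
  rewrite -ler_pdivlMl// mulrC -[leRHS]sqr_sqrtr; last by rewrite !divr_ge0 ?ltW.
  by rewrite lerXn2r ?nnegrE ?sqrtr_ge0.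
have e2 : 0 < e / 2 by rewrite divr_gt0.
have /cvgrPdist_lt/(_ _ e2)[A1 [_ HA1]] := cvg_int_sym Lk.
pose A := Num.max A1 (Num.max A0 `|xi|) + 1.
have AA1 : A1 < A by rewrite ltr_pwDr// le_max lexx.
have AA0 : A0 <= A by rewrite ler_wpDr// !le_max lexx orbT.
have Axi : `|xi| <= A by rewrite ler_wpDr// !le_max lexx !orbT.
have Agt0 : 0 <= A by exact: le_trans Axi.
have := HA1 A AA1; move: (Axi); rewrite ler_norml => /andP[xi1 xi2].
pose Z (z : R) : R := \int[mu]_(w in `[- A - 1, z]) k w.
have u1 : - A - 1 <= - A by rewrite gerBl.
have AA : - A <= A by rewrite ge0_cp.
have uA z : - A <= z -> - A - 1 < z by apply: lt_le_trans; rewrite gtrBl.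
have dZ (z : R) : - A <= z -> der Z z (k z) by move=> /uA; exact: (der_int_right ck).
rewrite (int_itvB ck u1 AA) -/(Z A) -/(Z (- A)).
have pos x : 0 <= al * (M ^+ (2 * n) - v x ^+ (2 * n)).
  by rewrite mulr_ge0// subr_ge0 lerXn2r ?nnegrE// Hxi.
(* [k] dominates the derivative of [H] to the left of [xi] and its opposite to the right. Adding
   both sides, the integral of [k] over [[- A, A]] is at least [2 * H xi - H A - H (- A)]. *)
have left : Z (- A) - H (- A) <= Z xi - H xi.
  have dL (x : R) : - A <= x <= xi -> der (fun z : R => Z z - H z) x
      (k x - al * (M ^+ (2 * n) - v x ^+ (2 * n)) * (v x * derive1 v x)).
    by move=> /andP[x1 x2]; exact: derB (dZ x x1) (dH x).
  apply: (nondecreasing_der xi1 dL) => x _; rewrite subr_ge0; apply: le_trans (kge x).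
  by rewrite ler_wpM2l ?ler_norm.
have right : Z xi + H xi <= Z A + H A.
  have dL (x : R) : xi <= x <= A -> der (fun z : R => Z z + H z) x
      (k x + al * (M ^+ (2 * n) - v x ^+ (2 * n)) * (v x * derive1 v x)).
    by move=> /andP[x1 x2]; exact: derD (dZ x (le_trans xi1 x1)) (dH x).
  apply: (nondecreasing_der xi2 dL) => x _; rewrite -lerBlDr sub0r -mulrN.
  apply: le_trans (kge x).
  by rewrite ler_wpM2l// -normrN ler_norm.
have t1 : H A <= e / 4 by apply: tail; rewrite ger0_norm.
have t2 : H (- A) <= e / 4 by apply: tail; rewrite normrN ger0_norm.
rewrite ltr_norml => /andP[h1 h2]; move: left right t1 t2 h1 h2.
set zA := Z A; set zN := Z (- A); set zx := Z xi; set hA := H A; set hN := H (- A).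
by set hx := H xi; set I := \int[mu]_x k x; lra.
Qed.

End sharp_inequality.

(** * Strong solutions *)

Section uniform_closeness.
Context {R : realType} {T : Type} (F : set_system R) {FF : Filter F}.

Definition uclose (f : R -> T -> R) (g : T -> R) :=
  forall e, 0 < e -> \forall s \near F, forall x, `|f s x - g x| <= e.

Lemma ucloseB f1 f2 g1 g2 : uclose f1 g1 -> uclose f2 g2 ->
  uclose (fun s x => f1 s x - f2 s x) (fun x => g1 x - g2 x).
Proof.
move=> h1 h2 e e0; have e2 : 0 < e / 2 by rewrite divr_gt0.
apply: filter_app (h1 _ e2); apply: filterS (h2 _ e2) => s k2 k1 x.
have -> : f1 s x - f2 s x - (g1 x - g2 x) = (f1 s x - g1 x) - (f2 s x - g2 x) by ring.
by apply: (le_trans (ler_normB _ _)); rewrite [leRHS]splitr lerD.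
Qed.

Lemma ucloseM f1 f2 g1 g2 (B : R) : (forall x, `|g1 x| <= B) -> (forall x, `|g2 x| <= B) ->
  uclose f1 g1 -> uclose f2 g2 ->
  uclose (fun s x => f1 s x * f2 s x) (fun x => g1 x * g2 x).
Proof.
move=> b1 b2 h1 h2 e e0.
have C0 : 0 < 1 + 2 * `|B| by rewrite ltr_pwDl// mulr_ge0.
(* The product of the two errors is at most [d], as one of them is at most 1, and each mixed term is
   at most [d * |B|]. *)
pose d := Num.min 1 (e / (1 + 2 * `|B|)).
have d0 : 0 < d by rewrite lt_min ltr01 divr_gt0.
have d1 : d <= 1 by rewrite ge_min lexx.
have de : d * (1 + 2 * `|B|) <= e by rewrite -ler_pdivlMr// ge_min lexx orbT.
apply: filter_app (h1 _ d0); apply: filterS (h2 _ d0) => s k2 k1 x.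
have a1 := k1 x; have a2 := k2 x.
have B1 : `|g1 x| <= `|B| by rewrite (le_trans (b1 x))// ler_norm.
have B2 : `|g2 x| <= `|B| by rewrite (le_trans (b2 x))// ler_norm.
have -> : f1 s x * f2 s x - g1 x * g2 x =
  (f1 s x - g1 x) * (f2 s x - g2 x) + (f1 s x - g1 x) * g2 x + g1 x * (f2 s x - g2 x) by ring.
apply: (le_trans (ler_normD _ _)); apply: (le_trans (lerD (ler_normD _ _) (lexx _))).
rewrite !normrM; apply: le_trans de.
have := ler_pM (normr_ge0 _) (normr_ge0 _) a1 (le_trans a2 d1).
have := ler_pM (normr_ge0 _) (normr_ge0 _) a1 B2.
have := ler_pM (normr_ge0 _) (normr_ge0 _) B1 a2; lra.
Qed.

Lemma ucloseX f g (B : R) k : 1 <= B -> (forall x, `|g x| <= B) -> uclose f g ->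
  uclose (fun s x => f s x ^+ k) (fun x => g x ^+ k).
Proof.
move=> B1 gB fg; elim: k => [|k IH].
  by move=> e e0; apply: nearW => s x; rewrite !expr0 subrr normr0 ltW.
have B0 : 0 <= B by exact: le_trans B1.
move=> e e0.
have : \forall s \near F, forall x, `|f s x * f s x ^+ k - g x * g x ^+ k| <= e.
  apply: (ucloseM (B := B ^+ k.+1) _ _ fg IH e0) => x.
    by rewrite (le_trans (gB x))// exprS ler_peMr// exprn_ege1.
  rewrite normrX (@le_trans _ _ (B ^+ k))// ?lerXn2r ?nnegrE//.
  by rewrite exprS ler_peMl// exprn_ge0.
by apply: filterS => r H x; rewrite !exprS.
Qed.

End uniform_closeness.

Section test_functions.
Context {R : realType}.
Notation mu := (@lebesgue_measure R).

Lemma derive1_support (f : R -> R) (A : R) : (forall x, A < `|x| -> f x = 0) ->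
  forall x, A < `|x| -> derive1 f x = 0.
Proof.
move=> f0 x Ax.
have H : \forall y \near x, 0 = f y.
  have cn : {for x, continuous (fun z : R => `|z|)} by exact: norm_continuous.
  have : \forall y \near x, A < `|y| by move/cvgr_gt: cn; apply.
  by apply: filterS => y /f0 ->.
exact: der_derive1 (near_eq_is_derive H (der_cst 0 x)).
Qed.

Lemma derive1n_support (f : R -> R) (A : R) k : (forall x, A < `|x| -> f x = 0) ->
  forall x, A < `|x| -> derive1n k f x = 0.
Proof.
move=> f0; elim: k => [//|k IH] x Ax.
by rewrite derive1nS; exact: derive1_support IH x Ax.
Qed.

(** Moves [1 - d^2/dx^2] from the test function to [u], turning the weak equation for [u_t] into one
    for pairings with [y]. The difference of the integrands is the derivative of
    [f * phi' - f' * phi], which has compact support. *)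
Lemma parts_twice (f phi : R -> R) : (forall x : R, der f x (derive1 f x)) ->
  (forall x : R, der (derive1 f) x (derive1n 2 f x)) -> continuous (derive1n 2 f) ->
  test_function phi ->
  \int[mu]_x (momentum f x * phi x) = \int[mu]_x (f x * (phi x - derive1n 2 phi x)).
Proof.
move=> df df1 cf2 [phik [A0 sA0]].
pose A := `|A0|; have sA x : A < `|x| -> phi x = 0.
  by move=> Ax; apply: sA0; exact: le_lt_trans (ler_norm _) Ax.
have A_ge0 : 0 <= A by exact: normr_ge0.
have AA : - A <= A by rewrite ge0_cp.
have dphi k (x : R) : der (derive1n k phi) x (derive1n k.+1 phi x).
  by rewrite derive1nS; exact: derivable_der.
have cphi k : continuous (derive1n k phi) by exact: continuous_der (dphi k).
have cf : continuous f := continuous_der df.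
have dA x : A < `|x| -> derive1n 2 phi x = 0 by exact: derive1n_support.
have cm : continuous (momentum f).
  by move=> x; apply: cvgB; [exact: cf|exact: cf2].
have c1 : continuous (fun x => momentum f x * phi x).
  by move=> x; apply: cvgM; [exact: cm|exact: (cphi 0%N)].
have c2 : continuous (fun x => f x * (phi x - derive1n 2 phi x)).
  move=> x; apply: cvgM; first exact: cf.
  by apply: cvgB; [exact: (cphi 0%N)|exact: (cphi 2)].
have I1 : L1 (fun x => momentum f x * phi x).
  by apply: (@continuous_support_L1 _ _ A) => // x Ax; rewrite sA// mulr0.
have I2 : L1 (fun x => f x * (phi x - derive1n 2 phi x)).
  by apply: (@continuous_support_L1 _ _ A) => // x Ax; rewrite sA// dA// subr0 mulr0.
apply/eqP; rewrite -subr_eq0 -(intB I1 I2); apply/eqP.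
have A1 : - (A + 1) <= A + 1 by rewrite ge0_cp// addr_ge0.
rewrite -(@int_support _ _ A (A + 1)) ?lerDl//; last first.
  by move=> x Ax; rewrite sA// dA// subr0 !mulr0 subrr.
pose G (x : R) := f x * derive1n 1 phi x - derive1 f x * phi x.
have dG (x : R) : der G x (momentum f x * phi x - f x * (phi x - derive1n 2 phi x)).
  have d1 := derM (df x) (dphi 1%N x).
  have d2 := derM (df1 x) (dphi 0%N x).
  have alg (a b c p q r : R) : b * q + a * r - (c * p + b * q) = (a - c) * p - a * (p - r).
    by ring.
  apply: (is_derive_eq (derB d1 d2)); rewrite derive1n0 /momentum.
  exact: alg.
rewrite (FTC A1 (fun x _ => dG x)); last first.
  by move=> x _; apply: cvgB; [exact: c1|exact: c2].
have out x : A < `|x| -> G x = 0.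
  by move=> Ax; rewrite /G sA// (derive1n_support 1 sA Ax) !mulr0 subrr.
by rewrite !out ?subrr// ?normrN ger0_norm ?addr_ge0// ltrDl.
Qed.

End test_functions.

(** * Regularity in space and time of a Sobolev-continuous curve *)

Section solution.
Context {R : realType}.
Notation mu := (@lebesgue_measure R).
Variables (s : R) (T : \bar R) (u : R -> R -> R).
Hypotheses (hs : 5 / 2 < s) (cu : forall t, time_interval T t -> continuous (u t))
  (su : sobolev_continuous s (time_interval T) u).

Definition regular (f : R -> R) (B : R) :=
  [/\ sqint f, (forall x : R, der f x (derive1 f x)),
    (forall x : R, der (derive1 f) x (derive1n 2 f x)), continuous (derive1n 2 f) &
    forall x : R, [/\ `|f x| <= B, `|derive1 f x| <= B & `|derive1n 2 f x| <= B]].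

Lemma sobolev_lt (sigma : R) (f : R -> R) : sobolev sigma f ->
  exists2 N : R, 0 < N & (sobolev_norm sigma f < N%:E)%E.
Proof.
rewrite /sobolev/=; case: (sobolev_norm _ _) => [r _|//|_].
  exists (`|r| + 1); first by rewrite ltr_wpDl.
  by rewrite lte_fin (le_lt_trans (ler_norm _))// ltrDl.
by exists 1 => //; exact: ltNyr.
Qed.

Lemma regular_slice t : time_interval T t -> exists2 B, 0 < B & regular (u t) B.
Proof.
move=> It; have [C C0 HC] := sobolev_embedding hs.
have [N N0 uN] := sobolev_lt (su It).1.
by exists (C * N); [exact: mulr_gt0|exact: HC (cu It) N0 uN].
Qed.

(** The embedding applied to the difference [u t - u t0]: its bound is linear in the H^s norm, so
    continuity in H^s becomes uniform closeness of the first two derivatives as well. *)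
Lemma uniform_time t0 e : time_interval T t0 -> 0 < e -> exists2 d, 0 < d &
  forall t, time_interval T t -> `|t - t0| < d -> forall x,
  [/\ `|u t x - u t0 x| <= e, `|derive1 (u t) x - derive1 (u t0) x| <= e &
    `|derive1n 2 (u t) x - derive1n 2 (u t0) x| <= e].
Proof.
move=> It0 e0; have [C C0 HC] := sobolev_embedding hs.
have eC : 0 < e / C by rewrite divr_gt0.
have FF : Filter (within (time_interval T) (nbhs t0)) by exact: within_filter.
have := cvge0_near_lt (su It0).2 eC.
move=> /(_ FF); rewrite near_withinE => /nbhs_ballP[d /= d0 H]; exists d => // t It td x.
have Hn : (sobolev_norm s (fun x => u t x - u t0 x)%R < (e / C)%:E)%E.
  by apply: H => //; rewrite /ball/= distrC.
have cB : continuous (fun x => u t x - u t0 x).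
  by move=> z; apply: cvgB; [exact: (cu It)|exact: (cu It0)].
have [_ _ _ _ /(_ x)] := HC _ _ cB eC Hn.
have [B _ [_ a1 a2 _ _]] := regular_slice It.
have [B0 _ [_ b1 b2 _ _]] := regular_slice It0.
have E1 : derive1 (fun x => u t x - u t0 x) = fun x => derive1 (u t) x - derive1 (u t0) x.
  by apply/funext => z; exact: der_derive1 (derB (a1 z) (b1 z)).
have E2 : derive1n 2 (fun x => u t x - u t0 x) x = derive1n 2 (u t) x - derive1n 2 (u t0) x.
  by rewrite derive1nS derive1n1 E1; exact: der_derive1 (derB (a2 x) (b2 x)).
by rewrite E2 E1 mulrC divfK ?gt_eqF.
Qed.

Lemma time_interval_le t1 t : time_interval T t1 -> 0 <= t <= t1 -> time_interval T t.
Proof. by move=> [_ tT] /andP[t0 tt1]; split => //; apply: le_lt_trans tT; rewrite lee_fin. Qed.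

(** Around each time the bound of that slice plus 1 is valid, by [uniform_time]; compactness of
    [[0, t1]] selects one bound. *)
Lemma uniform_bound t1 : time_interval T t1 ->
  exists2 B, 1 <= B & forall t, 0 <= t <= t1 -> regular (u t) B.
Proof.
move=> It1.
pose P (B t : R) := 0 <= t <= t1 -> regular (u t) B.
have : \forall B \near +oo, `[0, t1]%classic `<=` P B.
  have /compact_near_coveringP := @segment_compact R 0 t1; apply => t /=.
  rewrite in_itv/= => t01; have It := time_interval_le It1 t01.
  have [B0 B00 [_ _ _ _ uB0]] := regular_slice It.
  have [d d0 Hd] := uniform_time It ltr01.
  exists (ball t d, [set B | B0 + 1 <= B]); first split.
  - exact: nbhsx_ballx.
  - by apply: nbhs_pinfty_ge; rewrite num_real.
  move=> [t' B] /= [tt' B0B] t'01; have It' := time_interval_le It1 t'01.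
  have [B' _ [h1 h2 h3 h4 _]] := regular_slice It'; split => // x.
  have [|k1 k2 k3] := Hd t' It' _ x; first by rewrite distrC.
  have [m1 m2 m3] := uB0 x.
  have tri (a b : R) : `|a - b| <= 1 -> `|b| <= B0 -> `|a| <= B.
    move=> ab bB; apply: le_trans B0B; rewrite addrC -(subrK b a).
    by apply: (le_trans (ler_normD _ _)); exact: lerD.
  by split; [exact: tri k1 m1|exact: tri k2 m2|exact: tri k3 m3].
move=> [B1 [_ HB1]]; exists (Num.max (B1 + 1) 1); first by rewrite le_max lexx orbT.
have B1m : B1 < Num.max (B1 + 1) 1 by rewrite lt_max ltrDl ltr01.
by move=> t t01; apply: (HB1 _ B1m t) => //; rewrite /= in_itv.
Qed.

Lemma near_time t : 0 < t -> (t%:E < T)%E -> \forall r \near t, time_interval T r.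
Proof.
move=> t0 tT; have h0 : \forall r \near t, 0 < r by exact: lt_nbhsr.
have h1 : \forall r \near t, (r%:E < T)%E.
  move: tT; case: T => [b|_|//]; last by apply: (@filterE _ (nbhs t)) => r; exact: ltry.
  by rewrite lte_fin => tb; near=> r; rewrite lte_fin; near: r; exact: lt_nbhsl.
by near=> r; split; [apply: ltW; near: r|near: r].
Unshelve. all: end_near. Qed.

Variable ut : R -> R -> R.
Hypotheses (sut : sobolev_continuous (s - 1) (time_interval T) ut)
  (dut : sobolev_derivative (s - 1) (time_interval T) u ut).

(** The multiplier [phi - phi''] is a fixed test function, so by [sobolev_pairing] the convergence
    of the difference quotients in H^(s-1) passes to the pairing. *)
Lemma der_pairing (t : R) (phi : R -> R) : 0 < t -> (t%:E < T)%E -> test_function phi ->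
  der (fun r : R => \int[mu]_x (u r x * (phi x - derive1n 2 phi x))) t
    (\int[mu]_x (ut t x * (phi x - derive1n 2 phi x))).
Proof.
move=> t0 tT [phik [A0 sA0]].
have It : time_interval T t by split => //; exact: ltW.
(* Enlarging by 1 turns the strict support condition of [test_function] into the non-strict one of
   [sobolev_pairing]. *)
pose A := `|A0| + 1; have sA x : A <= `|x| -> A0 < `|x|.
  by apply: lt_le_trans; rewrite (le_lt_trans (ler_norm _))// ltrDl.
have A_ge0 : 0 <= A by rewrite addr_ge0.
have dphi k (x : R) : der (derive1n k phi) x (derive1n k.+1 phi x).
  by rewrite derive1nS; exact: derivable_der.
have cphi k : continuous (derive1n k phi) by exact: continuous_der (dphi k).
pose psi k x := derive1n k phi x - derive1n k.+2 phi x.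
have dpsi k (x : R) : der (psi k) x (psi k.+1 x) by exact: derB (dphi k x) (dphi k.+2 x).
have cpsi k : continuous (psi k) by exact: continuous_der (dpsi k).
have spsi k x : A <= `|x| -> psi k x = 0.
  by move=> /sA Ax; rewrite /psi !(derive1n_support _ sA0 Ax) subrr.
have s1 : 0 <= s - 1 by have := hs; lra.
have [C C0 HC] := sobolev_pairing A_ge0 (dpsi 0%N) (dpsi 1%N) (cpsi 2) (spsi 0%N) (spsi 1%N) (spsi 2) s1.
have psi_sq : sqint (psi 0%N).
  split; first exact: continuous_measurable_fun (cpsi 0%N).
  apply: (@continuous_support_L1 _ _ A).
    by move=> x; exact: der_cont (derX 1 (dpsi 0%N x)).
  by move=> x /ltW Ax; rewrite spsi// expr0n.
have Iu r : time_interval T r -> L1 (fun x => u r x * psi 0%N x).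
  by move=> /regular_slice[B _ [ur _ _ _ _]]; exact: L1_sqr_mul.
have Iut : L1 (fun x => ut t x * psi 0%N x).
  have [N N0 uN] := sobolev_lt (sut It).1.
  by have [ur _] := HC _ _ N0 uN; exact: L1_sqr_mul.
apply: der_little_o => e e0.
have eC : 0 < e / C by rewrite divr_gt0.
have FF : Filter (within (time_interval T `\ t) (nbhs t)) by exact: within_filter.
have := cvge0_near_lt (dut It) eC; move=> /(_ FF); rewrite near_withinE => H1.
have H2 := near_time t0 tT.
near=> r.
have Ir : time_interval T r by near: r.
have [->|rt] := eqVneq r t; first by rewrite !subrr mul0r subrr normr0 mulr0.
have Hr : (sobolev_norm (s - 1) (fun x => (u r x - u t x) / (r - t) - ut t x)%R < (e / C)%:E)%E.
  have : (time_interval T `\ t)%classic r -> (sobolev_norm (s - 1) (fun x => (u r x - u t x) / (r - t) - ut t x)%R < (e / C)%:E)%E.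
    by near: r.
  by apply; split => //; exact/eqP.
have rt0 : r - t != 0 by rewrite subr_eq0.
have [_] := HC _ _ eC Hr; rewrite mulrC divfK ?gt_eqF// => le_e.
have -> : \int[mu]_x (u r x * (phi x - derive1n 2 phi x)) - \int[mu]_x (u t x * (phi x - derive1n 2 phi x))
    - (r - t) * \int[mu]_x (ut t x * (phi x - derive1n 2 phi x)) =
  (r - t) * \int[mu]_x (((u r x - u t x) / (r - t) - ut t x) * psi 0%N x).
  rewrite -/(psi 0%N) -intB ?Iu// -intZ// -intB//; [|exact: L1B (Iu _ Ir) (Iu _ It)|exact: L1Z].
  have alg1 (a b c' p w : R) : w != 0 ->
    a * p - b * p - w * (c' * p) = w * (((a - b) / w - c') * p) by move=> w0; field.
  have alg2 (a b c' p w : R) : w^-1 * (a * p - b * p) - c' * p = ((a - b) / w - c') * p.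
    by ring.
  rewrite -intZ; first by congr Rintegral; apply/funext => x; exact: alg1.
  have := L1B (L1Z (r - t)^-1 (L1B (Iu _ Ir) (Iu _ It))) Iut.
  by congr L1; apply/funext => x; exact: alg2.
by rewrite normrM mulrC ler_wpM2r.
Unshelve. all: end_near. Qed.

End solution.

Section gmCH.
Context {R : realType}.
Variables (n : nat) (s : R) (u0 : R -> R) (T : \bar R) (u : R -> R -> R).
Hypotheses (hs : 5 / 2 < s) (sol : strong_solution n s u0 T u).

(** The maximum principle on [[0, t]] for [y], with speed [(u^2 - u_x^2)^n]. As [t < T], derivatives
    in time are two-sided up to and including [t]. *)
Lemma momentum_ge0 t : (forall x, 0 <= momentum u0 x) -> time_interval T t ->
  forall x, 0 <= momentum (u t) x.
Proof.
move=> y0 It; have [T0 cu su u00 [ut [sut dut weak]]] := sol.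
have [S [beta [Sk dS cbeta beta0 [Sl Sr]]]] := @smooth_step R.
have [t0 tT] := It.
have [B B1 HB] := uniform_bound hs cu su It.
have B0 : 0 < B by exact: lt_le_trans B1.
pose flux r x := (u r x ^+ 2 - derive1 (u r) x ^+ 2) ^+ n.
pose Q := 2 * B ^+ 2.
have Q1 : 1 <= Q by have : 1 <= B ^+ 2 := exprn_ege1 2 B1; rewrite /Q; lra.
have Q0 : 0 <= Q by exact: le_trans Q1.
(* The maximum principle takes a single bound: [Q ^+ n] is for the speed, [2 * B] for [y]. *)
pose K := Q ^+ n + 2 * B.
have K0 : 0 < K by rewrite ltr_wpDl ?exprn_ge0// mulr_gt0.
have In r : 0 <= r <= t -> time_interval T r by exact: time_interval_le.
have base_le r x : 0 <= r <= t -> `|u r x ^+ 2 - derive1 (u r) x ^+ 2| <= Q.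
  move=> /HB[_ _ _ _ /(_ x)[h1 h2 _]]; apply: (le_trans (ler_normB _ _)).
  by rewrite /Q mulr_natl mulr2n !normrX lerD// lerXn2r// nnegrE// ltW.
have flux_le r x : 0 <= r <= t -> `|flux r x| <= K.
  move=> rt; rewrite normrX (@le_trans _ _ (Q ^+ n))//.
    by rewrite lerXn2r ?nnegrE// base_le.
  by rewrite lerDl mulr_ge0 ?(ltW B0).
have y_le2 r x : 0 <= r <= t -> `|momentum (u r) x| <= 2 * B.
  move=> /HB[_ _ _ _ /(_ x)[h1 _ h2]]; apply: (le_trans (ler_normB _ _)).
  by rewrite mulr_natl mulr2n lerD.
have y_le r x : 0 <= r <= t -> `|momentum (u r) x| <= K.
  by move=> /(y_le2 _ x)/le_trans; apply; rewrite lerDr exprn_ge0.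
have cy r : time_interval T r -> continuous (momentum (u r)).
  move=> Ir x; have [_ _ [_ _ _ c2 _]] := regular_slice hs cu su Ir.
  by apply: cvgB; [exact: (cu _ Ir)|exact: c2].
have cX (f : R -> R) k : continuous f -> continuous (fun x => f x ^+ k).
  by move=> cf x; apply: (@cvg_comp _ _ _ f (fun y => y ^+ k)); [exact: cf|exact: exprn_continuous].
have cflux r : time_interval T r -> continuous (flux r).
  move=> Ir; have [_ _ [_ _ d2 _ _]] := regular_slice hs cu su Ir.
  have cb : continuous (fun x => u r x ^+ 2 - derive1 (u r) x ^+ 2).
    by move=> x; apply: cvgB; apply: cX; [exact: (cu _ Ir)|exact: continuous_der d2].
  exact: cX cb.
have uniy r e : time_interval T r -> 0 < e -> exists2 d, 0 < d &
    forall r' x, time_interval T r' -> `|r' - r| < d ->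
    `|momentum (u r') x - momentum (u r) x| <= e.
  move=> Ir e0; have e2 : 0 < e / 2 by rewrite divr_gt0.
  have [d d0 Hd] := uniform_time hs cu su Ir e2; exists d => // r' x Ir' rr'.
  have [h1 _ h2] := Hd r' Ir' rr' x.
  rewrite /momentum (_ : _ - _ = (u r' x - u r x) - (derive1n 2 (u r') x - derive1n 2 (u r) x)).
    by apply: (le_trans (ler_normB _ _)); rewrite [leRHS]splitr lerD.
  by set p := derive1n 2 _ x; set q := derive1n 2 _ x; ring.
suff H : forall r x, 0 <= r <= t -> 0 <= momentum (u r) x by move=> x; apply: H; rewrite t0 lexx.
apply: (@transport_ge0 R (fun r => momentum (u r)) flux t K K0 _ y_le flux_le).
- by move=> r rt; exact: cy (In r rt).
- move=> r e rt e0; have [d d0 Hd] := uniy r e (In r rt) e0.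
  by exists d => // r' x rt'; apply: Hd; exact: In.
- move=> r x1 x2 /andP[r0 rt] x12.
  have rt' : 0 <= r <= t by rewrite ltW.
  have Ir := In r rt'; have [_ rT] := Ir.
  have nI := near_time r0 rT.
  have nd d : 0 < d -> \forall r' \near r, `|r' - r| < d.
    by move=> d0; apply/nbhs_ballP; exists d => // z; rewrite /ball/= distrC.
  have unif e : 0 < e -> \forall r' \near r, forall x,
      [/\ `|u r' x - u r x| <= e, `|derive1 (u r') x - derive1 (u r) x| <= e &
        `|momentum (u r') x - momentum (u r) x| <= e].
    move=> e0; have [d d0 Hd] := uniform_time hs cu su Ir e0.
    have [d' d'0 Hd'] := uniy r e Ir e0.
    near=> r'; have Ir' : time_interval T r' by near: r'.
    have rd : `|r' - r| < d by near: r'; exact: nd.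
    have rd' : `|r' - r| < d' by near: r'; exact: nd.
    by move=> x; have [h1 h2 _] := Hd r' Ir' rd x; split => //; exact: Hd'.
  have cl1 : uclose (nbhs r) (fun r' => u r') (u r).
    by move=> e /unif; apply: filterS => r' H x; have [] := H x.
  have cl2 : uclose (nbhs r) (fun r' => derive1 (u r')) (derive1 (u r)).
    by move=> e /unif; apply: filterS => r' H x; have [] := H x.
  have cl3 : uclose (nbhs r) (fun r' => momentum (u r')) (momentum (u r)).
    by move=> e /unif; apply: filterS => r' H x; have [] := H x.
  have uB1 x : `|u r x| <= B by have [_ _ _ _ /(_ x)[]] := HB r rt'.
  have uB2 x : `|derive1 (u r) x| <= B by have [_ _ _ _ /(_ x)[]] := HB r rt'.
  have clflux : uclose (nbhs r) flux (flux r).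
    apply: (@ucloseX _ _ _ _ (fun r' x => u r' x ^+ 2 - derive1 (u r') x ^+ 2) _ Q n Q1).
      by move=> x; exact: base_le.
    apply: (@ucloseB _ _ _ _ (fun r' x => u r' x ^+ 2) (fun r' x => derive1 (u r') x ^+ 2)).
      exact: (@ucloseX _ _ _ _ (fun r' => u r') _ B 2 B1 uB1 cl1).
    exact: (@ucloseX _ _ _ _ (fun r' => derive1 (u r')) _ B 2 B1 uB2 cl2).
  have clk : uclose (nbhs r) (fun r' x => flux r' x * momentum (u r') x)
      (fun x => flux r x * momentum (u r) x).
    exact: (ucloseM (fun x => flux_le r x rt') (fun x => y_le r x rt') clflux cl3).
  (* Times near [r] may exceed [t], beyond the reach of the uniform bound; there [y] is within 1 of
     its slice at [r], hence the bound [K + 1]. *)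
  apply: (@weak_derivative R S beta Sk dS cbeta beta0 Sl Sr (fun r => momentum (u r))
    (fun r' x => flux r' x * momentum (u r') x) r (K + 1) x1 x2 x12) => [|e e0|].
  + have n1 := cl3 1 ltr01; near=> r'; have Ir' : time_interval T r' by near: r'.
    split; first exact: cy.
      by move=> x; apply: cvgM; [exact: (cflux _ Ir')|exact: (cy _ Ir')].
    have H : forall x, `|momentum (u r') x - momentum (u r) x| <= 1 by near: r'.
    move=> x; rewrite -(subrK (momentum (u r) x) (momentum (u r') x)) addrC.
    by apply: (le_trans (ler_normD _ _)); apply: lerD; [exact: y_le|exact: H].
  + exact: clk.
  + near=> r' => phi tphi.
    have [r'0 r'T] : 0 < r' /\ (r'%:E < T)%E.
      split; first by near: r'; exact: lt_nbhsr.
      suff [] : time_interval T r' by [].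
      by near: r'.
    have Ir' : time_interval T r' by split => //; exact: ltW.
    have D := der_pairing hs cu su sut dut r'0 r'T tphi.
    have := weak r' Ir' phi tphi => /eqP; rewrite subr_eq0 => /eqP E.
    rewrite E in D.
    apply: near_eq_is_derive D.
    have := near_time r'0 r'T; apply: filterS => q Iq.
    have [_ _ [_ a1 a2 a3 _]] := regular_slice hs cu su Iq.
    by rewrite parts_twice.
- by move=> x; rewrite u00.
Unshelve. all: end_near. Qed.

End gmCH.

Theorem lemma3p2 (R : realType) (n : nat) (s : R) (u0 : R -> R)
    (T : \bar R) (u : R -> R -> R)
    (hn : (2 <= n)%N) (hs : 5 / 2 < s) (hu0 : sobolev s u0)
    (hy0 : forall x : R, 0 <= momentum u0 x)
    (hu : maximal_strong_solution n s u0 T u)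
    (hpos : forall t x : R, 0 <= t -> (t%:E < T)%E -> 0 <= u t x) :
  forall t : R, 0 <= t -> (t%:E < T)%E ->
    n%:R * (2 - coef_c1 R n) / (n.+1)%:R * max_value (u t) ^+ (2 * n + 2)
    - (2 - coef_c1 R n) / 2 * max_value (u t) ^+ (2 * n) * energyE (u t)
    + energyF n (u t) <= 0.
Proof.
move=> t t0 tT; have It : time_interval T t by [].
have [sol _] := hu; have [_ cu su _ _] := sol.
have [B _ [[_ u2] d1 d2 _ uB]] := regular_slice hs cu su It.
apply: (sharp_inequality (B := B) n d1 (continuous_der d2) _ _ u2) => x.
  by have [] := uB x.
(* The sign of [y = u - u_xx] is the condition [v2 <= v] under which the slope is controlled by the
   height. *)
apply: (norm_derive_le (B := B) d1 d2) => z; try by have [] := uB z.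
by have := momentum_ge0 hs sol hy0 It z; rewrite subr_ge0.
Qed.
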